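(* Let $n\ge2$. The family of $2n^2$ functions $F_n=\{g_{ij},h_{ij},f_{kl},\varphi_{kl},c_1,\dots,c_{n-1}\}$ on $D(GL_n)=GL_n\times GL_n$ forms a log-canonical coordinate system with respect to the Poisson--Lie bracket $\{\cdot,\cdot\}_D$ on $D(GL_n)$.
   Context: **Functions.** Points of $D(GL_n)$ are pairs $(X,Y)$ of invertible complex $n\times n$ matrices; $U=X^{-1}Y$. For a matrix $A$, $A_I^J$ is the submatrix with rows $I$ and columns $J$ (an omitted index means all); $[a,b]=\{a,\dots,b\}$, $[a]=\{a\}$. For $k,l\ge1$, $k+l\le n-1$: $f_{kl}=\det\left[X^{[n-k+1,n]}\;Y^{[n-l+1,n]}\right]_{[n-k-l+1,n]}$. For $1\le j\le i\le n$: $g_{ij}=\det X_{[i,n]}^{[j,j+n-i]}$. For $1\le i\le j\le n$: $h_{ij}=\det Y_{[i,i+n-j]}^{[j,n]}$. For $k,l\ge1$, $k+l\le n$: $\varphi_{kl}=s_{kl}(\det X)^{n-k-l+1}\det\left[(U^0)^{[n-k+1,n]}\;U^{[n-l+1,n]}\;(U^2)^{[n]}\;\dots\;(U^{n-k-l+1})^{[n]}\right]$, where $s_{kl}=(-1)^{k(l+1)}$ for $n$ even and $s_{kl}=(-1)^{(n-1)/2+k(k-1)/2+l(l-1)/2}$ for $n$ odd. The $c_i$ are defined by $\det(X+\lambda Y)=\sum_{i=0}^n\lambda^i(-1)^{i(n-1)}c_i(X,Y)$. **Bracket.** Let $\langle A,B\rangle=\operatorname{Tr}(AB)$ on $\mathfrak{gl}_n$,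 let $\pi_{>0},\pi_0$ be the projections on strictly upper triangular and diagonal parts, $R_+=\pi_{>0}+\frac12\pi_0$, $\nabla_Xf=(\partial f/\partial x_{ji})_{i,j}$, $\nabla_Yf=(\partial f/\partial y_{ji})_{i,j}$, $E_Rf=X\nabla_Xf+Y\nabla_Yf$, $E_Lf=\nabla_Xf\cdot X+\nabla_Yf\cdot Y$, and $$\{f_1,f_2\}_D=\langle R_+(E_Lf_1),E_Lf_2\rangle-\langle R_+(E_Rf_1),E_Rf_2\rangle+\langle E_Rf_1,Y\nabla_Yf_2\rangle-\langle E_Lf_1,\nabla_Yf_2\cdot Y\rangle.$$ **Log-canonical coordinate system.** A transcendence basis of $\mathbb C(D(GL_n))$ such that any two of its elements $x,x'$ satisfy $\{x,x'\}_D=\omega\,xx'$ with a constant $\omega\in\mathbb Q$ depending on the pair. *)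

(* Defs.v *)
From HB Require Import structures.
From mathcomp Require Import all_boot all_order all_algebra.
From mathcomp Require Import complex mpoly reals ring.

Set Implicit Arguments.
Unset Strict Implicit.
Unset Printing Implicit Defensive.

Import GRing.Theory.
Local Open Scope ring_scope.

(* All row and column labels below are 1-based, as on paper; the label of
   i : 'I_n is i.+1. Enumeration of a {set 'I_n} is increasing, so [submx A I J]
   keeps the order of the rows and columns of A. *)

Definition itv (n a b : nat) : {set 'I_n} := [set i : 'I_n | a <= i.+1 <= b]%N.

Definition submx (K : Type) (n m : nat) (A : 'M[K]_(n, m))
    (I : {set 'I_n}) (J : {set 'I_m}) : 'M[K]_(#|I|, #|J|) :=
  mxsub (enum_val (A := I)) (enum_val (A := J)) A.

Definition rowsubmx (K : Type) (n m : nat) (A : 'M[K]_(n, m)) (I : {set 'I_n}) :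
    'M[K]_(#|I|, m) :=
  rowsub (enum_val (A := I)) A.

Definition colsubmx (K : Type) (n m : nat) (A : 'M[K]_(n, m)) (J : {set 'I_m}) :
    'M[K]_(n, #|J|) :=
  colsub (enum_val (A := J)) A.

(* The minors below are square only up to a propositional equality of
   dimensions; [conform_mx] performs the cast. The value for a genuinely
   rectangular matrix is junk and is never used in the admissible index range. *)
Definition rdet (K : comNzRingType) (m p : nat) (A : 'M[K]_(m, p)) : K :=
  \det (conform_mx (0 : 'M[K]_m) A).

Section Functions.
Variables (K : fieldType) (n : nat) (X Y : 'M[K]_n).

Definition fun_f (k l : nat) : K :=
  rdet (rowsubmx (row_mx (colsubmx X (itv n (n - k).+1 n))
                         (colsubmx Y (itv n (n - l).+1 n)))
                 (itv n (n - k - l).+1 n)).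

Definition fun_g (i j : nat) : K :=
  rdet (submx X (itv n i n) (itv n j (j + n - i))).

Definition fun_h (i j : nat) : K :=
  rdet (submx Y (itv n i (i + n - j)) (itv n j n)).

Definition mxU : 'M[K]_n := invmx X *m Y.

Definition sgn_phi (k l : nat) : K :=
  if odd n then (-1) ^+ ((n.-1)./2 + (k * k.-1)./2 + (l * l.-1)./2)
  else (-1) ^+ (k * l.+1).

(* The last block is [(U^2)^[n] ... (U^(n-k-l+1))^[n]], of width n - k - l. *)
Definition fun_phi (k l : nat) : K :=
  sgn_phi k l * (\det X) ^+ (n - k - l).+1 *
  rdet (row_mx (row_mx (colsubmx (mxU ^+ 0) (itv n (n - k).+1 n))
                       (colsubmx mxU (itv n (n - l).+1 n)))
               (\mxrow_(t < n - k - l) colsubmx (mxU ^+ t.+2) (itv n n n))).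

(* det (X + lambda Y), as a polynomial in lambda = 'X *)
Definition pencil_det : {poly K} :=
  \det (map_mx polyC X + 'X *: map_mx polyC Y).

Definition fun_c (i : nat) : K := (-1) ^+ (i * n.-1) * pencil_det`_i.

Definition family_F : seq K :=
  [seq fun_g i j | i <- index_iota 1 n.+1, j <- index_iota 1 i.+1]
  ++ [seq fun_h i j | i <- index_iota 1 n.+1, j <- index_iota i n.+1]
  ++ [seq fun_f k l | k <- index_iota 1 n, l <- index_iota 1 (n - k)]
  ++ [seq fun_phi k l | k <- index_iota 1 n, l <- index_iota 1 (n - k).+1]
  ++ [seq fun_c i | i <- index_iota 1 n].

End Functions.

(* The (-1)^(i(n-1)) in the defining expansion of the c_i is its own inverse. *)
Lemma pencil_detE (K : fieldType) (n : nat) (X Y : 'M[K]_n) :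
  pencil_det X Y =
  \sum_(i < n.+1) ((-1) ^+ (i * n.-1) * fun_c X Y i) *: 'X^i.
Proof.
have sz : (size (pencil_det X Y) <= n.+1)%N.
  rewrite /pencil_det /determinant.
  apply: (leq_trans (size_sum _ _ _)); apply/bigmax_leqP => s _.
  rewrite -polyC1 -polyCN -polyC_exp mul_polyC.
  apply: (leq_trans (size_scale_leq _ _)).
  apply: (leq_trans (size_poly_prod_leq _ _)).
  rewrite leq_subLR cardT size_enum_ord.
  have -> : (n + n.+1 = (\sum_(i < n) 2).+1)%N.
    by rewrite sum_nat_const card_ord muln2 addnS addnn.
  rewrite ltnS; apply: leq_sum => i _; rewrite !mxE.
  apply: (leq_trans (size_polyD _ _)); rewrite geq_max.
  rewrite (leq_trans (size_polyC_leq1 _)) //=.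
  by rewrite mulrC mul_polyC (leq_trans (size_scale_leq _ _)) ?size_polyX.
rewrite -(poly_def n.+1 (fun i => (-1) ^+ (i * n.-1) * fun_c X Y i)).
apply/polyP => j; rewrite coef_poly ltnS.
case: (leqP j n) => [_|lt_nj]; last by rewrite nth_default ?(leq_trans sz).
by rewrite /fun_c mulrA -exprD addnn -mul2n exprM sqrrN !expr1n mul1r.
Qed.

(* The function field C(D(GL_n)), i.e. rational functions in the 2n^2 entries
   x_ij, y_ij, since D(GL_n) is open and dense in the space of pairs of n x n
   matrices. *)
Section FunctionField.
Variables (C : fieldType) (n : nat).

Definition coord_ring : idomainType := {mpoly C[n * n + n * n]}.
Definition funfield : fieldType := {fraction coord_ring}.

Definition funconst : {rmorphism C -> funfield} :=
  @tofrac coord_ring \o @mpolyC (n * n + n * n) C.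

Definition xidx (i j : 'I_n) : 'I_(n * n + n * n) := lshift _ (mxvec_index i j).
Definition yidx (i j : 'I_n) : 'I_(n * n + n * n) := rshift _ (mxvec_index i j).

(* The generic point (X, Y) of D(GL_n). *)
Definition genX : 'M[funfield]_n := \matrix_(i, j) tofrac ('X_(xidx i j) : coord_ring).
Definition genY : 'M[funfield]_n := \matrix_(i, j) tofrac ('X_(yidx i j) : coord_ring).

(* Quotient rule on the representative of a fraction; [fracderiv_div] shows that
   the choice of the representative is irrelevant. *)
Definition fracderiv (v : 'I_(n * n + n * n)) (q : funfield) : funfield :=
  let a : coord_ring := \n_(repr q) in
  let b : coord_ring := \d_(repr q) in
  tofrac (mderiv v a * b - a * mderiv v b : coord_ring) / tofrac (b ^+ 2).

Definition gradX (f : funfield) : 'M[funfield]_n :=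
  \matrix_(i, j) fracderiv (xidx j i) f.
Definition gradY (f : funfield) : 'M[funfield]_n :=
  \matrix_(i, j) fracderiv (yidx j i) f.

Definition trform (A B : 'M[funfield]_n) : funfield := \tr (A *m B).

Definition pi_pos (A : 'M[funfield]_n) : 'M[funfield]_n :=
  \matrix_(i, j) (if (i < j)%N then A i j else 0).
Definition pi_diag (A : 'M[funfield]_n) : 'M[funfield]_n :=
  \matrix_(i, j) (if i == j then A i j else 0).
Definition Rplus (A : 'M[funfield]_n) : 'M[funfield]_n :=
  pi_pos A + 2%:R^-1 *: pi_diag A.

Definition E_R (f : funfield) : 'M[funfield]_n := genX *m gradX f + genY *m gradY f.
Definition E_L (f : funfield) : 'M[funfield]_n := gradX f *m genX + gradY f *m genY.

Definition bracketD (f1 f2 : funfield) : funfield :=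
  trform (Rplus (E_L f1)) (E_L f2) - trform (Rplus (E_R f1)) (E_R f2)
  + trform (E_R f1) (genY *m gradY f2) - trform (E_L f1) (gradY f2 *m genY).

End FunctionField.

Lemma frac_reprE (R : idomainType) (q : {fraction R}) :
  q = tofrac \n_(repr q) / tofrac \d_(repr q).
Proof.
have d0 : tofrac \d_(repr q) != 0 by rewrite tofrac_eq0 denom_ratioP.
apply: (mulIf d0); rewrite divfK // -{1}[q]reprK; unlock FracField.tofrac.
rewrite -[LHS]FracField.pi_mul; apply/eqmodP => /=.
rewrite FracField.equivfE /FracField.mulf !numden_Ratio ?oner_neq0
  ?mulf_neq0 ?oner_neq0 ?denom_ratioP //=.
by rewrite !mulr1 mulrC.
Qed.

Lemma quotient_rule_aux (R : comNzRingType) (a b a' b' da db da' db' : R) :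
  a * b' = a' * b -> da * b' + a * db' = da' * b + a' * db ->
  (da' * b' - a' * db') * b ^+ 2 = (da * b - a * db) * b' ^+ 2.
Proof.
move=> e1 e2.
have -> : (da' * b' - a' * db') * b ^+ 2 =
  (da' * b + a' * db) * (b * b') - (a' * b) * (db * b' + db' * b) by ring.
by rewrite -e2 -e1; ring.
Qed.

Lemma fracderiv_div (C : fieldType) (n : nat) (v : 'I_(n * n + n * n))
    (a b : coord_ring C n) : b != 0 ->
  fracderiv v (tofrac a / tofrac b : funfield C n) =
  tofrac (mderiv v a * b - a * mderiv v b : coord_ring C n) / tofrac (b ^+ 2).
Proof.
move=> b0; rewrite /fracderiv; set q := tofrac a / tofrac b.
set a' := \n_(repr q); set b' := \d_(repr q).
have b'0 : b' != 0 by exact: denom_ratioP.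
have qE : q = tofrac a' / tofrac b' by exact: frac_reprE.
have ab : a * b' = a' * b.
  apply/eqP; rewrite -tofrac_eq !tofracM -eqr_div ?tofrac_eq0 //.
  by rewrite -/q qE.
have dab : mderiv v a * b' + a * mderiv v b' = mderiv v a' * b + a' * mderiv v b.
  by rewrite -!mderivM ab.
apply/eqP; rewrite eqr_div ?tofrac_eq0 ?expf_neq0 // -!tofracM tofrac_eq.
apply/eqP; exact: quotient_rule_aux.
Qed.

Section TranscendenceBasis.
Variables (k K : fieldType) (iota : {rmorphism k -> K}).

Definition evalfam (s : seq K) (p : {mpoly k[size s]}) : K :=
  mmap iota (fun i => tnth (in_tuple s) i) p.

(* Independence is that of s as a family: a repeated element violates it. *)
Definition alg_independent (s : seq K) : Prop :=
  forall p : {mpoly k[size s]}, evalfam p = 0 -> p = 0.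

(* z belongs to the subfield k(s) of K *)
Definition in_gen_field (s : seq K) (z : K) : Prop :=
  exists p q : {mpoly k[size s]}, evalfam q != 0 /\ z = evalfam p / evalfam q.

Definition algebraic_over_gen (s : seq K) (z : K) : Prop :=
  exists p : {poly K},
    [/\ p != 0, (forall i, in_gen_field s p`_i) & root p z].

Definition transcendence_basis (s : seq K) : Prop :=
  alg_independent s /\ forall z : K, algebraic_over_gen s z.

End TranscendenceBasis.

Definition log_canonical_system (C : fieldType) (n : nat)
    (s : seq (funfield C n)) : Prop :=
  transcendence_basis (funconst C n) s /\
  forall x x', x \in s -> x' \in s ->
    exists w : rat, bracketD x x' = ratr w * (x * x').

(* Main.v *)
Require Import Defs.
From mathcomp Require Import all_boot all_order all_algebra.
From mathcomp Require Import perm.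
From mathcomp Require Import complex mpoly reals zify ring.

Set Implicit Arguments.
Unset Strict Implicit.
Unset Printing Implicit Defensive.
Import GRing.Theory.
Local Open Scope ring_scope.

(** The proof works with logarithmic gradients. If [(a, b)] is the gradient of
   [log f] in [(X, Y)], then [E_R], [E_L] of [log f] are [X a + Y b], [a X + b Y],
   and the bracket of two functions is their product times a bilinear expression
   [log_bracket] in the logarithmic gradients. Log-canonicity says that this
   expression is a rational constant; it turns out to be half an integer.

   Log-canonicity. The functions [g], [h], [f] are determinants whose rows and
   columns are selected from [X] and [Y], so their logarithmic gradients consist of
   pieces of inverse matrices. Multiplied by [X] or [Y], these pieces become
   projections onto or along coordinate subspaces ([minor_grad],
   [mixed_minor_grad]). They have diagonal entries 0 and 1, and they are triangular
   when the last rows or columns are selected. The trace of the product of two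
   triangular matrices of the same shape with integer diagonals is an integer, and
   [R_+] keeps half of it; this settles the brackets between [g], [h], [f], except
   that for two [g] and for two [h] one also has to compare projections onto two
   intervals of coordinates ([pos_part_interval]). A function [phi] is a power of
   [det X] times a determinant [psi] of [U = X^-1 Y]. Its [E_R] is scalar, because
   left translations fix [U], and its [E_L] is a scalar plus the commutator of [U]
   with the logarithmic gradient of [psi]. The inverse of the matrix defining [psi],
   cut into blocks, shows that this commutator is lower triangular with integer
   diagonal ([psi_comm], [psi_low_lower]) and that the remaining trace in the
   bracket of two functions [phi] is an integer ([isint_psi_pair]). Each [c_i] is a
   Casimir function: a translation by [A] on either side multiplies the determinant
   of the pencil infinitesimally by the trace of [A] ([fun_c_casimir]).

   Transcendence basis. By the Jacobian criterion ([jacobian_independent]) the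
   family is algebraically independent if a derivation [d] that kills all its
   members kills [X] and [Y] ([family_killed]). Killing the [g] and the [h], which
   are solid minors on the last rows of [X] and on the last columns of [Y], leaves
   [dX = A X] and [dY = Y B] with [A] strictly upper and [B] strictly lower
   triangular ([minors_killed_rows]). Next, [U] is conjugate under a unipotent lower
   triangular matrix to a Hessenberg matrix [H] whose Krylov matrix is triangular
   ([hessenberg_form]). The functions [psi] do not see the conjugation ([psi_conj]),
   and on [H] they are, up to sign, leading minors of the Krylov matrix times solid
   minors of a block of [H]. Killing them together with the coefficients of the
   pencil kills [H] ([hessenberg_killed]), so that [dU] is the commutator of a
   strictly lower triangular [Om] with [U]. Then [E = A + X Om X^-1] satisfies
   [E X = dX + X Om] and [E Y = dY + Y Om]. Killing the [f] makes [E] orthogonal to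
   the projections on the spans of the last columns of [X] and [Y], which forces
   [E] to be strictly upper triangular ([projections_separate]). As
   [E Y = Y (B + Om)], uniqueness of triangular factorisations gives [E = 0]
   ([big_cell_transversal]), and the same argument applied to [dX = - X Om] gives
   [A = 0], then [Om = 0] and [dY = 0].

   Independence requires that the functions involved do not vanish, which is checked
   at well-chosen points with permutation-like matrices. Finally the family has as
   many members as there are coordinates, and more rational functions than variables
   are always dependent, by counting monomials ([monomials_dependent]). *)

(** * Derivations of commutative rings and their action on determinants *)

Definition derivation (R : comNzRingType) (d : R -> R) : Prop :=
  (forall x y, d (x + y) = d x + d y) /\
  (forall x y, d (x * y) = d x * y + x * d y).

Section Derivation.
Variables (R : comNzRingType) (d : R -> R).
Hypothesis dP : derivation d.

Lemma derD x y : d (x + y) = d x + d y. Proof. exact: dP.1. Qed.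
Lemma derM x y : d (x * y) = d x * y + x * d y. Proof. exact: dP.2. Qed.

Lemma der0 : d 0 = 0.
Proof. by apply: (addrI (d 0)); rewrite -derD !addr0. Qed.

Lemma derN x : d (- x) = - d x.
Proof. by apply/eqP; rewrite -subr_eq0 opprK -derD addNr der0. Qed.

Lemma der1 : d 1 = 0.
Proof.
by apply: (addrI (d 1)); rewrite addr0 -{3}[1]mulr1 derM mulr1 mul1r.
Qed.

Lemma der_bool (b : bool) : d b%:R = 0.
Proof. by case: b; rewrite ?der0 ?der1. Qed.

Lemma der_sign k : d ((-1) ^+ k) = 0.
Proof. by rewrite -signr_odd; case: odd; rewrite ?expr0 ?expr1 ?derN der1 ?oppr0. Qed.

Lemma der_sum I (r : seq I) P (F : I -> R) :
  d (\sum_(i <- r | P i) F i) = \sum_(i <- r | P i) d (F i).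
Proof. by apply: big_morph; [exact: derD|exact: der0]. Qed.

Lemma der_exp0 x k : d x = 0 -> d (x ^+ k) = 0.
Proof.
by move=> dx; elim: k => [|k IH]; rewrite ?expr0 ?der1 // exprS derM dx IH mul0r mulr0 addr0.
Qed.

Lemma der_prod (I : finType) (F : I -> R) :
  d (\prod_i F i) = \sum_i d (F i) * \prod_(j | j != i) F j.
Proof.
suff H (s : seq I) : uniq s ->
    d (\prod_(i <- s) F i) =
    \sum_(i <- s) d (F i) * \prod_(j <- s | j != i) F j.
  by rewrite H // index_enum_uniq.
elim: s => [|a s IH] /=; first by rewrite !big_nil der1.
case/andP=> nas us; rewrite !big_cons eqxx /= derM IH //; congr (_ * _ + _).
  rewrite [RHS]big_seq_cond [LHS]big_seq_cond; apply: eq_bigl => i.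
  case si: (i \in s) => //=.
  by rewrite (contraNneq _ nas) // => <-.
rewrite big_distrr /= !big_seq; apply: eq_bigr => i si.
rewrite big_cons (_ : a != i); first by rewrite mulrCA.
by apply: contraNneq nas => ->.
Qed.

Lemma map_mx_derM m n p (A : 'M[R]_(m, n)) (B : 'M[R]_(n, p)) :
  map_mx d (A *m B) = map_mx d A *m B + A *m map_mx d B.
Proof.
apply/matrixP=> i j; rewrite !mxE der_sum -big_split /=.
by apply: eq_bigr => k _; rewrite !mxE derM.
Qed.

Lemma map_mx_der1 n : map_mx d (1%:M : 'M[R]_n) = 0.
Proof. by apply/matrixP=> i j; rewrite !mxE der_bool. Qed.

(** Jacobi's formula. *)
Lemma der_det n (A : 'M[R]_n) : d (\det A) = \tr (\adj A *m map_mx d A).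
Proof.
have -> : d (\det A) = \sum_i \det (\matrix_(a, b) if a == i then d (A a b) else A a b).
  rewrite /determinant der_sum exchange_big /=; apply: eq_bigr => s _.
  rewrite derM der_sign mul0r add0r der_prod big_distrr /=; apply: eq_bigr => i _.
  congr (_ * _); rewrite [RHS](bigD1 i) //= mxE eqxx; congr (_ * _).
  by apply: eq_bigr => j /negPf ji; rewrite mxE ji.
rewrite mxtrace_mulC /mxtrace; apply: eq_bigr => i _.
rewrite (expand_det_row _ i) [RHS]mxE; apply: eq_bigr => j _.
rewrite !mxE eqxx; congr (_ * _).
rewrite /cofactor; congr (_ * \det _); apply/matrixP => a b.
by rewrite !mxE eq_sym (negPf (neq_lift _ _)).
Qed.

End Derivation.

(** * Determinants of matrices that are square up to an equality of sizes *)

Section Rdet.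
Variable K : fieldType.

Lemma rdet_sq n (A : 'M[K]_n) : rdet A = \det A.
Proof. by rewrite /rdet conform_mx_id. Qed.

Lemma rdet_entry m p r (A : 'M[K]_(m, p)) (B : 'M[K]_r) :
  m = r -> p = r ->
  (forall (i j : 'I_r) (i' : 'I_m) (j' : 'I_p), i = i' :> nat -> j = j' :> nat -> A i' j' =
    B i j) ->
  rdet A = \det B.
Proof.
move=> e1 e2; subst m p => AB; rewrite rdet_sq; congr (\det _).
by apply/matrixP => i j; apply: AB.
Qed.

Lemma rdet_inv m p (A : 'M[K]_(m, p)) : m = p -> rdet A != 0 ->
  exists2 B : 'M[K]_(p, m), A *m B = 1%:M & B *m A = 1%:M.
Proof.
move=> e; subst p; rewrite rdet_sq -unitfE => uA.
by exists (invmx A); [rewrite mulmxV|rewrite mulVmx].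
Qed.

Lemma rdet_der (d : K -> K) m p (A : 'M[K]_(m, p)) (B : 'M[K]_(p, m)) :
  derivation d -> m = p -> B *m A = 1%:M ->
  d (rdet A) = \tr (B *m map_mx d A) * rdet A.
Proof.
move=> dP e; subst p; rewrite rdet_sq => BA.
have uA : A \in unitmx by have [] := mulmx1_unit BA.
have -> : B = (\det A)^-1 *: \adj A.
  by rewrite -[B]mulmx1 -(mulmxV uA) mulmxA BA mul1mx /invmx uA.
rewrite (der_det dP) -scalemxAl mxtraceZ mulrAC mulVf ?mul1r //.
by rewrite -unitfE -unitmxE.
Qed.
End Rdet.

(** * Selecting consecutive rows *)

Definition ei (R : comNzRingType) n b : 'cV[R]_n := \col_a (a == b :> nat)%:R.
Arguments ei {R n}.

Section Sel.
Variables (K : fieldType) (n : nat).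
Local Notation ei := (@ei K n).

(** Multiplication by [Sel r s] on the left keeps the [r] rows starting at the
   row of index [s], counted from 0. *)
Definition Sel r s : 'M[K]_(r, n) := \matrix_(i, a) (a == s + i :> nat)%N%:R.

(** The projection on the coordinates from [s] to [s + r - 1]. *)
Definition Pi r s : 'M[K]_n :=
  \matrix_(a, b) ((a == b) && (s <= a < s + r)%N)%:R.

Lemma Sel_mul p r s (A : 'M[K]_(n, p)) (i : 'I_r) (a : 'I_n) j :
  a = (s + i)%N :> nat -> (Sel r s *m A) i j = A a j.
Proof.
move=> ea; rewrite mxE (bigD1 a) //= mxE ea eqxx mul1r big1 ?addr0 // => b ba.
by rewrite mxE -ea val_eqE (negPf ba) mul0r.
Qed.

Lemma mul_SelT p r s (A : 'M[K]_(p, n)) i (j : 'I_r) (a : 'I_n) :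
  a = (s + j)%N :> nat -> (A *m (Sel r s)^T) i j = A i a.
Proof.
by move=> ea; rewrite -[A]trmxK -trmx_mul mxE (Sel_mul _ _ ea) !mxE.
Qed.

Lemma mul_ei p (A : 'M[K]_(p, n)) i j (a : 'I_n) : (A *m ei a) i j = A i a.
Proof.
rewrite mxE (bigD1 a) //= mxE eqxx mulr1 big1 ?addr0 // => b ba.
by rewrite mxE val_eqE (negPf ba) mulr0.
Qed.

Lemma SelT_out p r s (A : 'M[K]_(r, p)) (a : 'I_n) j :
  ~~ (s <= a < s + r)%N -> ((Sel r s)^T *m A) a j = 0.
Proof.
move=> H; rewrite mxE big1 // => i _; rewrite !mxE.
case: eqP => [e|_]; last by rewrite mul0r.
by case/negP: H; have := ltn_ord i; lia.
Qed.

Lemma Sel_SelT r s : (s + r <= n)%N -> Sel r s *m (Sel r s)^T = 1%:M.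
Proof.
move=> le; apply/matrixP => i j.
have lt : (s + j < n)%N by have := ltn_ord j; lia.
rewrite (@mul_SelT _ _ _ _ _ _ (Ordinal lt)) // !mxE /= eqn_add2l.
by rewrite eq_sym.
Qed.

Lemma SelT_Sel r s : (Sel r s)^T *m Sel r s = Pi r s.
Proof.
apply/matrixP => a b; case: (boolP (s <= a < s + r)%N) => H; last first.
  by rewrite SelT_out // mxE (negPf H) andbF.
have lt : (a - s < r)%N by lia.
rewrite mxE (bigD1 (Ordinal lt)) //= !mxE /= subnKC; last by lia.
rewrite eqxx mul1r H andbT big1 ?addr0 => [|i ne]; first by rewrite eq_sym.
rewrite !mxE; case: eqP => [e|_]; last by rewrite mul0r.
by case/negP: ne; apply/eqP/val_inj => /=; lia.
Qed.

Lemma Pi_mul r s p (A : 'M[K]_(n, p)) a j :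
  (Pi r s *m A) a j = if (s <= a < s + r)%N then A a j else 0.
Proof.
rewrite mxE (bigD1 a) //= mxE eqxx /= big1 => [|b ba].
  by case: ifP; rewrite ?mul1r ?mul0r addr0.
by rewrite mxE eq_sym (negPf ba) mul0r.
Qed.

Lemma tr_Pi r s : (Pi r s)^T = Pi r s.
Proof.
apply/matrixP => a b; rewrite !mxE; congr (_%:R); rewrite eq_sym.
by case: eqP => // ->.
Qed.

Lemma mul_Pi r s p (A : 'M[K]_(p, n)) i b :
  (A *m Pi r s) i b = if (s <= b < s + r)%N then A i b else 0.
Proof. by rewrite -tr_Pi -[A]trmxK -trmx_mul mxE Pi_mul !mxE. Qed.

Lemma Pi_full s r : s = 0%N -> r = n -> Pi r s = 1%:M.
Proof.
move=> -> ->; apply/matrixP => a b; rewrite !mxE /= ltn_ord andbT.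
by [].
Qed.

Lemma Sel1 : Sel n 0 = 1%:M.
Proof. by apply/matrixP => i j; rewrite !mxE add0n val_eqE eq_sym. Qed.

Lemma mul_Pi_SelT r s : (s + r <= n)%N -> Pi r s *m (Sel r s)^T = (Sel r s)^T.
Proof. by move=> le; rewrite -SelT_Sel -mulmxA Sel_SelT // mulmx1. Qed.

Lemma Sel_mul_Pi r s : (s + r <= n)%N -> Sel r s *m Pi r s = Sel r s.
Proof. by move=> le; rewrite -SelT_Sel mulmxA Sel_SelT // mul1mx. Qed.

Lemma der_Sel d r s : derivation d -> map_mx d (Sel r s) = 0.
Proof. by move=> dP; apply/matrixP => i j; rewrite !mxE der_bool. Qed.

Lemma der_SelT d r s : derivation d -> map_mx d (Sel r s)^T = 0.
Proof. by move=> dP; apply/matrixP => i j; rewrite !mxE der_bool. Qed.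

Lemma der_ei d b : derivation d -> map_mx d (ei b) = 0.
Proof. by move=> dP; apply/matrixP => i j; rewrite !mxE der_bool. Qed.

Lemma card_itv a b : (0 < a)%N -> (b <= n)%N -> #|itv n a b| = (b.+1 - a)%N.
Proof.
move=> a0 bn.
have -> : #|itv n a b| = #|[set i : 'I_n | (a.-1 <= i < b)%N]|.
  by apply: eq_card => i; rewrite !inE; lia.
rewrite cardsE cardE /enum_mem size_filter -[Finite.enum _]enumT.
rewrite -(@count_map _ _ val (fun i => (a.-1 <= i < b)%N)) val_enum_ord.
elim: (n) bn => [|m IH] bn; first by rewrite /=; lia.
rewrite -(addn1 m) iotaD count_cat /= add0n addn0.
case: (leqP b m) => bm; first by rewrite IH //; lia.
have -> : b = m.+1 by lia.
suff -> : count (fun i => a.-1 <= i < m.+1)%N (iota 0 m) = (m - a.-1)%N by lia.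
elim: (m) => // p IH2; rewrite -(addn1 p) iotaD count_cat /= add0n addn0.
have -> : count (fun i => a.-1 <= i < (p + 1).+1)%N (iota 0 p) =
          count (fun i => a.-1 <= i < p.+1)%N (iota 0 p).
  by apply: eq_in_count => i; rewrite mem_iota; lia.
by rewrite IH2; lia.
Qed.

Lemma enum_val_itv a b (i : 'I_#|itv n a b|) : (0 < a)%N -> (b <= n)%N ->
  enum_val i = (a.-1 + i)%N :> nat.
Proof.
move=> a0 bn; have lti := ltn_ord i; rewrite {2}card_itv // in lti.
pose x0 := enum_val i.
have srt : map val (enum (itv n a b)) = iota a.-1 (b.+1 - a).
  apply: (@irr_sorted_eq _ ltn).
  - exact: ltn_trans.
  - by move=> x; rewrite /= ltnn.
  - rewrite /enum_mem -[Finite.enum _]enumT.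
    rewrite sorted_map; apply: sorted_filter; first by move=> x y z; exact: ltn_trans.
    by rewrite -sorted_map val_enum_ord iota_ltn_sorted.
  - exact: iota_ltn_sorted.
  move=> x; rewrite mem_iota; apply/mapP/idP => [[y]|H].
    by rewrite mem_enum inE => H -> /=; lia.
  have xn : (x < n)%N by lia.
  by exists (Ordinal xn) => //; rewrite mem_enum inE /=; lia.
rewrite (enum_val_nth x0).
rewrite -(nth_map _ 0%N val) -?cardE // srt nth_iota //.
Qed.

End Sel.
Arguments Sel {K n}.
Arguments Pi {K n}.

(** * The five families of functions in terms of row selections *)

Section Bridge.
Variables (K : fieldType) (n : nat).

(** The solid minor of order [r] whose upper left corner is the entry [(s, t)],
   counted from 0. *)
Definition minor r s t (X : 'M[K]_n) : K := \det (Sel r s *m X *m (Sel r t)^T).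

Definition mixed_cols (X Y : 'M[K]_n) k l : 'M[K]_(n, k + l) :=
  row_mx (X *m (Sel k (n - k))^T) (Y *m (Sel l (n - l))^T).

(** This is [fun_f] for positive [k] and [l]; for [k = 0] or [l = 0] it is a trailing
   minor of a single matrix, which lets the functions [g], [h], [f] be treated
   together. *)
Definition mixed_minor (X Y : 'M[K]_n) k l : K :=
  \det (Sel (k + l) (n - (k + l)) *m mixed_cols X Y k l).

Definition psi_mx (U : 'M[K]_n) k l : 'M[K]_(n, k + l + (n - k - l)) :=
  row_mx (row_mx (Sel k (n - k))^T (U *m (Sel l (n - l))^T))
         (\matrix_(a, t) (U ^+ t.+2 *m ei n.-1) a 0).

Definition psi (U : 'M[K]_n) k l : K := rdet (psi_mx U k l).

Lemma minor_full (A : 'M[K]_n) : minor n 0 0 A = \det A.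
Proof. by rewrite /minor Sel1 mul1mx trmx1 mulmx1. Qed.

Lemma minor_empty s t (A : 'M[K]_n) : minor 0 s t A = 1.
Proof. by rewrite /minor det_mx00. Qed.

Lemma fun_g_minor (X : 'M[K]_n) i j : (0 < j)%N -> (j <= i)%N -> (i <= n)%N ->
  fun_g X i j = minor (n.+1 - i) i.-1 j.-1 X.
Proof.
move=> j0 ji ni; apply: rdet_entry; rewrite ?card_itv //; try lia.
move=> a b a' b' ea eb; rewrite /submx mxE.
have la := ltn_ord a; have lb := ltn_ord b.
rewrite (@mul_SelT _ _ _ _ _ _ _ _ (enum_val b')) ?enum_val_itv ?eb //; try lia.
by rewrite (@Sel_mul _ _ _ _ _ _ _ (enum_val a')) ?enum_val_itv ?ea //; lia.
Qed.

Lemma fun_h_minor (Y : 'M[K]_n) i j : (0 < i)%N -> (i <= j)%N -> (j <= n)%N ->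
  fun_h Y i j = minor (n.+1 - j) i.-1 j.-1 Y.
Proof.
move=> j0 ji ni; apply: rdet_entry; rewrite ?card_itv //; try lia.
move=> a b a' b' ea eb; rewrite /submx mxE.
have la := ltn_ord a; have lb := ltn_ord b.
rewrite (@mul_SelT _ _ _ _ _ _ _ _ (enum_val b')) ?enum_val_itv ?eb //; try lia.
by rewrite (@Sel_mul _ _ _ _ _ _ _ (enum_val a')) ?enum_val_itv ?ea //; lia.
Qed.

Lemma fun_fE (X Y : 'M[K]_n) k l : (0 < k)%N -> (0 < l)%N -> (k + l <= n)%N ->
  fun_f X Y k l = mixed_minor X Y k l.
Proof.
move=> k0 l0 kl.
have ck : #|itv n (n - k).+1 n| = k by rewrite card_itv //; lia.
have cl : #|itv n (n - l).+1 n| = l by rewrite card_itv //; lia.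
apply: rdet_entry; rewrite ?ck ?cl ?card_itv //; try lia.
move=> a b a' b' ea eb; rewrite /rowsubmx mxE.
have la := ltn_ord a; have lb := ltn_ord b.
rewrite (@Sel_mul _ _ _ _ _ _ _ (enum_val a')) ?enum_val_itv ?ea //; try lia.
rewrite !mxE; case: splitP => c ec; case: splitP => e ee;
  have lc := ltn_ord c; have le := ltn_ord e.
- rewrite (@mul_SelT _ _ _ _ _ _ _ _ (enum_val c)) ?enum_val_itv //; try lia.
  by rewrite /colsubmx mxE.
- by lia.
- by lia.
- rewrite (@mul_SelT _ _ _ _ _ _ _ _ (enum_val c)) ?enum_val_itv //; try lia.
  by rewrite /colsubmx mxE.
Qed.

Lemma val_sig1_const1 m (p : 'I_m -> nat) (k : 'I_(\sum_i p i)) :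
  (forall i, p i = 1%N) -> tagnat.sig1 k = k :> nat.
Proof.
move=> p1; rewrite [RHS]tagnat.rect.
have := leq_trans (ltn_ord (tagnat.sig2 k)) (eq_leq (p1 _)).
rewrite ltnS leqn0 => /eqP ->; rewrite addn0 (eq_bigr (fun _ => 1%N)) => [|i _]; last exact: p1.
rewrite -(big_ord_widen m (fun _ => 1%N)) ?sum_nat_const ?card_ord ?muln1 //.
exact/ltnW/ltn_ord.
Qed.

Lemma eq_mx_cast m p k (A : 'M[K]_(m, p)) (B : 'M[K]_(m, k)) (e : p = k) :
  (forall i (j : 'I_k) (j' : 'I_p), j = j' :> nat -> A i j' = B i j) ->
  castmx (erefl m, e) A = B.
Proof.
by subst k => AB; rewrite castmx_id; apply/matrixP => i j; apply: AB.
Qed.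

Lemma rdet_row_mx3 p1 p2 p3 k l m (A : 'M[K]_(n, p1)) (B : 'M[K]_(n, p2))
    (C : 'M[K]_(n, p3)) (e1 : p1 = k) (e2 : p2 = l) (e3 : p3 = m) :
  rdet (row_mx (row_mx A B) C) =
  rdet (row_mx (row_mx (castmx (erefl n, e1) A) (castmx (erefl n, e2) B))
               (castmx (erefl n, e3) C)).
Proof. by subst k l m; rewrite !castmx_id. Qed.

Lemma fun_phiE (X Y : 'M[K]_n) k l : (0 < k)%N -> (0 < l)%N -> (k + l <= n)%N ->
  fun_phi X Y k l =
  sgn_phi K n k l * (\det X) ^+ (n - k - l).+1 * psi (invmx X *m Y) k l.
Proof.
move=> k0 l0 kl; congr (_ * _ * _); rewrite /psi -/(mxU X Y).
have ck : #|itv n (n - k).+1 n| = k by rewrite card_itv //; lia.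
have cl : #|itv n (n - l).+1 n| = l by rewrite card_itv //; lia.
have c1 : #|itv n n n| = 1%N by rewrite card_itv //; lia.
have e3 : (\sum_(t < n - k - l) #|itv n n n| = n - k - l)%N.
  by rewrite sum_nat_const c1 card_ord muln1.
rewrite (rdet_row_mx3 _ _ _ ck cl e3); congr (rdet (row_mx (row_mx _ _) _)).
- apply: eq_mx_cast => i j j' ej; have lj := ltn_ord j.
  rewrite /colsubmx expr0 !mxE -val_eqE /= enum_val_itv; try lia.
  by rewrite ej.
- apply: eq_mx_cast => i j j' ej; have lj := ltn_ord j.
  rewrite (@mul_SelT _ _ _ _ _ _ _ _ (enum_val j')) ?mxE //.
  by rewrite enum_val_itv //; lia.
- apply: eq_mx_cast => i j j' ej; have lj := ltn_ord j.
  rewrite [RHS]mxE [LHS]mxE /colsubmx [LHS]mxE [in RHS]ej -(val_sig1_const1 j' (fun=> c1)).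
  set x := enum_val _.
  have ex : x = n.-1 :> nat.
    rewrite /x enum_val_itv; try lia.
    have := leq_trans (ltn_ord (tagnat.sig2 j')) (eq_leq c1).
    by rewrite ltnS leqn0 => /eqP ->; rewrite addn0.
  by rewrite -ex mul_ei.
Qed.

Lemma Sel_Sel r s p s' : (s + r <= p)%N ->
  @Sel K p r s *m @Sel K n p s' = @Sel K n r (s' + s).
Proof.
move=> le; apply/matrixP => i a; have li := ltn_ord i.
have lt : (s + i < p)%N by lia.
by rewrite (@Sel_mul _ _ _ _ _ _ _ (Ordinal lt)) // !mxE /= addnA.
Qed.

End Bridge.

Lemma minor_sub (K : fieldType) n r s t p s' t' (X : 'M[K]_n) :
  (s + r <= p)%N -> (t + r <= p)%N ->
  minor r s t (Sel p s' *m X *m (Sel p t')^T) = minor r (s' + s) (t' + t) X.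
Proof.
move=> h1 h2; rewrite /minor !mulmxA Sel_Sel // -[in LHS](mulmxA _ (Sel p t')^T).
by rewrite -trmx_mul Sel_Sel.
Qed.

(** * Logarithmic gradients *)

Section LogGrad.
Variables (K : fieldType) (n : nat).
Implicit Types (X Y U E P G : 'M[K]_n).
Local Notation Sel := (@Sel K n).
Local Notation Pi := (@Pi K n).
Local Notation ei := (@ei K n).

(** For an idempotent [P], [rowproj P E] says that [E] is an idempotent with the same
   kernel as [P], and [colproj P E] that it is one with the same image. *)
Definition rowproj P E := P *m E = P /\ E *m P = E.
Definition colproj P E := E *m P = P /\ P *m E = E.

(** The gradient of [log (det M)] is the inverse of [M]; here that inverse is put back
   in the place of the submatrix, transposed. Multiplying by [X] restores an identity
   block on the selected rows or columns, whence the projections. *)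
Lemma minor_grad r s t X : (s + r <= n)%N -> (t + r <= n)%N ->
  minor r s t X != 0 ->
  exists G, [/\ forall d, derivation d ->
                  d (minor r s t X) = \tr (G *m map_mx d X) * minor r s t X,
                rowproj (Pi r s) (X *m G), colproj (Pi r t) (G *m X),
                G *m Pi r s = G & Pi r t *m G = G].
Proof.
move=> sr tr; rewrite /minor -rdet_sq => nz.
have [B AB BA] := rdet_inv erefl nz.
have GP : (Sel r t)^T *m B *m Sel r s *m Pi r s = (Sel r t)^T *m B *m Sel r s.
  by rewrite -!mulmxA Sel_mul_Pi.
have PG : Pi r t *m ((Sel r t)^T *m B *m Sel r s) = (Sel r t)^T *m B *m Sel r s.
  by rewrite !mulmxA mul_Pi_SelT.
exists ((Sel r t)^T *m B *m Sel r s); split=> //.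
- move=> d dP; rewrite (rdet_der dP erefl BA); congr (_ * _).
  rewrite !map_mx_derM // der_Sel // der_SelT // mul0mx add0r mulmx0 addr0.
  by rewrite -!mulmxA [RHS]mxtrace_mulC !mulmxA.
- split; last by rewrite -mulmxA GP.
  rewrite -SelT_Sel -!mulmxA; congr (_ *m _).
  by rewrite !mulmxA AB mul1mx.
- split; last by rewrite mulmxA PG.
  rewrite -SelT_Sel !mulmxA; congr (_ *m _).
  by rewrite -!mulmxA [X in B *m X]mulmxA BA mulmx1.
Qed.

(** The upper and lower halves of the inverse of the selected matrix are the gradients
   in [X] and in [Y]. The first is orthogonal to the chosen columns of [Y], the
   second to those of [X]. *)
Lemma mixed_minor_grad X Y k l : (k + l <= n)%N -> mixed_minor X Y k l != 0 ->
  exists GX GY,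
  [/\ forall d, derivation d -> d (mixed_minor X Y k l) =
        (\tr (GX *m map_mx d X) + \tr (GY *m map_mx d Y)) * mixed_minor X Y k l,
      rowproj (Pi (k + l) (n - (k + l))) (X *m GX + Y *m GY),
      colproj (Pi k (n - k)) (GX *m X),
      colproj (Pi l (n - l)) (GY *m Y) &
      [/\ Pi k (n - k) *m (GX *m Y) = GX *m Y, (GX *m Y) *m Pi l (n - l) = 0,
          Pi l (n - l) *m (GY *m X) = GY *m X & (GY *m X) *m Pi k (n - k) = 0]].
Proof.
move=> kl; rewrite /mixed_minor -rdet_sq => nz.
set S := Sel (k + l) _ in nz *; set SX := (Sel k (n - k))^T; set SY := (Sel l (n - l))^T.
have [B AB BA] := rdet_inv erefl nz.
have [BX [BY eB]] : exists BX BY, B = col_mx BX BY.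
  by exists (usubmx B), (dsubmx B); rewrite vsubmxK.
pose GX := SX *m BX *m S; pose GY := SY *m BY *m S.
have lk : (n - k + k <= n)%N by lia.
have ll : (n - l + l <= n)%N by lia.
have lkl : (n - (k + l) + (k + l) <= n)%N by lia.
have BA1 := BA.
rewrite eB /mixed_cols mul_mx_row mul_col_row !mulmxA scalar_mx_block -/SX -/SY in BA1.
have [e1 e2 e3 e4] := eq_block_mx BA1.
exists GX, GY; split.
- move=> d dP; rewrite (rdet_der dP erefl BA); congr (_ * _).
  rewrite map_mx_derM // der_Sel // mul0mx add0r /mixed_cols map_row_mx !map_mx_derM //
    !der_SelT //.
  rewrite !mulmx0 !addr0 mul_mx_row eB mul_col_row -/SX -/SY -/S mxtrace_block.
  by congr (_ + _); rewrite -!mulmxA [RHS]mxtrace_mulC !mulmxA.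
- split; last by rewrite /GX /GY mulmxDl -!mulmxA !Sel_mul_Pi.
  rewrite -SelT_Sel -mulmxA; congr (_ *m _).
  rewrite -[RHS]mul1mx -AB eB /mixed_cols -/SX -/SY -!(mulmxA S) mul_row_col mulmxDl.
  by rewrite /GX /GY !mulmxA.
- split; last by rewrite /GX /GY !mulmxA mul_Pi_SelT.
  rewrite /GX /GY -SelT_Sel -/SX !mulmxA -(mulmxA SX) -(mulmxA SX) -(mulmxA SX) e1.
  by rewrite mulmx1.
- split; last by rewrite /GX /GY !mulmxA mul_Pi_SelT.
  rewrite /GX /GY -SelT_Sel -/SY !mulmxA -(mulmxA SY) -(mulmxA SY) -(mulmxA SY) e4.
  by rewrite mulmx1.
- split.
  + by rewrite /GX /GY !mulmxA mul_Pi_SelT.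
  + rewrite /GX /GY -SelT_Sel -/SY !mulmxA -(mulmxA SX) -(mulmxA SX) -(mulmxA SX) e2.
    by rewrite mulmx0 mul0mx.
  + by rewrite /GX /GY !mulmxA mul_Pi_SelT.
  + rewrite /GX /GY -SelT_Sel -/SX !mulmxA -(mulmxA SY) -(mulmxA SY) -(mulmxA SY) e3.
    by rewrite mulmx0 mul0mx.
Qed.

Lemma col_mulmx m p q (A : 'M[K]_(m, p)) (B : 'M[K]_(p, q)) j :
  col j (A *m B) = A *m col j B.
Proof. by apply/colP => a; rewrite !mxE; apply: eq_bigr => c _; rewrite mxE. Qed.

Lemma expmxS U s : U ^+ s.+1 = U *m U ^+ s. Proof. exact: exprS. Qed.
Lemma expmxSr U s : U ^+ s.+1 = U ^+ s *m U. Proof. exact: exprSr. Qed.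
Lemma expmxD U s r : U ^+ (s + r) = U ^+ s *m U ^+ r. Proof. exact: exprD. Qed.

Lemma der_expmx (d : K -> K) U s : derivation d ->
  map_mx d (U ^+ s) = \sum_(r < s) U ^+ r *m map_mx d U *m U ^+ (s.-1 - r).
Proof.
move=> dP; elim: s => [|s IH]; first by rewrite big_ord0 expr0 map_mx_der1.
rewrite exprSr map_mx_derM // IH big_ord_recr /= subnn expr0 mulmx1.
congr (_ + _); rewrite mulmx_suml; apply: eq_bigr => r _.
have -> : (s - r = (s.-1 - r).+1)%N by have := ltn_ord r; lia.
by rewrite expmxSr !mulmxA.
Qed.

(** The inverse of the matrix whose determinant is [psi U k l], cut into the blocks
   that pair with the columns of [U ^ 0], of [U] and of each higher power; each block
   is padded with zero rows to the size [n]. *)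
Definition psi_blocks U k l E0 E1 (Z : nat -> 'M[K]_n) :=
  let m := (n - k - l)%N in
  [/\ E0 + U *m E1 + \sum_(t < m) U ^+ t.+2 *m Z t = 1%:M,
      [/\ Pi k (n - k) *m E0 = E0, E0 *m Pi k (n - k) = Pi k (n - k),
          E0 *m U *m Pi l (n - l) = 0 &
          forall s, (s < m)%N -> E0 *m (U ^+ s.+2 *m ei n.-1) = 0],
      [/\ Pi l (n - l) *m E1 = E1, E1 *m Pi k (n - k) = 0,
          E1 *m U *m Pi l (n - l) = Pi l (n - l) &
          forall s, (s < m)%N -> E1 *m (U ^+ s.+2 *m ei n.-1) = 0] &
      forall t, (t < m)%N ->
      [/\ Pi 1 n.-1 *m Z t = Z t, Z t *m Pi k (n - k) = 0,
          Z t *m U *m Pi l (n - l) = 0 &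
          forall s, (s < m)%N -> Z t *m (U ^+ s.+2 *m ei n.-1) =
                               (s == t)%:R *: ei n.-1]].

(** The gradient of [log (psi U k l)] with respect to [U]: the inner sum is the
   Leibniz rule for the power [U ^ (t + 2)]. *)
Definition psi_lgrad U k l E1 (Z : nat -> 'M[K]_n) : 'M[K]_n :=
  E1 + \sum_(t < n - k - l) \sum_(r < t.+2) U ^+ (t.+1 - r) *m Z t *m U ^+ r.

Lemma psi_grad U k l : (k + l <= n)%N -> psi U k l != 0 ->
  exists E0 E1 Z, psi_blocks U k l E0 E1 Z /\
      forall d, derivation d -> d (psi U k l) =
        \tr (psi_lgrad U k l E1 Z *m map_mx d U) * psi U k l.
Proof.
move=> kl; rewrite /psi => nz; set m := (n - k - l)%N.
have en : n = (k + l + m)%N by rewrite /m; lia.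
have [B AB BA] := rdet_inv en nz.
set SX := (Sel k (n - k))^T in nz AB BA *; set SY := (Sel l (n - l))^T in nz AB BA *.
have [B0 [B1 [B2 eB]]] : exists B0 B1 B2, B = col_mx (col_mx B0 B1) B2.
  by exists (usubmx (usubmx B)), (dsubmx (usubmx B)), (dsubmx B); rewrite !vsubmxK.
pose Zc : 'M[K]_(n, m) := \matrix_(a, t) (U ^+ t.+2 *m ei n.-1) a 0.
pose Z t : 'M[K]_n := \matrix_(a, b)
  if insub t is Some t' then (a == n.-1 :> nat)%:R * B2 t' b else 0.
have lk : (n - k + k <= n)%N by lia.
have ll : (n - l + l <= n)%N by lia.
have ZE (t : 'I_m) : Z t = ei n.-1 *m row t B2.
  by apply/matrixP => a b; rewrite mxE valK mxE big_ord1 !mxE.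
have ZcE (t : 'I_m) : col t Zc = U ^+ t.+2 *m ei n.-1.
  by apply/colP => a; rewrite !mxE.
have ZcB2 : \sum_(t < m) U ^+ t.+2 *m Z t = Zc *m B2.
  apply/matrixP => a b; rewrite summxE mxE; apply: eq_bigr => t _.
  by rewrite ZE mulmxA -ZcE mxE big_ord1 !mxE.
have BA1 := BA.
rewrite eB /psi_mx -/SX -/SY -/Zc -/m mul_col_row !mul_col_row in BA1.
rewrite mul_mx_row mul_col_mx scalar_mx_block in BA1.
have [BA2 b1 c1 d1] := eq_block_mx BA1.
rewrite scalar_mx_block in BA2; have [a1 a2 a3 a4] := eq_block_mx BA2.
rewrite -col_mx0 in b1; have {b1}[b1 b2] := eq_col_mx b1.
rewrite -row_mx0 in c1; have {c1}[c1 c2] := eq_row_mx c1.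
exists (SX *m B0), (SY *m B1), Z; split; last first.
  move=> d dP; rewrite (rdet_der dP en BA); congr (_ * _).
  rewrite /psi_lgrad -/m eB /psi_mx -/SX -/SY -/Zc -/m !map_row_mx mul_col_row mxtrace_block.
  rewrite mul_col_row mxtrace_block !map_mx_derM // !der_SelT // !mulmx0 addr0 mxtrace0 add0r.
  rewrite mulmxDl mxtraceD; congr (_ + _).
    by rewrite -!mulmxA [RHS]mxtrace_mulC !mulmxA.
  rewrite mulmx_suml raddf_sum {1}/mxtrace /=; apply: eq_bigr => t _.
  have -> : (B2 *m map_mx d Zc) t t = \tr (row t B2 *m map_mx d (col t Zc)).
    rewrite /mxtrace big_ord1 !mxE; apply: eq_bigr => a _; rewrite !mxE.
    by [].
  rewrite ZcE map_mx_derM // der_ei // mulmx0 addr0 mulmxA mxtrace_mulC mulmxA -ZE.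
  rewrite der_expmx // mulmx_sumr mulmx_suml !raddf_sum.
  by apply: eq_bigr => r _ /=; rewrite !mulmxA [LHS]mxtrace_mulC !mulmxA.
rewrite /psi_blocks /= -/m; split.
- rewrite ZcB2 mulmxA -AB eB /psi_mx -/SX -/SY -/Zc -/m !mul_row_col //.
- split.
  + by rewrite mulmxA mul_Pi_SelT.
  + by rewrite -SelT_Sel -/SX !mulmxA -(mulmxA SX) a1 mulmx1.
  + by rewrite -SelT_Sel -/SY !mulmxA -(mulmxA SX B0) -(mulmxA SX) -(mulmxA B0) a2 mulmx0 mul0mx.
  + move=> s sm; rewrite -(ZcE (Ordinal sm)) -mulmxA -col_mulmx b1.
    by rewrite col0 mulmx0.
- split.
  + by rewrite mulmxA mul_Pi_SelT.
  + by rewrite -SelT_Sel -/SX !mulmxA -(mulmxA SY) a3 mulmx0 mul0mx.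
  + by rewrite -SelT_Sel -/SY !mulmxA -(mulmxA SY B1) -(mulmxA SY) -(mulmxA B1) a4 mulmx1.
  + move=> s sm; rewrite -(ZcE (Ordinal sm)) -mulmxA -col_mulmx b2.
    by rewrite col0 mulmx0.
move=> t tm; rewrite (ZE (Ordinal tm)) -[t]/(nat_of_ord (Ordinal tm)).
have rowZ p (A : 'M[K]_(n, p)) :
  ei n.-1 *m row (Ordinal tm) B2 *m A = ei n.-1 *m row (Ordinal tm) (B2 *m A).
  by rewrite -mulmxA row_mul.
split.
- rewrite mulmxA; congr (_ *m _); apply/matrixP => a b; rewrite Pi_mul.
  by rewrite !mxE; case: ifP => //; case: eqP => // ->; have := ltn_ord a; lia.
- by rewrite rowZ -SelT_Sel -/SX mulmxA c1 mul0mx row0 mulmx0.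
- by rewrite -mulmxA rowZ -SelT_Sel -/SY !mulmxA -(mulmxA B2) c2 mul0mx row0 mulmx0.
- move=> s sm; rewrite rowZ -(ZcE (Ordinal sm)) -col_mulmx d1.
  apply/colP => a; rewrite mxE big_ord1 !mxE mulrC eq_sym.
  by [].
Qed.
End LogGrad.

(** * Brackets of logarithms *)

Section Integers.
Variable K : fieldType.

Definition isint (z : K) := exists a : int, z = a%:~R.
Definition half_int (z : K) := isint (z *+ 2).

Lemma isint0 : isint 0. Proof. by exists 0. Qed.
Lemma isint1 : isint 1. Proof. by exists 1. Qed.
Lemma isint_bool (b : bool) : isint b%:R. Proof. by case: b; [exact: isint1|exact: isint0]. Qed.
Lemma isintD x y : isint x -> isint y -> isint (x + y).
Proof. by move=> [a ->] [b ->]; exists (a + b); rewrite intrD. Qed.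
Lemma isintN x : isint x -> isint (- x).
Proof. by move=> [a ->]; exists (- a); rewrite rmorphN. Qed.
Lemma isintM x y : isint x -> isint y -> isint (x * y).
Proof. by move=> [a ->] [b ->]; exists (a * b); rewrite intrM. Qed.
Lemma isintB x y : isint x -> isint y -> isint (x - y).
Proof. by move=> hx hy; apply: isintD => //; apply: isintN. Qed.
Lemma isint_sum (I : finType) (F : I -> K) :
  (forall i, isint (F i)) -> isint (\sum_i F i).
Proof. by move=> H; apply: big_ind => //; [exact: isint0|exact: isintD]. Qed.
Lemma isint_nat m : isint m%:R. Proof. by exists m%:Z. Qed.

Lemma half_intD x y : half_int x -> half_int y -> half_int (x + y).
Proof. by rewrite /half_int mulrnDl; apply: isintD. Qed.
Lemma half_intN x : half_int x -> half_int (- x).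
Proof. by rewrite /half_int mulNrn; apply: isintN. Qed.
Lemma half_intB x y : half_int x -> half_int y -> half_int (x - y).
Proof. by move=> hx hy; apply: half_intD => //; apply: half_intN. Qed.
Lemma half_int_isint x : isint x -> half_int x.
Proof. by move=> hx; rewrite /half_int mulr2n; apply: isintD. Qed.
Lemma half_int_half x : 2%:R != 0 :> K -> isint x -> half_int (2%:R^-1 * x).
Proof. by move=> c2 hx; rewrite /half_int -(mulr_natl (_ * _)) mulrA mulfV // mul1r. Qed.
End Integers.

Section Triangular.
Variables (K : fieldType) (n : nat).
Implicit Types (A B E X Y U : 'M[K]_n).
Local Notation Pi := (@Pi K n).

Definition lower A := forall i j : 'I_n, (i < j)%N -> A i j = 0.
Definition upper A := forall i j : 'I_n, (j < i)%N -> A i j = 0.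
Definition intdiag A := forall i, isint (A i i).

(** The map [Rplus] over an arbitrary field, so that the computations with triangular
   matrices need not unfold the field of rational functions. *)
Definition Rplus_mx A : 'M[K]_n :=
  \matrix_(i, j) (if (i < j)%N then A i j else 0) +
  2%:R^-1 *: \matrix_(i, j) (if i == j then A i j else 0).

Definition diag_dot A B : K := \sum_i A i i * B i i.

Lemma mxtraceM A B : \tr (A *m B) = \sum_i \sum_j A i j * B j i.
Proof. by apply: eq_bigr => i _; rewrite mxE. Qed.

Lemma tr_Rplus A B :
  \tr (Rplus_mx A *m B) = (\sum_(i < n) \sum_(j < n | (i < j)%N) A i j * B j i) + 2%:R^-1 *
    diag_dot A B.
Proof.
rewrite mulmxDl mxtraceD -scalemxAl mxtraceZ !mxtraceM; congr (_ + _ * _).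
  apply: eq_bigr => i _; rewrite [RHS]big_mkcond; apply: eq_bigr => j _.
  by rewrite mxE; case: ifP; rewrite ?mul0r.
apply: eq_bigr => i _; rewrite (bigD1 i) //= mxE eqxx big1 ?addr0 // => j ji.
by rewrite mxE eq_sym (negPf ji) mul0r.
Qed.

Lemma tr_split A B :
  \tr (A *m B) = (\sum_(i < n) \sum_(j < n | (i < j)%N) A i j * B j i) +
                 (\sum_(i < n) \sum_(j < n | (j < i)%N) A i j * B j i) + diag_dot A B.
Proof.
rewrite mxtraceM -!big_split /=; apply: eq_bigr => i _.
rewrite (bigID (fun j : 'I_n => (i < j)%N)) /= -addrA; congr (_ + _).
rewrite (bigID (fun j : 'I_n => (j < i)%N)) /=; congr (_ + _).
  by apply: eq_bigl => j; lia.
rewrite (eq_bigl (pred1 i)) ?big_pred1_eq // => j /=.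
by rewrite -val_eqE /=; lia.
Qed.

Lemma tr_Rplus_lower A B : lower A -> \tr (Rplus_mx A *m B) = 2%:R^-1 * diag_dot A B.
Proof.
move=> lA; rewrite tr_Rplus big1 ?add0r // => i _; rewrite big1 // => j ij.
by rewrite lA // mul0r.
Qed.

Lemma tr_Rplus_upper A B : upper B -> \tr (Rplus_mx A *m B) = 2%:R^-1 * diag_dot A B.
Proof.
move=> uB; rewrite tr_Rplus big1 ?add0r // => i _; rewrite big1 // => j ij.
by rewrite uB // mulr0.
Qed.

Lemma tr_lower A B : lower A -> lower B -> \tr (A *m B) = diag_dot A B.
Proof.
move=> lA lB; rewrite tr_split !big1 ?add0r // => i _; rewrite big1 // => j ij.
  by rewrite lB ?mulr0.
by rewrite lA ?mul0r.
Qed.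

Lemma tr_upper A B : upper A -> upper B -> \tr (A *m B) = diag_dot A B.
Proof.
move=> uA uB; rewrite tr_split !big1 ?add0r // => i _; rewrite big1 // => j ij.
  by rewrite uA ?mul0r.
by rewrite uB ?mulr0.
Qed.

Lemma isint_diag_dot A B : intdiag A -> intdiag B -> isint (diag_dot A B).
Proof. by move=> iA iB; apply: isint_sum => i; apply: isintM. Qed.

Lemma isint_tr A : intdiag A -> isint (\tr A).
Proof. by move=> iA; apply: isint_sum. Qed.

Lemma intdiagD A B : intdiag A -> intdiag B -> intdiag (A + B).
Proof. by move=> iA iB i; rewrite mxE; apply: isintD. Qed.

Lemma lowerD A B : lower A -> lower B -> lower (A + B).
Proof. by move=> lA lB i j ij; rewrite mxE lA ?lB ?addr0. Qed.

Lemma lower_sum (I : finType) (F : I -> 'M[K]_n) :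
  (forall i, lower (F i)) -> lower (\sum_i F i).
Proof. by move=> H a b ab; rewrite summxE big1 // => i _; apply: H. Qed.

Lemma intdiag_sum (I : finType) (F : I -> 'M[K]_n) :
  (forall i, intdiag (F i)) -> intdiag (\sum_i F i).
Proof. by move=> H a; rewrite summxE; apply: isint_sum => i; apply: H. Qed.

Lemma lower_scalar c : lower c%:M.
Proof. by move=> i j ij; rewrite mxE -val_eqE ltn_eqF. Qed.

Lemma intdiag_scalar m : intdiag m%:R%:M.
Proof. by move=> i; rewrite mxE eqxx; apply: isint_nat. Qed.

Lemma intdiagN A : intdiag A -> intdiag (- A).
Proof. by move=> iA i; rewrite mxE; apply: isintN. Qed.

Lemma lowerN A : lower A -> lower (- A).
Proof. by move=> lA i j ij; rewrite mxE lA ?oppr0. Qed.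

Lemma lower0 : lower 0. Proof. by move=> i j _; rewrite mxE. Qed.
Lemma intdiag0 : intdiag 0. Proof. by move=> i; rewrite mxE; apply: isint0. Qed.

(** ** The supports of the projections [rowproj] and [colproj] *)

Lemma colproj_in r s E a (b : 'I_n) : colproj (Pi r s) E -> (s <= b < s + r)%N ->
  E a b = (a == b)%:R.
Proof.
move=> [H _] hb; have /matrixP/(_ a b) := H; rewrite mul_Pi hb => ->.
by rewrite mxE; case: eqP => //= ->; rewrite hb.
Qed.

Lemma colproj_out r s E (a : 'I_n) b : colproj (Pi r s) E -> ~~ (s <= a < s + r)%N ->
  E a b = 0.
Proof. by move=> [_ H] ha; rewrite -H Pi_mul (negPf ha). Qed.

Lemma rowproj_tr r s E : rowproj (Pi r s) E <-> colproj (Pi r s) E^T.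
Proof.
split=> [[h1 h2]|[h1 h2]]; split.
- by rewrite -{1}tr_Pi -trmx_mul h1 tr_Pi.
- by rewrite -{1}tr_Pi -trmx_mul h2.
- by rewrite -[LHS]trmxK trmx_mul tr_Pi h1 tr_Pi.
- by rewrite -[LHS]trmxK trmx_mul tr_Pi h2 trmxK.
Qed.

Lemma colproj_intdiag r s E : colproj (Pi r s) E -> intdiag E.
Proof.
move=> H a; case: (boolP (s <= a < s + r)%N) => ha.
  by rewrite (colproj_in _ H ha); apply: isint_bool.
by rewrite (colproj_out _ H ha); apply: isint0.
Qed.

(** The image is spanned by the last basis vectors, on which [E] is the identity. *)
Lemma colproj_lower r E : (r <= n)%N -> colproj (Pi r (n - r)) E -> lower E.
Proof.
move=> rn H a b ab; case: (boolP (n - r <= a < n - r + r)%N) => ha.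
  rewrite (colproj_in _ H); last by have := ltn_ord b; lia.
  by rewrite -val_eqE ltn_eqF.
exact: (colproj_out _ H).
Qed.

Lemma rowproj_intdiag r s E : rowproj (Pi r s) E -> intdiag E.
Proof.
by move=> /rowproj_tr /colproj_intdiag H a; have := H a; rewrite mxE.
Qed.

Lemma rowproj_upper r E : (r <= n)%N -> rowproj (Pi r (n - r)) E -> upper E.
Proof.
move=> rn /rowproj_tr /(colproj_lower rn) H a b ab.
by have := H _ _ ab; rewrite mxE.
Qed.

(** Let [J] and [J'] be the two intervals of length [r] and [r'] starting at [s] and
   [s']. If neither contains the other, the comparison between an index of [J \ J']
   and an index of [J' \ J] always goes the same way; nested intervals give no such
   pair of indices. *)
Lemma pos_part_interval s r s' r' A B :
  (forall i j : 'I_n, i != j -> A i j * B j i != 0 ->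
     [&& (s <= i < s + r)%N, ~~ (s' <= i < s' + r')%N,
         (s' <= j < s' + r')%N & ~~ (s <= j < s + r)%N]) ->
  let P := \sum_(i < n) \sum_(j < n | (i < j)%N) A i j * B j i in
  P = 0 \/ P = \tr (A *m B) - diag_dot A B.
Proof.
move=> H P; case: (boolP ((s <= s') && (s + r <= s' + r'))%N) => c; [right|left].
  rewrite tr_split -/P [X in P + X + _]big1 ?addr0 ?addrK // => i _.
  rewrite big1 // => j ji; apply/eqP/negPn/negP => /H.
  by rewrite -val_eqE /=; lia.
apply: big1 => i _; apply: big1 => j ij; apply/eqP/negPn/negP => /H.
by rewrite -val_eqE /=; lia.
Qed.

End Triangular.

Section Brackets.
Variables (K : fieldType) (n : nat).
Hypothesis char2 : 2%:R != 0 :> K.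
Implicit Types (A B E X Y U : 'M[K]_n).
Local Notation Pi := (@Pi K n).

Lemma half_complement (a : K) : a - 2%:R^-1 * a = 2%:R^-1 * a.
Proof. by rewrite -{1}[a]mul1r -mulrBl; congr (_ * _); field. Qed.

Lemma tr_sub_Rplus_upper A B : upper A ->
  \tr (A *m B) - \tr (Rplus_mx A *m B) = 2%:R^-1 * diag_dot A B.
Proof.
move=> uA; rewrite tr_split tr_Rplus [X in _ + X + _]big1 ?addr0.
  by rewrite opprD addrACA subrr add0r half_complement.
by move=> i _; rewrite big1 // => j ij; rewrite uA ?mul0r.
Qed.

Lemma tr_sub_Rplus_lower A B : lower B ->
  \tr (A *m B) - \tr (Rplus_mx A *m B) = 2%:R^-1 * diag_dot A B.
Proof.
move=> lB; rewrite tr_split tr_Rplus [X in _ + X + _]big1 ?addr0.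
  by rewrite opprD addrACA subrr add0r half_complement.
by move=> i _; rewrite big1 // => j ij; rewrite lB ?mulr0.
Qed.

Lemma half_int_diag_dot A B : intdiag A -> intdiag B -> half_int (2%:R^-1 * diag_dot A B).
Proof. by move=> iA iB; apply: half_int_half => //; apply: isint_diag_dot. Qed.

(** ** The bracket of two functions with logarithmic gradients [(a1, b1)], [(a2, b2)] *)

(** The quotient of [bracketD f1 f2] by [f1 * f2]. *)
Definition log_bracket X Y (a1 b1 a2 b2 : 'M[K]_n) : K :=
  \tr (Rplus_mx (a1 *m X + b1 *m Y) *m (a2 *m X + b2 *m Y))
  - \tr (Rplus_mx (X *m a1 + Y *m b1) *m (X *m a2 + Y *m b2))
  + \tr ((X *m a1 + Y *m b1) *m (Y *m b2))
  - \tr ((a1 *m X + b1 *m Y) *m (b2 *m Y)).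

Lemma tr_cyc4 (A B C D : 'M[K]_n) : \tr (A *m B *m (C *m D)) = \tr (B *m C *m (D *m A)).
Proof. by rewrite -!mulmxA mxtrace_mulC !mulmxA. Qed.

Lemma Rplus_mx_tr A B : \tr (Rplus_mx A *m B) + \tr (Rplus_mx B *m A) = \tr (A *m B).
Proof.
rewrite !tr_Rplus tr_split addrACA; congr (_ + _ + _).
  rewrite [RHS](exchange_big_dep xpredT) //=.
  by apply: eq_bigr => i _; apply: eq_bigr => j _; rewrite mulrC.
have -> : diag_dot B A = diag_dot A B by apply: eq_bigr => i _; rewrite mulrC.
by rewrite -{2}(half_complement (diag_dot A B)) addrC subrK.
Qed.

(** The map [Rplus_mx] plus its adjoint is the identity ([Rplus_mx_tr]): the symmetric
   part of the first two terms is a combination of traces, and the last two terms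
   cancel it. *)
Lemma log_bracket_antisym X Y a1 b1 a2 b2 : log_bracket X Y a2 b2 a1 b1 =
  - log_bracket X Y a1 b1 a2 b2.
Proof.
apply/eqP; rewrite -addr_eq0; apply/eqP; rewrite /log_bracket.
have e1 := Rplus_mx_tr (a1 *m X + b1 *m Y) (a2 *m X + b2 *m Y).
have e2 := Rplus_mx_tr (X *m a1 + Y *m b1) (X *m a2 + Y *m b2).
have {}e1 := canRL (addKr _) e1; have {}e2 := canRL (addKr _) e2.
rewrite e1 e2 !mulmxDl !mulmxDr !mxtraceD.
rewrite (tr_cyc4 X a1 Y b2) (tr_cyc4 X a2 Y b1) (tr_cyc4 Y b1 X a2) (tr_cyc4 X a1 X a2).
rewrite (tr_cyc4 Y b1 Y b2) (tr_cyc4 Y b2 Y b1).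
rewrite (mxtrace_mulC (b2 *m Y) (b1 *m Y)).
rewrite (mxtrace_mulC (b1 *m X) (a2 *m Y)) (mxtrace_mulC (b1 *m Y) (a2 *m X)).
ring.
Qed.

Lemma log_bracket_scale X Y a1 b1 a2 b2 (x y : K) :
  log_bracket X Y (x *: a1) (x *: b1) (y *: a2) (y *: b2) = log_bracket X Y a1 b1 a2 b2 * (x * y).
Proof.
have RZ (z : K) A : Rplus_mx (z *: A) = z *: Rplus_mx A.
  apply/matrixP => i j; rewrite !mxE.
  by case: ifP => _; case: ifP => _; rewrite ?(mulr0, addr0, add0r) // ?mulrDr // mulrCA.
rewrite /log_bracket -!scalemxAl -!scalemxAr -!scalerDr !RZ -!scalemxAl -!scalemxAr !mxtraceZ.
move: (\tr _) (\tr _) (\tr _) (\tr _) => p q r s; ring.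
Qed.

(** On scalar matrices [Rplus_mx] is one half, so only the traces of [E_L], [E_R] and
   of [Y b2], [b2 Y] are left, which agree pairwise. *)
Lemma log_bracket_casimir X Y a b a2 b2 (c : K) :
  a *m X + b *m Y = c%:M -> X *m a + Y *m b = c%:M -> log_bracket X Y a b a2 b2 = 0.
Proof.
move=> hL hR; rewrite /log_bracket hL hR.
have -> : Rplus_mx (c%:M : 'M[K]_n) = (2%:R^-1 * c)%:M.
  apply/matrixP => i j; rewrite !mxE -val_eqE.
  by case: ltngtP => //= h; rewrite ?mulr0 ?addr0 ?add0r ?mulr1n ?mulr0n ?mulr0 //.
rewrite !mul_scalar_mx !mxtraceZ !mxtraceD (mxtrace_mulC Y b2) (mxtrace_mulC X a2).
by rewrite addrK subrr.
Qed.

Lemma mxtrace_leibniz (a b c e P Q : 'M[K]_n) (f g : K) :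
  \tr ((g *: a + f *: b) *m P) + \tr ((g *: c + f *: e) *m Q) =
  (\tr (a *m P) + \tr (c *m Q)) * g + f * (\tr (b *m P) + \tr (e *m Q)).
Proof.
rewrite !mulmxDl !mxtraceD -!scalemxAl !mxtraceZ.
move: (\tr _) (\tr _) (\tr _) (\tr _) => p q r s; ring.
Qed.

(** ** Brackets of minors and mixed minors *)

Lemma half_int_lower A B : lower A -> lower B -> intdiag A -> intdiag B ->
  half_int (\tr (A *m B)).
Proof. by move=> lA lB iA iB; rewrite tr_lower //; apply/half_int_isint/isint_diag_dot. Qed.

(** On the side of rows both matrices are upper triangular. On the side of columns
   they are projections on two intervals of coordinates, so only one of the two
   strict halves of the trace of their product is nonzero ([pos_part_interval]); the
   whole trace is the same on both sides. *)
Lemma log_bracket_gg X a a' r s t r' s' t' :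
  (r <= n)%N -> (r' <= n)%N -> s = (n - r)%N -> s' = (n - r')%N ->
  rowproj (Pi r s) (X *m a) -> colproj (Pi r t) (a *m X) ->
  rowproj (Pi r' s') (X *m a') -> colproj (Pi r' t') (a' *m X) ->
  forall Y, half_int (log_bracket X Y a 0 a' 0).
Proof.
move=> rn rn' -> -> rp cp rp' cp' Y.
have u := rowproj_upper rn rp; have u' := rowproj_upper rn' rp'.
have i := rowproj_intdiag rp; have i' := rowproj_intdiag rp'.
have j := colproj_intdiag cp; have j' := colproj_intdiag cp'.
rewrite /log_bracket !(mul0mx, mulmx0, addr0, linear0) subr0.
rewrite [X in _ - X]tr_Rplus_upper //; apply: half_intB; last exact: half_int_diag_dot.
rewrite tr_Rplus; apply: half_intD; last exact: half_int_diag_dot.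
have [|->|->] := @pos_part_interval K n t r t' r' (a *m X) (a' *m X).
- move=> x y xy; have yx : (y == x) = false by rewrite eq_sym (negPf xy).
  apply: contraNT => H.
  case: (boolP (t <= x < t + r)%N) => h1; last by rewrite (colproj_out _ cp h1) mul0r.
  case: (boolP (t <= y < t + r)%N) => h2; first by rewrite (colproj_in _ cp h2) (negPf xy) mul0r.
  case: (boolP (t' <= y < t' + r')%N) => h3; last by rewrite (colproj_out _ cp' h3) mulr0.
  case: (boolP (t' <= x < t' + r')%N) => h4.
    by rewrite (colproj_in _ cp' h4) yx mulr0.
  by rewrite h1 h2 h3 h4 in H.
- exact/half_int_isint/isint0.
rewrite -tr_cyc4 mxtrace_mulC tr_upper //.
by apply: half_intB; apply/half_int_isint/isint_diag_dot.
Qed.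

(** As for two functions [g], with the roles of rows and columns exchanged. *)
Lemma log_bracket_hh Y b b' r s t r' s' t' :
  (r <= n)%N -> (r' <= n)%N -> t = (n - r)%N -> t' = (n - r')%N ->
  rowproj (Pi r s) (Y *m b) -> colproj (Pi r t) (b *m Y) ->
  rowproj (Pi r' s') (Y *m b') -> colproj (Pi r' t') (b' *m Y) ->
  forall X, half_int (log_bracket X Y 0 b 0 b').
Proof.
move=> rn rn' -> -> rp cp rp' cp' X.
have u := colproj_lower rn cp; have u' := colproj_lower rn' cp'.
have i := rowproj_intdiag rp; have i' := rowproj_intdiag rp'.
have j := colproj_intdiag cp; have j' := colproj_intdiag cp'.
rewrite /log_bracket !(mul0mx, mulmx0, add0r, linear0).
rewrite -(tr_cyc4 Y b Y b') addrK tr_Rplus_lower //; apply: half_intB;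
  first exact: half_int_diag_dot.
rewrite tr_Rplus; apply: half_intD; last exact: half_int_diag_dot.
have [|->|->] := @pos_part_interval K n s' r' s r (Y *m b) (Y *m b').
- move: rp rp' => /rowproj_tr rp /rowproj_tr rp'.
  have eb x y : (Y *m b) x y = ((Y *m b)^T) y x by rewrite [RHS]mxE.
  have eb' x y : (Y *m b') x y = ((Y *m b')^T) y x by rewrite [RHS]mxE.
  move=> x y xy; have yx : (y == x) = false by rewrite eq_sym (negPf xy).
  apply: contraNT => H; rewrite eb eb'.
  case: (boolP (s <= y < s + r)%N) => h1; last by rewrite (colproj_out _ rp h1) mul0r.
  case: (boolP (s <= x < s + r)%N) => h2; first by rewrite (colproj_in _ rp h2) yx mul0r.
  case: (boolP (s' <= x < s' + r')%N) => h3; last by rewrite (colproj_out _ rp' h3) mulr0.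
  case: (boolP (s' <= y < s' + r')%N) => h4.
    by rewrite (colproj_in _ rp' h4) (negPf xy) mulr0.
  by rewrite h1 h2 h3 h4 in H.
- exact/half_int_isint/isint0.
rewrite tr_cyc4 tr_lower //.
by apply: half_intB; apply/half_int_isint/isint_diag_dot.
Qed.

(** What is left are two differences between a trace and its [Rplus_mx] part, in each
   of which one factor is triangular. *)
Lemma log_bracket_gh X Y a b :
  upper (X *m a) -> intdiag (X *m a) -> intdiag (a *m X) ->
  lower (b *m Y) -> intdiag (b *m Y) -> intdiag (Y *m b) ->
  half_int (log_bracket X Y a 0 0 b).
Proof.
move=> u i j l i' j'; rewrite /log_bracket !(mul0mx, mulmx0, addr0, add0r).
have -> (p q r s : K) : p - q + r - s = (r - q) - (s - p) by ring.
by rewrite tr_sub_Rplus_upper // tr_sub_Rplus_lower //; apply: half_intB; apply: half_int_diag_dot.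
Qed.

(** Substituting [Y b2 = (X a2 + Y b2) - X a2] in the mixed trace again leaves only
   differences between a trace and its [Rplus_mx] part. *)
Lemma log_bracket_gf X Y a a2 b2 :
  upper (X *m a) -> intdiag (X *m a) -> intdiag (a *m X) ->
  lower (a2 *m X) -> lower (b2 *m Y) -> upper (X *m a2 + Y *m b2) ->
  intdiag (a2 *m X) -> intdiag (b2 *m Y) -> intdiag (X *m a2 + Y *m b2) ->
  half_int (log_bracket X Y a 0 a2 b2).
Proof.
move=> u i j l l' u' i1 i2 i3; rewrite /log_bracket !(mul0mx, mulmx0, addr0).
rewrite [X in _ - X + _ - _]tr_Rplus_upper //.
have -> : \tr (X *m a *m (Y *m b2)) =
    \tr (X *m a *m (X *m a2 + Y *m b2)) - \tr (a *m X *m (a2 *m X)).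
  by rewrite mulmxDr mxtraceD (tr_cyc4 X a X a2) addrC addKr.
rewrite (mulmxDr (Rplus_mx _)) mxtraceD.
have -> (p q r s t v : K) : p + q - r + (s - t) - v = s - r - (t - p) - (v - q) by ring.
rewrite !tr_sub_Rplus_lower //.
repeat first [exact: half_int_diag_dot | apply: half_intB].
by rewrite tr_upper //; apply/half_int_isint/isint_diag_dot.
Qed.

Lemma log_bracket_fh X Y a1 b1 b2 :
  lower (a1 *m X + b1 *m Y) -> upper (X *m a1 + Y *m b1) ->
  intdiag (a1 *m X + b1 *m Y) -> intdiag (X *m a1 + Y *m b1) ->
  lower (b2 *m Y) -> intdiag (b2 *m Y) -> intdiag (Y *m b2) ->
  half_int (log_bracket X Y a1 b1 0 b2).
Proof.
move=> l u i1 i2 l' i3 i4; rewrite /log_bracket !(mul0mx, mulmx0, add0r).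
rewrite tr_Rplus_lower // -(addrA _ (- _)) (addrC (- _) (\tr _)) tr_sub_Rplus_upper //.
apply: half_intB; last exact: half_int_lower.
by apply: half_intD; apply: half_int_diag_dot.
Qed.

(** The only term that is not a trace of triangular matrices is the one of
   [a1 Y b2 X]. It vanishes because the image of [b2 X] lies in the span of the last
   [l2 <= l1] basis vectors, which [a1 Y] kills; for this reason the two functions
   are ordered by [l]. *)
Lemma log_bracket_ff X Y a1 b1 a2 b2 l1 l2 : (l2 <= l1)%N -> (l1 <= n)%N ->
  lower (a1 *m X + b1 *m Y) -> intdiag (a1 *m X + b1 *m Y) ->
  lower (b1 *m Y) -> intdiag (b1 *m Y) -> (a1 *m Y) *m Pi l1 (n - l1) = 0 ->
  upper (X *m a2 + Y *m b2) -> intdiag (X *m a1 + Y *m b1) ->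
  intdiag (X *m a2 + Y *m b2) -> intdiag (a2 *m X + b2 *m Y) ->
  lower (b2 *m Y) -> intdiag (b2 *m Y) -> Pi l2 (n - l2) *m (b2 *m X) = b2 *m X ->
  half_int (log_bracket X Y a1 b1 a2 b2).
Proof.
move=> ll ln l1L i1 l1b i2 z1 u2 i3 i4 i5 l2b i6 z2; rewrite /log_bracket.
rewrite tr_Rplus_lower // [X in _ - X + _ - _]tr_Rplus_upper //.
have -> : \tr ((X *m a1 + Y *m b1) *m (Y *m b2)) = \tr (b1 *m Y *m (b2 *m Y)).
  rewrite mulmxDl mxtraceD (tr_cyc4 X a1 Y b2) (tr_cyc4 Y b1 Y b2).
  rewrite -z2 -(_ : Pi l1 (n - l1) *m Pi l2 (n - l2) = Pi l2 (n - l2)).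
    by rewrite -(mulmxA (Pi l1 _)) (mulmxA (a1 *m Y)) z1 mul0mx mxtrace0 add0r.
  apply/matrixP => x y; rewrite Pi_mul; case: ifP => // h; rewrite mxE.
  by rewrite [X in _ && X]negbTE ?andbF //; have := ltn_ord x; lia.
apply: half_intB; last exact: half_int_lower.
apply: half_intD; last exact: half_int_lower.
by apply: half_intB; apply: half_int_diag_dot.
Qed.

End Brackets.

(** ** The functions [phi] *)

Section PhiBracket.
Variables (K : fieldType) (n : nat).
Implicit Types (A B E X Y U D : 'M[K]_n).
Local Notation Pi := (@Pi K n).
Local Notation ei := (@ei K n).

(** The decomposition of the identity in [psi_blocks] has the powers of [U] on the
   left of the blocks; here they stand on the right. *)
Definition psi_low U k l E0 E1 (Z : nat -> 'M[K]_n) : 'M[K]_n :=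
  E0 + E1 *m U + \sum_(t < n - k - l) Z t *m U ^+ t.+2.

Lemma ei_trei : (0 < n)%N -> ei n.-1 *m (ei n.-1)^T = Pi 1 n.-1.
Proof.
move=> n0; apply/matrixP => a b; rewrite !mxE big_ord1 !mxE.
rewrite -natrM mulnb; congr (_%:R); rewrite -val_eqE /=.
have := ltn_ord a; have := ltn_ord b; lia.
Qed.

Lemma Pi_Pi1 l : (0 < l <= n)%N -> Pi l (n - l) *m Pi 1 n.-1 = Pi 1 n.-1.
Proof.
move=> l0; apply/matrixP => a b; rewrite Pi_mul; case: ifP => // h; rewrite mxE.
by rewrite [X in _ && X]negbTE ?andbF //; have := ltn_ord a; lia.
Qed.

(** The commutator with [U] telescopes in each sum over [r] and moves the powers of
   [U] from one side of the blocks to the other. *)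
Lemma psi_comm U k l E0 E1 Z : psi_blocks U k l E0 E1 Z ->
  let D := psi_lgrad U k l E1 Z in
  D *m U - U *m D = psi_low U k l E0 E1 Z - 1%:M.
Proof.
case=> e1 _ _ _ D; rewrite -e1 /psi_low /D /psi_lgrad mulmxDl mulmxDr.
rewrite mulmx_suml mulmx_sumr.
have : \sum_(t < n - k - l) (Z t *m U ^+ t.+2 - U ^+ t.+2 *m Z t) =
  \sum_(t < n - k - l) (\sum_(r < t.+2) U ^+ (t.+1 - r) *m Z t *m U ^+ r) *m U -
  \sum_(t < n - k - l) U *m (\sum_(r < t.+2) U ^+ (t.+1 - r) *m Z t *m U ^+ r).
  rewrite -sumrB; apply: eq_bigr => t _; rewrite mulmx_suml mulmx_sumr -sumrB.
  rewrite -(big_mkord xpredT (fun r =>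
     U ^+ (t.+1 - r) *m Z t *m U ^+ r *m U - U *m (U ^+ (t.+1 - r) *m Z t *m U ^+ r))).
  (* The summand of the commutator is [F r.+1 - F r]. *)
  pose F r := U ^+ (t.+2 - r) *m Z t *m U ^+ r.
  rewrite (eq_big_nat _ _ (F2 := fun r => F r.+1 - F r)) => [|r /andP[_ rt]].
    by rewrite telescope_sumr // /F subnn subn0 !expr0 mul1mx mulmx1.
  rewrite /F subSS -(mulmxA (_ *m _)) -expmxSr; congr (_ - _).
  by rewrite (@subSn r t.+1) // expmxS !mulmxA.
rewrite sumrB.
have aux (a b c d e p q : 'M[K]_n) : c - e = p - q ->
    b + p - (d + q) = a + b + c - (a + d + e).
  move/matrixP=> H; apply/matrixP => i j; have := H i j; rewrite !mxE => h.
  have -> : c i j = p i j - q i j + e i j by rewrite -h subrK.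
  ring.
by apply: aux.
Qed.

(** Each summand of [psi_low] is a projection on the span of the last coordinate
   vectors, since the blocks are dual to the columns of [psi_mx]. *)
Lemma psi_blocks_low U k l E0 E1 Z : (0 < k)%N -> (0 < l)%N -> (k + l <= n)%N ->
  psi_blocks U k l E0 E1 Z ->
  [/\ colproj (Pi k (n - k)) E0, colproj (Pi l (n - l)) (E1 *m U) &
      forall t, (t < n - k - l)%N -> colproj (Pi 1 n.-1) (Z t *m U ^+ t.+2)].
Proof.
move=> k0 l0 kl [_ [a1 a2 a3 a4] [b1 b2 b3 b4] c]; split.
- by [].
- by split; rewrite // mulmxA b1.
- move=> t tm; have [c1 c2 c3 c4] := c t tm; split; last by rewrite mulmxA c1.
  rewrite -ei_trei; last by lia.
  by rewrite mulmxA -(mulmxA (Z t)) c4 // eqxx scale1r.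
Qed.

Lemma psi_low_lower U k l E0 E1 Z : (0 < k)%N -> (0 < l)%N -> (k + l <= n)%N ->
  psi_blocks U k l E0 E1 Z ->
  lower (psi_low U k l E0 E1 Z) /\ intdiag (psi_low U k l E0 E1 Z).
Proof.
move=> k0 l0 kl H; have [h0 h1 h2] := psi_blocks_low k0 l0 kl H.
have kn : (k <= n)%N by lia.
have ln : (l <= n)%N by lia.
have n1 : (1 <= n)%N by lia.
have e1 : n.-1 = (n - 1)%N by lia.
split.
  apply: lowerD; last by apply: lower_sum => t; apply: (colproj_lower n1); rewrite -e1; apply: h2.
  by apply: lowerD; [exact: (colproj_lower kn)|exact: (colproj_lower ln)].
apply: intdiagD; last by apply: intdiag_sum => t; apply: colproj_intdiag (h2 _ _).
by apply: intdiagD; [exact: (colproj_intdiag h0)|exact: (colproj_intdiag h1)].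
Qed.

(** After expanding [psi_lgrad], consider a term where a positive power of [U]
   precedes [Z' t]. Its image lies in the span of a column [U ^ s e] of the matrix of
   [psi U k l], and the block [E0] or [E1] on its left vanishes there; the assumption
   [k + l <= k' + l'] ensures that [s] is small enough. If the left factor is [Z p],
   then [U ^ (r + 1)] stands cyclically between [Z' t] and [Z p], and [Z' t] vanishes
   on the column of that power, which is not its own. The terms that survive are
   traces of products of lower triangular matrices with integer diagonal. *)
Lemma isint_psi_pair U k l k' l' E0 E1 Z E0' E1' Z' :
  (0 < k)%N -> (0 < l)%N -> (k + l <= n)%N ->
  (0 < k')%N -> (0 < l')%N -> (k' + l' <= n)%N -> (k + l <= k' + l')%N ->
  psi_blocks U k l E0 E1 Z -> psi_blocks U k' l' E0' E1' Z' ->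
  isint (\tr (psi_low U k l E0 E1 Z *m (psi_lgrad U k' l' E1' Z' *m U))).
Proof.
move=> k0 l0 kl k0' l0' kl' ll H H'.
have [h0 h1 h2] := psi_blocks_low k0 l0 kl H.
have [h0' h1' h2'] := psi_blocks_low k0' l0' kl' H'.
have kn : (k <= n)%N by lia.
have ln : (l <= n)%N by lia.
have ln' : (l' <= n)%N by lia.
have n1 : (1 <= n)%N by lia.
have en : n.-1 = (n - 1)%N by lia.
have L0 := colproj_lower kn h0; have L1 := colproj_lower ln h1.
have L2 t (tm : (t < n - k - l)%N) : lower (Z t *m U ^+ t.+2).
  by apply: (colproj_lower n1); rewrite -en; apply: h2.
have L1' := colproj_lower ln' h1'.
have L2' t (tm : (t < n - k' - l')%N) : lower (Z' t *m U ^+ t.+2).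
  by apply: (colproj_lower n1); rewrite -en; apply: h2'.
have I0 := colproj_intdiag h0; have I1 := colproj_intdiag h1.
have I1' := colproj_intdiag h1'.
have I2 t (tm : (t < n - k - l)%N) : intdiag (Z t *m U ^+ t.+2) := colproj_intdiag (h2 t tm).
have I2' t (tm : (t < n - k' - l')%N) : intdiag (Z' t *m U ^+ t.+2) := colproj_intdiag (h2' t tm).
have PP : Pi l (n - l) *m Pi 1 n.-1 = Pi 1 n.-1 by apply: Pi_Pi1; rewrite l0.
have PP' : Pi l' (n - l') *m Pi 1 n.-1 = Pi 1 n.-1 by apply: Pi_Pi1; rewrite l0'.
case: H => _ [a1 a2 a3 a4] [b1 b2 b3 b4] c.
case: H' => _ [a1' a2' a3' a4'] [b1' b2' b3' b4'] c'.
have gen E : lower E -> intdiag E ->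
    (forall t r, (t < n - k' - l')%N -> (r < t.+1)%N ->
      \tr (E *m U ^+ (t.+1 - r) *m Z' t *m U ^+ r *m U) = 0) ->
    isint (\tr (E *m (psi_lgrad U k' l' E1' Z' *m U))).
  move=> LE IE HE; rewrite /psi_lgrad mulmxDl mulmxDr mxtraceD; apply: isintD.
    by rewrite tr_lower //; apply: isint_diag_dot.
  rewrite mulmx_suml mulmx_sumr raddf_sum; apply: isint_sum => t /=.
  rewrite mulmx_suml mulmx_sumr raddf_sum big_ord_recr /= big1 ?add0r.
    rewrite subnn expr0 mul1mx -mulmxA -expmxSr tr_lower //; last exact: L2'.
    exact: (isint_diag_dot IE (I2' _ _)).
  by move=> r _; rewrite !mulmxA HE.
move: (psi_lgrad U k' l' E1' Z' *m U) gen => W gen.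
rewrite /psi_low !mulmxDl !mxtraceD; apply: isintD; first apply: isintD.
- apply: (gen _ L0 I0) => t r tm rt; have [c1 _ _ _] := c' t tm.
  rewrite -c1 mulmxA -(mulmxA _ _ (Pi 1 _)).
  (* The exponent is at least 1 and at most [t.+1 <= n - k' - l']: it is that of the
     block of [U] if it is 1, and of a higher column otherwise. *)
  suff -> : E0 *m (U ^+ (t.+1 - r) *m Pi 1 n.-1) = 0 by rewrite !mul0mx mxtrace0.
  case e: (t.+1 - r)%N => [|[|s]]; first by lia.
    by rewrite expr1 -PP !mulmxA a3 mul0mx.
  rewrite -ei_trei // (mulmxA (_ ^+ _)) (mulmxA E0) a4 ?mul0mx //; lia.
- apply: (gen _ L1 I1) => t r tm rt; have [c1 _ _ _] := c' t tm.
  rewrite -c1 mulmxA -(mulmxA _ _ (Pi 1 _)).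
  suff -> : E1 *m U *m (U ^+ (t.+1 - r) *m Pi 1 n.-1) = 0 by rewrite !mul0mx mxtrace0.
  case e: (t.+1 - r)%N => [|s]; first by lia.
  rewrite -ei_trei // !mulmxA -(mulmxA E1) -expmxS -(mulmxA E1) b4 ?mul0mx //; lia.
- rewrite mulmx_suml raddf_sum; apply: isint_sum => p /=.
  apply: (gen _ (L2 _ (ltn_ord p)) (I2 _ (ltn_ord p))) => t r tm rt.
  have [c1 _ _ _] := c p (ltn_ord p); have [d1 d2 d3 d4] := c' t tm.
  rewrite -c1 -!mulmxA mxtrace_mulC -!mulmxA.
  suff -> : Z' t *m (U ^+ r *m (U *m Pi 1 n.-1)) = 0 by rewrite !mulmx0 mxtrace0.
  case: r rt => [|r] rt; first by rewrite expr0 mul1mx -PP' !mulmxA d3 mul0mx.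
  rewrite (mulmxA _ U) -(expmxSr U r.+1) -ei_trei // (mulmxA (U ^+ r.+2)) (mulmxA (Z' t)) d4;
    last by lia.
  by rewrite (_ : (r == t) = false) ?scale0r ?mul0mx //; lia.
Qed.

Definition phi_gradX X U (m : nat) D : 'M[K]_n := m%:R *: invmx X - U *m D *m invmx X.
Definition phi_gradY X D : 'M[K]_n := D *m invmx X.

Section PhiPair.
Variables X Y : 'M[K]_n.
Hypothesis uX : X \in unitmx.
Let U := invmx X *m Y.

(** The function [psi] depends on [X^-1 Y] only, which left translations fix: just the
   power of [\det X] contributes. *)
Lemma phi_ER m D : X *m phi_gradX X U m D + Y *m phi_gradY X D = m%:R%:M.
Proof.
rewrite /phi_gradX /phi_gradY mulmxBr -scalemxAr mulmxV // scalemx1.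
by rewrite /U !mulmxA mulmxV // mul1mx subrK.
Qed.

Lemma phi_ELY D : phi_gradY X D *m Y = D *m U.
Proof. by rewrite /phi_gradY -mulmxA. Qed.

Lemma phi_EL m D : phi_gradX X U m D *m X + phi_gradY X D *m Y =
  m%:R%:M + (D *m U - U *m D).
Proof.
rewrite phi_ELY /phi_gradX mulmxBl -scalemxAl mulVmx // scalemx1 -(mulmxA _ (invmx X)) mulVmx //
  mulmx1.
by rewrite -addrA (addrC (- _)).
Qed.

Lemma phi_EL_low m k l E0 E1 Z : (0 < k)%N -> (0 < l)%N -> (k + l <= n)%N ->
  psi_blocks U k l E0 E1 Z ->
  let D := psi_lgrad U k l E1 Z in
  lower (m%:R%:M + (D *m U - U *m D)) /\ intdiag (m%:R%:M + (D *m U - U *m D)).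
Proof.
move=> k0 l0 kl H D; rewrite (psi_comm H); have [h1 h2] := psi_low_lower k0 l0 kl H.
split; first by apply: lowerD; [exact: lower_scalar|apply: lowerD => //; apply: lowerN;
  exact: lower_scalar].
by apply: intdiagD; [exact: intdiag_scalar|apply: intdiagD => //; apply: intdiagN; by move=> i;
  rewrite mxE eqxx; exact: isint1].
Qed.

(** This trace is the degree of [psi U k l] as a homogeneous function of [U]. *)
Lemma isint_degree k l E0 E1 Z : (0 < k)%N -> (0 < l)%N -> (k + l <= n)%N ->
  psi_blocks U k l E0 E1 Z -> isint (\tr (psi_lgrad U k l E1 Z *m U)).
Proof.
move=> k0 l0 kl H; have [h0 h1 h2] := psi_blocks_low k0 l0 kl H.
rewrite /psi_lgrad mulmxDl mxtraceD; apply: isintD.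
  exact/isint_tr/(colproj_intdiag h1).
rewrite mulmx_suml raddf_sum; apply: isint_sum => t /=.
rewrite mulmx_suml raddf_sum; apply: isint_sum => r /=.
rewrite -mulmxA -expmxSr -mulmxA mxtrace_mulC -mulmxA -expmxD.
have -> : (r.+1 + (t.+1 - r) = t.+2)%N by have := ltn_ord r; lia.
exact/isint_tr/(colproj_intdiag (h2 _ _)).
Qed.

Hypothesis char2 : 2%:R != 0 :> K.

(** [E_R] of the first function is scalar and its [E_L] lower triangular, so the
   traces only see diagonals. *)
Lemma log_bracket_phi_lin m k l E0 E1 Z a2 b2 :
  (0 < k)%N -> (0 < l)%N -> (k + l <= n)%N -> psi_blocks U k l E0 E1 Z ->
  lower (b2 *m Y) -> intdiag (b2 *m Y) -> intdiag (a2 *m X + b2 *m Y) ->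
  intdiag (X *m a2 + Y *m b2) ->
  let D := psi_lgrad U k l E1 Z in
  half_int (log_bracket X Y (phi_gradX X U m D) (phi_gradY X D) a2 b2).
Proof.
move=> k0 l0 kl H lb ib iL iR D; rewrite /log_bracket phi_ER phi_EL.
have [lD iD] := phi_EL_low m k0 l0 kl H.
rewrite tr_Rplus_lower // tr_Rplus_lower; last exact: lower_scalar.
apply: half_intB; last exact: half_int_lower.
apply: half_intD; first apply: half_intB; try exact: (half_int_diag_dot char2).
  by apply: (half_int_diag_dot char2) => //; exact: intdiag_scalar.
rewrite mul_scalar_mx mxtraceZ mxtrace_mulC; apply/half_int_isint/isintM.
  exact: isint_nat.
exact: isint_tr.
Qed.

(** All terms are as in [log_bracket_phi_lin], except for the trace of the commutator
   of one logarithmic gradient with [U] against the other one. *)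
Lemma log_bracket_phi_phi m k l E0 E1 Z m' k' l' E0' E1' Z' :
  (0 < k)%N -> (0 < l)%N -> (k + l <= n)%N ->
  (0 < k')%N -> (0 < l')%N -> (k' + l' <= n)%N -> (k + l <= k' + l')%N ->
  psi_blocks U k l E0 E1 Z -> psi_blocks U k' l' E0' E1' Z' ->
  let D := psi_lgrad U k l E1 Z in let D' := psi_lgrad U k' l' E1' Z' in
  half_int (log_bracket X Y (phi_gradX X U m D) (phi_gradY X D)
                    (phi_gradX X U m' D') (phi_gradY X D')).
Proof.
move=> k0 l0 kl k0' l0' kl' ll H H' D D'; rewrite /log_bracket !phi_ER !phi_EL phi_ELY.
have [lD iD] := phi_EL_low m k0 l0 kl H.
have [lD' iD'] := phi_EL_low m' k0' l0' kl' H'.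
rewrite tr_Rplus_lower // tr_Rplus_lower; last exact: lower_scalar.
have ideg := isint_degree k0' l0' kl' H'.
apply: half_intB; first apply: half_intD; first apply: half_intB.
- exact: (half_int_diag_dot char2).
- by apply: (half_int_diag_dot char2) => //; exact: intdiag_scalar.
- rewrite mul_scalar_mx mxtraceZ mxtrace_mulC phi_ELY; apply/half_int_isint/isintM => //.
  exact: isint_nat.
have pair := isint_psi_pair k0 l0 kl k0' l0' kl' ll H H'.
apply: half_int_isint; rewrite (psi_comm H) /D'.
move: (psi_low U k l E0 E1 Z) (psi_lgrad U k' l' E1' Z' *m U) ideg pair => V W ideg pair.
rewrite !mulmxDl mulNmx mul1mx mul_scalar_mx.
rewrite !mxtraceD mxtraceZ raddfN /=; apply: isintD.
  by apply: isintM => //; apply: isint_nat.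
exact: isintB.
Qed.
End PhiPair.

(** The chain rule for [\det X] and [psi (invmx X *m Y)]. *)
Lemma phi_logder (d : K -> K) X Y U k l m D s :
  derivation d -> X \in unitmx -> d s = 0 -> X *m U = Y ->
  d (psi U k l) = \tr (D *m map_mx d U) * psi U k l ->
  d (s * (\det X) ^+ m * psi U k l) =
    (\tr (phi_gradX X U m D *m map_mx d X) +
     \tr (phi_gradY X D *m map_mx d Y)) * (s * (\det X) ^+ m * psi U k l).
Proof.
move=> dP uX ds XU; move: (psi U k l) => q dq.
have ddet : d (\det X) = \tr (invmx X *m map_mx d X) * \det X.
  by rewrite -rdet_sq (rdet_der dP erefl (mulVmx uX)).
have dexp p : d (\det X ^+ p) = p%:R * \tr (invmx X *m map_mx d X) * \det X ^+ p.
  elim: p => [|p IH]; first by rewrite expr0 der1 // !mul0r.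
  rewrite exprS (derM dP) ddet IH mulrS.
  move: (\tr _) (\det X) (\det X ^+ p) => x y z; ring.
have dU : map_mx d U = invmx X *m map_mx d Y - invmx X *m map_mx d X *m U.
  rewrite -XU map_mx_derM // mulmxDr !mulmxA mulVmx // mul1mx.
  by rewrite addrAC subrr add0r.
move: (map_mx d U) (map_mx d X) (map_mx d Y) dq dexp dU => W V V' dq dexp eW; rewrite eW in dq.
rewrite !(derM dP) ds mul0r add0r dexp dq /phi_gradX /phi_gradY.
have -> : \tr ((m%:R *: invmx X - U *m D *m invmx X) *m V) =
    m%:R * \tr (invmx X *m V) - \tr (D *m (invmx X *m V *m U)).
  rewrite mulmxBl mxtraceD raddfN -scalemxAl mxtraceZ; congr (_ - _).
  by rewrite -!mulmxA [LHS]mxtrace_mulC !mulmxA.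
rewrite mulmxBr mxtraceD raddfN /= -[D *m invmx X *m V']mulmxA.
move: (\tr _) (\tr _) (\tr _) (_ ^+ m) (m%:R) => x y z u v; ring.
Qed.
End PhiBracket.

(** * Determinants of pencils are Casimir functions *)

Section PolyDerivation.
Variables (R : comNzRingType) (d : R -> R).
Hypothesis dP : derivation d.

Lemma coef_der (p : {poly R}) i : (map_poly d p)`_i = d p`_i.
Proof. by rewrite coef_map_id0 // (der0 dP). Qed.

Lemma map_poly_derivation : derivation (map_poly d : {poly R} -> {poly R}).
Proof.
split=> p q; apply/polyP => i.
  by rewrite coefD !coef_der coefD (derD dP).
rewrite coefD !coefM coef_der coefM (der_sum dP) -big_split /=.
by apply: eq_bigr => j _; rewrite (derM dP) !coef_der.
Qed.

End PolyDerivation.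

Section Pencil.
Variables (K : fieldType) (n : nat) (d : K -> K).
Hypothesis dP : derivation d.
Implicit Types X Y A : 'M[K]_n.

Definition pencil X Y : 'M[{poly K}]_n := map_mx polyC X + 'X *: map_mx polyC Y.

Lemma der_pencil X Y : map_mx (map_poly d) (pencil X Y) = pencil (map_mx d X) (map_mx d Y).
Proof.
apply/matrixP => i j; rewrite !mxE; apply/polyP => k.
by rewrite (coef_der dP) !coefD !coefC !coefXM !coefC (derD dP);
   case: k => [|[|k]] /=; rewrite ?(der0 dP).
Qed.

Lemma pencil_mull A X Y : pencil (A *m X) (A *m Y) = map_mx polyC A *m pencil X Y.
Proof. by rewrite /pencil mulmxDr -scalemxAr !map_mxM. Qed.

Lemma pencil_mulr A X Y : pencil (X *m A) (Y *m A) = pencil X Y *m map_mx polyC A.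
Proof. by rewrite /pencil mulmxDl -scalemxAl !map_mxM. Qed.

(** Jacobi's formula, with the adjugate of the pencil cancelling the pencil. *)
Lemma der_pencil_detl X Y A : map_mx d X = A *m X -> map_mx d Y = A *m Y ->
  forall i, d (pencil_det X Y)`_i = \tr A * (pencil_det X Y)`_i.
Proof.
move=> dX dY i; rewrite -(coef_der dP) /pencil_det -/(pencil X Y).
rewrite (der_det (map_poly_derivation dP)) der_pencil dX dY pencil_mull.
rewrite mxtrace_mulC -mulmxA mul_mx_adj mul_mx_scalar mxtraceZ.
by rewrite trace_map_mx mulrC coefCM.
Qed.

Lemma der_pencil_detr X Y A : map_mx d X = X *m A -> map_mx d Y = Y *m A ->
  forall i, d (pencil_det X Y)`_i = \tr A * (pencil_det X Y)`_i.
Proof.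
move=> dX dY i; rewrite -(coef_der dP) /pencil_det -/(pencil X Y).
rewrite (der_det (map_poly_derivation dP)) der_pencil dX dY pencil_mulr.
rewrite mulmxA mul_adj_mx mul_scalar_mx mxtraceZ.
by rewrite trace_map_mx mulrC coefCM.
Qed.
End Pencil.

(** * The partial derivatives of the field of rational functions *)

Section FunField.
Variables (C : fieldType) (n : nat).
Local Notation K := (funfield C n).
Local Notation N := (n * n + n * n)%N.
Local Notation X := (genX C n).
Local Notation Y := (genY C n).
Implicit Types (f q : K) (P Q A : 'M[K]_n).

Lemma fracderiv_derivation (v : 'I_N) : derivation (@fracderiv C n v).
Proof.
have num_ne q : tofrac \d_(repr q) != 0 :> K by rewrite tofrac_eq0 denom_ratioP.
split=> x y; rewrite {1}(frac_reprE x) {1}(frac_reprE y); set a := \n_(repr x);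
  set b := \d_(repr x); set c := \n_(repr y); set e := \d_(repr y).
- have b0 : b != 0 := denom_ratioP _; have e0 : e != 0 := denom_ratioP _.
  rewrite addf_div ?tofrac_eq0 // -!tofracM -tofracD fracderiv_div ?mulf_neq0 //.
  rewrite /fracderiv -/a -/b -/c -/e.
  rewrite addf_div ?tofrac_eq0 ?expf_neq0 // -!tofracM -tofracD.
  apply/eqP; rewrite eqr_div ?tofrac_eq0 ?mulf_neq0 ?expf_neq0 ?mulf_neq0 //.
  rewrite -!tofracM tofrac_eq !mderivD !mderivM; apply/eqP; ring.
- have b0 : b != 0 := denom_ratioP _; have e0 : e != 0 := denom_ratioP _.
  rewrite mulf_div -!tofracM fracderiv_div ?mulf_neq0 //.
  rewrite /fracderiv -/a -/b -/c -/e {1}(frac_reprE x) {1}(frac_reprE y).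
  rewrite -/a -/b -/c -/e !mulf_div -!tofracM.
  rewrite addf_div ?tofrac_eq0 ?mulf_neq0 ?expf_neq0 // -!tofracM -tofracD.
  apply/eqP; rewrite eqr_div ?tofrac_eq0 ?mulf_neq0 ?expf_neq0 ?mulf_neq0 //.
  rewrite -!tofracM tofrac_eq !mderivM; apply/eqP; ring.
Qed.

Lemma fracderiv_tofrac v (p : coord_ring C n) :
  fracderiv v (tofrac p : K) = tofrac (mderiv v p).
Proof.
rewrite -[tofrac p]divr1 -(tofrac1 (coord_ring C n)) fracderiv_div ?oner_neq0 //.
by rewrite -mpolyC1 mderivC mulr0 subr0 mpolyC1 expr1n mulr1 tofrac1 divr1.
Qed.

Lemma fracderiv_const v (c : C) : fracderiv v (funconst C n c) = 0.
Proof. by rewrite /funconst /= fracderiv_tofrac mderivC tofrac0. Qed.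

Lemma mxvec_index_eq m p (i k : 'I_m) (j l : 'I_p) :
  (mxvec_index i j == mxvec_index k l) = (i == k) && (j == l).
Proof.
by rewrite /mxvec_index (inj_eq (@cast_ord_inj _ _ _)) (inj_eq enum_rank_inj).
Qed.

Lemma fracderiv_var (v w : 'I_N) :
  fracderiv v (tofrac ('X_w : coord_ring C n) : K) = (w == v)%:R.
Proof.
rewrite fracderiv_tofrac mderivX mnm1E.
case: eqP => [->|_]; last by rewrite scale0r tofrac0.
rewrite scale1r.
have -> : (U_(v) - U_(v))%MM = 0%MM by apply/mnmP => i; rewrite mnmBE mnm0E subnn.
by rewrite mpolyX0 tofrac1.
Qed.

Lemma fracderiv_genX_x i j k l :
  fracderiv (xidx k l) (X i j) = ((i == k) && (j == l))%:R.
Proof.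
by rewrite mxE fracderiv_var (inj_eq (@lshift_inj _ _)) mxvec_index_eq.
Qed.

Lemma fracderiv_genX_y i j k l : fracderiv (yidx k l) (X i j) = 0.
Proof. by rewrite mxE fracderiv_var eq_lrshift. Qed.

Lemma fracderiv_genY_y i j k l :
  fracderiv (yidx k l) (Y i j) = ((i == k) && (j == l))%:R.
Proof.
by rewrite mxE fracderiv_var (inj_eq (@rshift_inj _ _)) mxvec_index_eq.
Qed.

Lemma fracderiv_genY_x i j k l : fracderiv (xidx k l) (Y i j) = 0.
Proof. by rewrite mxE fracderiv_var eq_rlshift. Qed.

(** The directional derivative along [(P, Q)]: every pair of matrices is the value of
   a derivation at the generic point. *)
Definition dirder P Q f : K := \tr (gradX f *m P) + \tr (gradY f *m Q).

Lemma dirder_derivation P Q : derivation (dirder P Q).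
Proof.
have gD f g : gradX (f + g) = gradX f + gradX g /\ gradY (f + g) = gradY f + gradY g.
  by split; apply/matrixP => i j; rewrite !mxE (derD (fracderiv_derivation _)).
have gM f g : gradX (f * g) = g *: gradX f + f *: gradX g /\
              gradY (f * g) = g *: gradY f + f *: gradY g.
  split; apply/matrixP => i j; rewrite !mxE (derM (fracderiv_derivation _));
  by rewrite [_ * g]mulrC.
split=> f g; rewrite /dirder.
  by have [-> ->] := gD f g; rewrite !mulmxDl !mxtraceD addrACA.
by have [-> ->] := gM f g; rewrite mxtrace_leibniz.
Qed.

Lemma mxtrace_delta m (A : 'M[K]_m) i j : \tr (A *m delta_mx i j) = A j i.
Proof.
rewrite mxtraceM (bigD1 j) //= (bigD1 i) //= mxE !eqxx mulr1 !big1 ?addr0 //.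
  by move=> k kj; rewrite big1 // => l _; rewrite mxE (negPf kj) andbF mulr0.
by move=> k ki; rewrite mxE (negPf ki) mulr0.
Qed.

Lemma dirder_genX P Q : map_mx (dirder P Q) X = P.
Proof.
apply/matrixP => i j; rewrite mxE /dirder.
have -> : gradX (X i j) = delta_mx j i.
  by apply/matrixP => k l; rewrite [LHS]mxE fracderiv_genX_x [RHS]mxE andbC eq_sym [i == _]eq_sym.
have -> : gradY (X i j) = 0.
  by apply/matrixP => k l; rewrite [LHS]mxE fracderiv_genX_y [RHS]mxE.
by rewrite mul0mx mxtrace0 addr0 mxtrace_mulC mxtrace_delta.
Qed.

Lemma dirder_genY P Q : map_mx (dirder P Q) Y = Q.
Proof.
apply/matrixP => i j; rewrite mxE /dirder.
have -> : gradY (Y i j) = delta_mx j i.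
  by apply/matrixP => k l; rewrite [LHS]mxE fracderiv_genY_y [RHS]mxE andbC eq_sym [i == _]eq_sym.
have -> : gradX (Y i j) = 0.
  by apply/matrixP => k l; rewrite [LHS]mxE fracderiv_genY_x [RHS]mxE.
by rewrite mul0mx mxtrace0 add0r mxtrace_mulC mxtrace_delta.
Qed.

(** The gradient of [log f], tested on all derivations instead of the partial
   derivatives: it can then be computed from the Leibniz rule alone. *)
Definition lgrad f (a b : 'M[K]_n) : Prop :=
  forall d, derivation d -> d f = (\tr (a *m map_mx d X) + \tr (b *m map_mx d Y)) * f.

Lemma gradX_lgrad f a b : lgrad f a b -> gradX f = f *: a.
Proof.
move=> H; apply/matrixP => i j; rewrite !mxE (H _ (fracderiv_derivation _)).
have -> : map_mx (fracderiv (xidx j i)) X = delta_mx j i.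
  by apply/matrixP => k l; rewrite [LHS]mxE fracderiv_genX_x [RHS]mxE.
have -> : map_mx (fracderiv (xidx j i)) Y = 0.
  by apply/matrixP => k l; rewrite [LHS]mxE fracderiv_genY_x [RHS]mxE.
by rewrite mulmx0 mxtrace0 addr0 mxtrace_delta mulrC.
Qed.

Lemma gradY_lgrad f a b : lgrad f a b -> gradY f = f *: b.
Proof.
move=> H; apply/matrixP => i j; rewrite !mxE (H _ (fracderiv_derivation _)).
have -> : map_mx (fracderiv (yidx j i)) Y = delta_mx j i.
  by apply/matrixP => k l; rewrite [LHS]mxE fracderiv_genY_y [RHS]mxE.
have -> : map_mx (fracderiv (yidx j i)) X = 0.
  by apply/matrixP => k l; rewrite [LHS]mxE fracderiv_genX_y [RHS]mxE.
by rewrite mulmx0 mxtrace0 add0r mxtrace_delta mulrC.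
Qed.

Lemma bracketD_grad f g :
  bracketD f g = log_bracket X Y (gradX f) (gradY f) (gradX g) (gradY g).
Proof. by []. Qed.

Lemma bracketD_lgrad f g a b a' b' : lgrad f a b -> lgrad g a' b' ->
  bracketD f g = log_bracket X Y a b a' b' * (f * g).
Proof.
move=> hf hg; rewrite bracketD_grad (gradX_lgrad hf) (gradY_lgrad hf).
by rewrite (gradX_lgrad hg) (gradY_lgrad hg) log_bracket_scale.
Qed.

Lemma bracketD_casimir f g : E_L f = f%:M -> E_R f = f%:M -> bracketD f g = 0.
Proof.
by move=> hL hR; rewrite bracketD_grad; exact: log_bracket_casimir hL hR.
Qed.

(** For the derivation that takes [(X, Y)] to [(X A, Y A)] or [(A X, A Y)], the trace
   of [A] times [c] is also the trace of [A] against [E_L c] or [E_R c]; letting [A]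
   vary gives the result. *)
Lemma fun_c_casimir i : let c := fun_c X Y i in E_L c = c%:M /\ E_R c = c%:M.
Proof.
move=> c.
have main (M : 'M[K]_n) : (forall A, \tr (M *m A) = \tr A * c) -> M = c%:M.
  move=> H; apply/matrixP => k l; have := H (delta_mx l k).
  rewrite mxtrace_delta => ->; rewrite -[delta_mx l k]mul1mx mxtrace_delta !mxE.
  by case: (k == l); rewrite ?mul1r ?mul0r ?mulr1n ?mulr0n.
split; apply: main => A.
- have dP := dirder_derivation (X *m A) (Y *m A).
  have := der_pencil_detr dP (dirder_genX _ _) (dirder_genY _ _) i => h.
  have : dirder (X *m A) (Y *m A) c = \tr A * c.
    by rewrite /c /fun_c (derM dP) (der_sign dP) mul0r add0r h mulrCA.
  by rewrite /dirder /E_L mulmxDl mxtraceD !mulmxA.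
- have dP := dirder_derivation (A *m X) (A *m Y).
  have := der_pencil_detl dP (dirder_genX _ _) (dirder_genY _ _) i => h.
  have : dirder (A *m X) (A *m Y) c = \tr A * c.
    by rewrite /c /fun_c (derM dP) (der_sign dP) mul0r add0r h mulrCA.
  rewrite /dirder /E_R mulmxDl mxtraceD !mulmxA => <-.
  by congr (_ + _); rewrite -mulmxA [LHS]mxtrace_mulC.
Qed.

End FunField.

(** * Log-canonicity *)

Section RatrHalf.
Variable K : fieldType.
Hypothesis char0 : forall m, m.+1%:R != 0 :> K.

Lemma intr_neq0 (a : int) : a != 0 -> a%:~R != 0 :> K.
Proof.
case: a => [[|m]|m] //= _; first exact: char0.
by rewrite NegzE mulrNz oppr_eq0; apply: char0.
Qed.

Lemma half_int_ratr (z : K) : half_int z -> exists w : rat, z = ratr w.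
Proof.
move=> [a za]; exists (a%:~R / 2%:R).
have c2 : 2%:R != 0 :> K by apply: char0.
set w := _ / _; rewrite /ratr.
(* The numerator of [w] need not be [a], but the fractions agree over the integers. *)
have e : numq w * 2 = a * denq w.
  have we : w * 2%:~R = a%:~R by rewrite /w divfK.
  by apply: (@intr_inj rat); rewrite !intrM numqE mulrAC we.
have dn : (denq w)%:~R != 0 :> K by apply: intr_neq0; exact: denq_neq0.
have -> : z = a%:~R / 2%:R by apply: (canRL (mulfK c2)); rewrite mulr_natr za.
apply/eqP; rewrite eqr_div // -[2%:R]/((2 : int)%:~R) -!intrM -e.
by [].
Qed.
End RatrHalf.

Section LogCanonical.
Variables (C : fieldType) (n : nat).
Local Notation K := (funfield C n).
Local Notation X := (genX C n).
Local Notation Y := (genY C n).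
Local Notation U := (invmx X *m Y).
Hypothesis char0 : forall m, m.+1%:R != 0 :> K.
Hypothesis uX : X \in unitmx.
Hypothesis minor_X : forall r s t, (s + r <= n)%N -> (t + r <= n)%N -> minor r s t X != 0.
Hypothesis minor_Y : forall r s t, (s + r <= n)%N -> (t + r <= n)%N -> minor r s t Y != 0.
Hypothesis mixed_minor_neq0 : forall k l, (k + l <= n)%N -> mixed_minor X Y k l != 0.
Hypothesis psi_neq0 : forall k l, (0 < k)%N -> (0 < l)%N -> (k + l <= n)%N -> psi U k l != 0.

Let char2 : 2%:R != 0 :> K. Proof. exact: char0. Qed.

Definition logcan (x y : K) := exists w : rat, bracketD x y = ratr w * (x * y).

Lemma logcan_sym x y : logcan x y -> logcan y x.
Proof.
move=> [w e]; exists (- w); rewrite bracketD_grad (log_bracket_antisym char2) -bracketD_grad e.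
by rewrite mulrC [y * x]mulrC /ratr numqN denqN mulrC rmorphN /= !mulNr.
Qed.

Lemma logcan_lgrad x y a b a' b' : lgrad x a b -> lgrad y a' b' ->
  half_int (log_bracket X Y a b a' b') -> logcan x y.
Proof.
move=> hx hy /(half_int_ratr char0) [w e]; exists w.
by rewrite (bracketD_lgrad hx hy) e.
Qed.

(** What the bracket with a function [phi] uses of a function [g], [h] or [f]. *)
Definition lin_data (f : K) a b := [/\ lgrad f a b, lower (b *m Y), intdiag (b *m Y),
  intdiag (a *m X + b *m Y) & intdiag (X *m a + Y *m b)].

(** The data of a function of each kind from which its brackets are computed: the
   logarithmic gradient and the projections that it produces. *)
Definition g_data (f : K) a := lgrad f a 0 /\ exists r t, [/\ (r <= n)%N,
   rowproj (Pi r (n - r)) (X *m a) & colproj (Pi r t) (a *m X)].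
Definition h_data (f : K) b := lgrad f 0 b /\ exists r s, [/\ (r <= n)%N,
   rowproj (Pi r s) (Y *m b) & colproj (Pi r (n - r)) (b *m Y)].
Definition f_data (f : K) a b := lgrad f a b /\ exists k l,
  [/\ (k + l <= n)%N, rowproj (Pi (k + l) (n - (k + l))) (X *m a + Y *m b),
      colproj (Pi k (n - k)) (a *m X), colproj (Pi l (n - l)) (b *m Y) &
      (a *m Y) *m Pi l (n - l) = 0 /\ Pi l (n - l) *m (b *m X) = b *m X].
Definition phi_data (f : K) := exists m k l E0 E1 Z,
  [/\ lgrad f (phi_gradX X U m (psi_lgrad U k l E1 Z)) (phi_gradY X (psi_lgrad U k l E1 Z)),
      (0 < k)%N, (0 < l)%N, (k + l <= n)%N & psi_blocks U k l E0 E1 Z].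

Lemma g_dataP i j : (0 < j)%N -> (j <= i)%N -> (i <= n)%N ->
  exists a, g_data (fun_g X i j) a.
Proof.
move=> j0 ji ni; rewrite fun_g_minor //.
have h1 : (i.-1 + (n.+1 - i) <= n)%N by lia.
have h2 : (j.-1 + (n.+1 - i) <= n)%N by lia.
have [a [ha hr hc _ _]] := minor_grad h1 h2 (minor_X h1 h2).
exists a; split; first by move=> d dP; rewrite ha // mul0mx mxtrace0 addr0.
have er : (n - (n.+1 - i) = i.-1)%N by lia.
by exists (n.+1 - i)%N, j.-1; rewrite er; split=> //; lia.
Qed.

Lemma h_dataP i j : (0 < i)%N -> (i <= j)%N -> (j <= n)%N ->
  exists b, h_data (fun_h Y i j) b.
Proof.
move=> j0 ji ni; rewrite fun_h_minor //.
have h1 : (i.-1 + (n.+1 - j) <= n)%N by lia.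
have h2 : (j.-1 + (n.+1 - j) <= n)%N by lia.
have [a [ha hr hc _ _]] := minor_grad h1 h2 (minor_Y h1 h2).
exists a; split; first by move=> d dP; rewrite ha // mul0mx mxtrace0 add0r.
have er : (n - (n.+1 - j) = j.-1)%N by lia.
by exists (n.+1 - j)%N, i.-1; rewrite er; split=> //; lia.
Qed.

Lemma f_dataP k l : (0 < k)%N -> (0 < l)%N -> (k + l <= n)%N ->
  exists a b, f_data (fun_f X Y k l) a b.
Proof.
move=> k0 l0 kl; rewrite fun_fE //.
have [a [b [hg hr ha hb [c1 c2 c3 c4]]]] := mixed_minor_grad kl (mixed_minor_neq0 kl).
by exists a, b; split=> //; exists k, l; split.
Qed.

Lemma phi_dataP k l : (0 < k)%N -> (0 < l)%N -> (k + l <= n)%N ->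
  phi_data (fun_phi X Y k l).
Proof.
move=> k0 l0 kl; rewrite fun_phiE //.
have [E0 [E1 [Z [hb hd]]]] := psi_grad kl (psi_neq0 k0 l0 kl).
exists (n - k - l).+1, k, l, E0, E1, Z; split=> // d dP.
apply: phi_logder => //; last exact: hd.
  by rewrite /sgn_phi; case: ifP; rewrite (der_sign dP).
exact: (mulKVmx uX Y).
Qed.

Lemma g_lin f a : g_data f a -> lin_data f a 0.
Proof.
move=> [hg [r [t [rn hr hc]]]]; split=> //; rewrite ?mul0mx ?mulmx0 ?addr0.
- exact: lower0.
- exact: intdiag0.
- exact: colproj_intdiag hc.
- exact: rowproj_intdiag hr.
Qed.

Lemma h_lin f b : h_data f b -> lin_data f 0 b.
Proof.
move=> [hg [r [t [rn hr hc]]]]; split=> //; rewrite ?mul0mx ?mulmx0 ?add0r.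
- exact: colproj_lower hc.
- exact: colproj_intdiag hc.
- exact: colproj_intdiag hc.
- exact: rowproj_intdiag hr.
Qed.

Lemma f_lin f a b : f_data f a b -> lin_data f a b.
Proof.
move=> [hg [k [l [kl hr ha hb _]]]]; split=> //.
- by apply: colproj_lower hb; lia.
- exact: colproj_intdiag hb.
- by apply: intdiagD; [exact: colproj_intdiag ha|exact: colproj_intdiag hb].
- exact: rowproj_intdiag hr.
Qed.

Lemma logcan_phi_lin f g a b : phi_data f -> lin_data g a b -> logcan f g.
Proof.
move=> [m [k [l [E0 [E1 [Z [hf k0 l0 kl hb]]]]]]] [hg h1 h2 h3 h4].
exact: (logcan_lgrad hf hg (log_bracket_phi_lin uX char2 m k0 l0 kl hb h1 h2 h3 h4)).
Qed.

Lemma logcan_phi_phi f g : phi_data f -> phi_data g -> logcan f g.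
Proof.
move=> [m [k [l [E0 [E1 [Z [hf k0 l0 kl hb]]]]]]].
move=> [m' [k' [l' [E0' [E1' [Z' [hg k0' l0' kl' hb']]]]]]].
have [ll|ll] := leqP (k + l) (k' + l').
  exact: (logcan_lgrad hf hg (log_bracket_phi_phi uX char2 m m' k0 l0 kl k0' l0' kl' ll hb hb')).
apply: logcan_sym; apply: (logcan_lgrad hg hf).
exact: (log_bracket_phi_phi uX char2 m' m k0' l0' kl' k0 l0 kl (ltnW ll) hb' hb).
Qed.

Lemma logcan_gg f g a b : g_data f a -> g_data g b -> logcan f g.
Proof.
move=> [hf [r [t [rn hr hc]]]] [hg [r' [t' [rn' hr' hc']]]].
apply: (logcan_lgrad hf hg).
exact: (log_bracket_gg char2 rn rn' erefl erefl hr hc hr' hc').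
Qed.

Lemma logcan_hh f g a b : h_data f a -> h_data g b -> logcan f g.
Proof.
move=> [hf [r [t [rn hr hc]]]] [hg [r' [t' [rn' hr' hc']]]].
apply: (logcan_lgrad hf hg).
exact: (log_bracket_hh char2 rn rn' erefl erefl hr hc hr' hc').
Qed.

Lemma logcan_gh f g a b : g_data f a -> h_data g b -> logcan f g.
Proof.
move=> [hf [r [t [rn hr hc]]]] [hg [r' [t' [rn' hr' hc']]]].
apply: (logcan_lgrad hf hg); apply: log_bracket_gh => //.
- exact: rowproj_upper hr.
- exact: rowproj_intdiag hr.
- exact: colproj_intdiag hc.
- exact: colproj_lower hc'.
- exact: colproj_intdiag hc'.
- exact: rowproj_intdiag hr'.
Qed.

Lemma logcan_gf f g a b c : g_data f a -> f_data g b c -> logcan f g.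
Proof.
move=> [hf [r [t [rn hr hc]]]] [hg [k [l [kl hr' ha hb _]]]].
have kn : (k <= n)%N by lia.
have ln : (l <= n)%N by lia.
apply: (logcan_lgrad hf hg); apply: log_bracket_gf => //.
- exact: rowproj_upper hr.
- exact: rowproj_intdiag hr.
- exact: colproj_intdiag hc.
- exact: colproj_lower ha.
- exact: colproj_lower hb.
- exact: rowproj_upper hr'.
- exact: colproj_intdiag ha.
- exact: colproj_intdiag hb.
- exact: rowproj_intdiag hr'.
Qed.

Lemma logcan_fh f g a b c : f_data f a b -> h_data g c -> logcan f g.
Proof.
move=> [hg [k [l [kl hr' ha hb _]]]] [hf [r [t [rn hr hc]]]].
have kn : (k <= n)%N by lia.
have ln : (l <= n)%N by lia.
apply: (logcan_lgrad hg hf); apply: log_bracket_fh => //.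
- by apply: lowerD; [exact: colproj_lower ha|exact: colproj_lower hb].
- exact: rowproj_upper hr'.
- by apply: intdiagD; [exact: colproj_intdiag ha|exact: colproj_intdiag hb].
- exact: rowproj_intdiag hr'.
- exact: colproj_lower hc.
- exact: colproj_intdiag hc.
- exact: rowproj_intdiag hr.
Qed.

Lemma logcan_ff f g a b a' b' : f_data f a b -> f_data g a' b' -> logcan f g.
Proof.
move=> [hf [k [l [kl hr ha hb [c1 c2]]]]] [hg [k' [l' [kl' hr' ha' hb' [c1' c2']]]]].
have kn : (k <= n)%N by lia.
have ln : (l <= n)%N by lia.
have kn' : (k' <= n)%N by lia.
have ln' : (l' <= n)%N by lia.
have La := colproj_lower kn ha; have Lb := colproj_lower ln hb.
have La' := colproj_lower kn' ha'; have Lb' := colproj_lower ln' hb'.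
have Ia := colproj_intdiag ha; have Ib := colproj_intdiag hb.
have Ia' := colproj_intdiag ha'; have Ib' := colproj_intdiag hb'.
have Ir := rowproj_intdiag hr; have Ir' := rowproj_intdiag hr'.
have Ur := rowproj_upper kl hr; have Ur' := rowproj_upper kl' hr'.
have L := lowerD La Lb; have I := intdiagD Ia Ib.
have L' := lowerD La' Lb'; have I' := intdiagD Ia' Ib'.
have [ll|/ltnW ll] := leqP l' l; last apply: logcan_sym.
  exact: (logcan_lgrad hf hg (log_bracket_ff char2 ll ln L I Lb Ib c1 Ur' Ir Ir' I' Lb' Ib' c2')).
exact: (logcan_lgrad hg hf (log_bracket_ff char2 ll ln' L' I' Lb' Ib' c1' Ur Ir' Ir I Lb Ib c2)).
Qed.

Lemma logcan_casimir i g : logcan (fun_c X Y i) g.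
Proof.
have [hL hR] := fun_c_casimir C n i; exists 0.
by rewrite (bracketD_casimir g hL hR) /ratr (_ : numq 0 = 0) // mul0r mul0r.
Qed.

Lemma family_logcan x y : x \in family_F X Y -> y \in family_F X Y -> logcan x y.
Proof.
have split_family z : z \in family_F X Y ->
    [\/ exists a, g_data z a, exists b, h_data z b, exists a b, f_data z a b |
        phi_data z \/ exists i, z = fun_c X Y i].
  rewrite /family_F !mem_cat => /or4P [|||/orP []] /=.
  - by case/allpairsPdep => i [j []]; rewrite !mem_index_iota => hi hj ->;
       apply: Or41; apply: g_dataP; lia.
  - by case/allpairsPdep => i [j []]; rewrite !mem_index_iota => hi hj ->;
       apply: Or42; apply: h_dataP; lia.
  - by case/allpairsPdep => i [j []]; rewrite !mem_index_iota => hi hj ->;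
       apply: Or43; apply: f_dataP; lia.
  - by case/allpairsPdep => i [j []]; rewrite !mem_index_iota => hi hj ->;
       apply: Or44; left; apply: phi_dataP; lia.
  - by case/mapP => i _ ->; apply: Or44; right; exists i.
move=> /split_family hx /split_family hy.
have cas z i : logcan z (fun_c X Y i) by apply: logcan_sym; exact: logcan_casimir.
case: hx => [[a hx]|[b hx]|[a [b hx]]|[hx|[i ->]]]; last exact: logcan_casimir.
- case: hy => [[a' hy]|[b' hy]|[a' [b' hy]]|[hy|[j ->]]]; last exact: cas.
  + exact: logcan_gg hx hy.
  + exact: logcan_gh hx hy.
  + exact: logcan_gf hx hy.
  + apply: logcan_sym; exact: logcan_phi_lin hy (g_lin hx).
- case: hy => [[a' hy]|[b' hy]|[a' [b' hy]]|[hy|[j ->]]]; last exact: cas.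
  + apply: logcan_sym; exact: logcan_gh hy hx.
  + exact: logcan_hh hx hy.
  + apply: logcan_sym; exact: logcan_fh hy hx.
  + apply: logcan_sym; exact: logcan_phi_lin hy (h_lin hx).
- case: hy => [[a' hy]|[b' hy]|[a' [b' hy]]|[hy|[j ->]]]; last exact: cas.
  + apply: logcan_sym; exact: logcan_gf hy hx.
  + exact: logcan_fh hx hy.
  + exact: logcan_ff hx hy.
  + apply: logcan_sym; exact: logcan_phi_lin hy (f_lin hx).
- case: hy => [[a' hy]|[b' hy]|[a' [b' hy]]|[hy|[j ->]]]; last exact: cas.
  + exact: logcan_phi_lin hx (g_lin hy).
  + exact: logcan_phi_lin hx (h_lin hy).
  + exact: logcan_phi_lin hx (f_lin hy).
  + exact: logcan_phi_phi hx hy.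
Qed.
End LogCanonical.

(** * Triangular matrices and derivations that kill minors *)

Section Strict.
Variables (K : fieldType) (n : nat).
Implicit Types (A B E G X Y R S : 'M[K]_n).
Local Notation Sel := (@Sel K n).
Local Notation Pi := (@Pi K n).
Local Notation ei := (@ei K n).

Definition strict_upper A := forall i j : 'I_n, (j <= i)%N -> A i j = 0.
Definition strict_lower A := forall i j : 'I_n, (i <= j)%N -> A i j = 0.

Lemma upperM A B : upper A -> upper B -> upper (A *m B).
Proof.
move=> uA uB i j ji; rewrite mxE big1 // => k _.
have [ki|ik] := ltnP k i; first by rewrite uA ?mul0r.
by rewrite uB ?mulr0 //; lia.
Qed.

Lemma strict_lowerM A B : strict_lower A -> lower B -> strict_lower (A *m B).
Proof.
move=> uA uB i j ji; rewrite mxE big1 // => k _.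
have [ki|ik] := leqP i k; first by rewrite uA ?mul0r.
by rewrite uB ?mulr0 //; lia.
Qed.

(** By induction on the columns of [R], which also yields that the diagonal of [S]
   does not vanish. *)
Lemma upper_inv R S : R *m S = 1%:M -> upper S -> upper R /\ forall i, S i i != 0.
Proof.
move=> RS uS.
have main m (j : 'I_n) : (j < m)%N ->
    (forall i : 'I_n, (j < i)%N -> R i j = 0) /\ S j j != 0.
  elim: m j => // m IH j jm.
  (* Earlier columns of [R] vanish below the diagonal, so [R *m S] is visible in
     column [j] through the single product [R i j * S j j]. *)
  have prev (i k : 'I_n) : (k < j)%N -> (j <= i)%N -> R i k = 0.
    move=> kj ji; have km : (k < m)%N by lia.
    by apply: (IH k km).1; lia.
  have RSj (i : 'I_n) : (j <= i)%N -> (i == j)%:R = R i j * S j j.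
    move=> ji; have /matrixP/(_ i j) := RS; rewrite !mxE => <-.
    rewrite (bigD1 j) //= big1 ?addr0 // => k kj.
    have [lt|le] := ltnP k j; first by rewrite prev ?mul0r.
    rewrite uS ?mulr0 //; move: kj; rewrite -val_eqE /=; lia.
  have Sj : S j j != 0.
    apply/eqP => e; have := RSj j (leqnn _); rewrite eqxx e mulr0.
    by move/eqP; rewrite oner_eq0.
  split=> // i ji; have := RSj i (ltnW ji).
  rewrite -val_eqE /= gtn_eqF // => /esym/eqP.
  by rewrite mulf_eq0 (negPf Sj) orbF => /eqP.
split=> [i j ji|j]; [exact: (main j.+1 j (ltnSn _)).1|exact: (main j.+1 j (ltnSn _)).2].
Qed.

Lemma eq0_entry p q (A : 'M[K]_(p, q)) i j : A = 0 -> A i j = 0.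
Proof. by move=> ->; rewrite mxE. Qed.

Lemma minor_inv r s t X : minor r s t X != 0 ->
  exists2 B : 'M[K]_r, Sel r s *m X *m (Sel r t)^T *m B = 1%:M &
                       B *m (Sel r s *m X *m (Sel r t)^T) = 1%:M.
Proof. by rewrite /minor -rdet_sq => /(rdet_inv erefl). Qed.

Lemma minor_tr r s t X : minor r s t X^T = minor r t s X.
Proof. by rewrite /minor -det_tr !trmx_mul !trmxK mulmxA. Qed.

Lemma Sel_full r s p (A : 'M[K]_(n, p)) :
  (forall (a : 'I_n) j, ~~ (s <= a < s + r)%N -> A a j = 0) ->
  (Sel r s)^T *m (Sel r s *m A) = A.
Proof.
move=> H; rewrite mulmxA SelT_Sel; apply/matrixP => a j; rewrite Pi_mul.
by case: ifP => // /negbT /H.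
Qed.

Lemma mul_Sel_full r s p (A : 'M[K]_(p, n)) :
  (forall i (b : 'I_n), ~~ (s <= b < s + r)%N -> A i b = 0) ->
  (A *m (Sel r s)^T) *m Sel r s = A.
Proof.
move=> H; rewrite -mulmxA SelT_Sel; apply/matrixP => a j; rewrite mul_Pi.
by case: ifP => // /negbT /H.
Qed.

(** The entries vanish one after the other: the vector supported on the interval from
   [t] to [t + r] pairs the only entry not yet known to vanish, the one at [t + r],
   with a nonzero coefficient. *)
Lemma sliding (r : nat) (al : 'rV[K]_n) :
  (forall b : 'I_n, (b < r)%N -> al 0 b = 0) ->
  (forall t, (t + r < n)%N -> exists be : 'cV[K]_n, [/\ al *m be = 0,
     forall a : 'I_n, ~~ (t <= a < t + r.+1)%N -> be a 0 = 0 &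
     forall a : 'I_n, a = (t + r)%N :> nat -> be a 0 != 0]) ->
  al = 0.
Proof.
move=> h0 H.
have main m (b : 'I_n) : (b < m)%N -> al 0 b = 0.
  elim: m b => // m IH b bm.
  have [br|rb] := ltnP b r; first exact: h0.
  have tb : (b - r + r < n)%N by have := ltn_ord b; lia.
  have [be [e s nz]] := H _ tb.
  have {}nz : be b 0 != 0 by apply: nz; lia.
  move/matrixP: e => /(_ 0 0); rewrite !mxE (bigD1 b) //= big1 ?addr0.
    by move/eqP; rewrite mulf_eq0 (negPf nz) orbF => /eqP.
  move=> c cb; have [cm|mc] := ltnP c m; first by rewrite IH ?mul0r.
  rewrite s ?mulr0 //; move: cb; rewrite -val_eqE /=; lia.
by apply/rowP => b; rewrite mxE (main b.+1).
Qed.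

(** The infinitesimal form of the uniqueness of triangular factorisations. The rows of
   [E] are killed from the bottom: if the last [r] vanish, then the trailing minor of
   order [r] forces the last [r] columns of [Ga] to vanish, and the same minor then
   forces the next row of [E] to vanish. *)
Lemma big_cell_transversal E Y Ga : strict_upper E -> strict_lower Ga -> E *m Y = Y *m Ga ->
  (forall r, (r <= n)%N -> minor r (n - r) (n - r) Y != 0) -> E = 0.
Proof.
move=> uE lG EY nz.
suff main r (i j : 'I_n) : (n - r <= i)%N -> E i j = 0.
  by apply/matrixP => i j; rewrite mxE (main n) // subnn.
elim: r i j => [|r IH] i j ri; first by have := ltn_ord i; lia.
have [lt|le] := leqP (n - r) i; first exact: IH.
have rn : (r <= n)%N by lia.
have s1 : (n - r + r <= n)%N by lia.
have is_ : i.+1 = (n - r)%N :> nat by lia.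
have [M M1 M2] := minor_inv (nz r rn).
set S := Sel r (n - r) in M1 M2.
have SE : S *m E = 0.
  apply/matrixP => x y; have lx := ltn_ord x.
  have lt : (n - r + x < n)%N by lia.
  by rewrite (@Sel_mul _ _ _ _ _ _ _ (Ordinal lt)) // mxE IH //=; lia.
have GS : S^T *m (S *m (Ga *m S^T)) = Ga *m S^T.
  apply: Sel_full => a x ha; have lx := ltn_ord x.
  have lt : (n - r + x < n)%N by lia.
  by rewrite (@mul_SelT _ _ _ _ _ _ _ _ (Ordinal lt)) // lG //=; have := ltn_ord a; lia.
have G0 : Ga *m S^T = 0.
  rewrite -GS -[S *m (Ga *m _)]mul1mx -M2 -!mulmxA GS.
  by rewrite (mulmxA Y) -EY !mulmxA -(mulmxA _ S E) SE mulmx0 !mul0mx.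
have ES : row i E *m S^T *m S = row i E.
  apply: mul_Sel_full => x b hb; rewrite mxE uE //; have := ltn_ord b; lia.
have E0 : row i E = 0.
  rewrite -ES -[row i E *m S^T]mulmx1 -M1 !mulmxA ES.
  have -> : row i E *m Y *m S^T = row i (E *m Y) *m S^T by rewrite row_mul.
  by rewrite EY row_mul -(mulmxA _ Ga) G0 mulmx0 !mul0mx.
by have := congr1 (fun M : 'rV[K]_n => M 0 j) E0; rewrite !mxE.
Qed.

(** The columns of [E] are treated from left to right. In column [b], comparison with
   [\tr E = 0] turns each [\tr (T * E) = 0] into the orthogonality of that column to
   a row [nu] of [T - 1]. As [k] varies, the vectors [nu *m X] are triangular, and
   the trailing minor of [X] on the rows from [b] on converts this into the vanishing
   of the entries of the column from row [b] on. *)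
Lemma projections_separate X Y E :
  (forall k l, (k + l <= n)%N -> mixed_minor X Y k l != 0) ->
  (forall r, (r <= n)%N -> minor r (n - r) (n - r) X != 0) ->
  (forall k l, (k + l <= n)%N -> (k + l < n)%N || (l == 0)%N -> exists T,
     [/\ rowproj (Pi (k + l) (n - (k + l))) T,
         T *m (X *m Pi k (n - k)) = X *m Pi k (n - k),
         T *m (Y *m Pi l (n - l)) = Y *m Pi l (n - l) & \tr (T *m E) = 0]) ->
  strict_upper E.
Proof.
move=> nzf nzX HT.
have trE : \tr E = 0.
  have [||T [[T1 _] _ _ <-]] := HT n 0%N; try lia.
  by move: T1; rewrite addn0 subnn Pi_full // mul1mx => ->; rewrite mul1mx.
suff main b (i j : 'I_n) : (j < b)%N -> (j <= i)%N -> E i j = 0.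
  by move=> i j; apply: (main j.+1).
elim: b i j => // b IH i j jb ji.
have [jb'|bj] := ltnP j b; first exact: IH.
have {jb bj} jb : j = b :> nat by lia.
have bn := ltn_ord j.
pose r := (n - b.+1)%N.
have rn : (r.+1 <= n)%N by rewrite /r; lia.
have er : (n - r.+1 = b)%N by rewrite /r; lia.
have eb : (n - r = b.+1)%N by rewrite /r; lia.
(* For each [k <= r], a row vector [nu] supported on the last [r.+1] coordinates,
   orthogonal to column [b] of [E] and to the last [k] columns of [X], but not to
   the column of [X] just before them. *)
have nuE k : (k <= r)%N -> exists nu : 'rV[K]_n,
   [/\ forall c : 'I_n, (c < b)%N -> nu 0 c = 0, nu *m E *m ei b = 0,
       forall q : 'I_n, (n - k <= q)%N -> (nu *m X) 0 q = 0 &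
       forall q : 'I_n, q = (n - k.+1)%N :> nat -> (nu *m X) 0 q != 0].
  move=> kr; have ekl : (k + (r - k) = r)%N by lia.
  have [||T [hT TX TY trT]] := HT k (r - k)%N; try (rewrite /r; lia).
  rewrite ekl eb in hT; have hT' := (rowproj_tr _ _ _).1 hT.
  have T_in (a c : 'I_n) : (b < a)%N -> T a c = (a == c)%:R.
    move=> ba; have -> : T a c = T^T c a by rewrite mxE.
    by rewrite (colproj_in _ hT') 1?eq_sym //; have := ltn_ord a; rewrite /r; lia.
  have T_out (a c : 'I_n) : (c <= b)%N -> T a c = 0.
    move=> cb; have -> : T a c = T^T c a by rewrite mxE.
    by rewrite (colproj_out _ hT') //; lia.
  pose nu : 'rV[K]_n := row j (T - 1%:M).
  have nuc c : nu 0 c = T j c - (j == c)%:R by rewrite !mxE.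
  have nuX p (A : 'M[K]_(n, p)) : T *m A = A -> nu *m A = 0.
    by move=> TA; rewrite -row_mul mulmxBl TA mul1mx subrr row0.
  have supp (c : 'I_n) : (c < b)%N -> nu 0 c = 0.
    by move=> cb; rewrite nuc T_out 1?ltnW // -val_eqE /= gtn_eqF ?subr0 // jb.
  exists nu; split=> //.
  - apply/matrixP => x y; rewrite !ord1 -jb mul_ei [RHS]mxE mxE.
    rewrite (eq_bigr (fun c => T j c * E c j - (j == c)%:R * E c j)); last first.
      by move=> c _; rewrite nuc mulrBl.
    rewrite sumrB [X in _ - X](bigD1 j) //= eqxx mul1r [X in _ - (_ + X)]big1 ?addr0; last first.
      by move=> c; rewrite eq_sym => /negPf ->; rewrite mul0r.
    move: trT; rewrite mxtraceM => trT.
    have e (c : 'I_n) : \sum_a T c a * E a c =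
        (if c == j then \sum_a T j a * E a j else 0) + (if (b < c)%N then E c c else 0).
      have [->|cj] := eqVneq c j; first by rewrite jb ltnn addr0.
      have [bc|cb] := ltnP b c.
        rewrite add0r (bigD1 c) //= T_in // eqxx mul1r big1 ?addr0 // => a ac.
        by rewrite T_in // eq_sym (negPf ac) mul0r.
      rewrite addr0 big1 // => a _.
      have [ab|ba] := leqP a b; first by rewrite T_out ?mul0r.
      rewrite IH ?mulr0 //; last by lia.
      by move: cj; rewrite -val_eqE /=; lia.
    move: trT; rewrite (eq_bigr _ (fun c _ => e c)) big_split /= -big_mkcond big_pred1_eq.
    move=> /eqP; rewrite addr_eq0 => /eqP ->; apply/eqP; rewrite -opprD oppr_eq0; apply/eqP;
      rewrite -[RHS]trE.
    rewrite /mxtrace [RHS](bigD1 j) //= addrC; congr (_ + _).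
    rewrite [RHS]big_mkcond; apply: eq_bigr => c _.
    have [->|cj] := eqVneq c j; first by rewrite jb ltnn.
    by case: ltnP => //= cb; rewrite IH //; move: cj; rewrite -val_eqE /=; lia.
  - move=> q hq; have := eq0_entry 0 q (nuX _ _ TX).
    rewrite mulmxA mul_Pi ifT //; have := ltn_ord q; move: kr; rewrite /r; lia.
  move=> q hq; apply/eqP => nq.
  have kl1 : (k.+1 + (r - k) <= n)%N by rewrite /r; lia.
  have := nzf _ _ kl1; rewrite /mixed_minor -rdet_sq => /(rdet_inv erefl) [B AB BA].
  have e1 : (n - (k.+1 + (r - k)) = b)%N by rewrite /r; lia.
  have Sfull : nu *m (Sel (k.+1 + (r - k)) b)^T *m Sel (k.+1 + (r - k)) b = nu.
    apply: mul_Sel_full => x c hc; rewrite ord1 supp //.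
    by have := ltn_ord c; move: hc; rewrite /r; lia.
  have nuF : nu *m mixed_cols X Y k.+1 (r - k) = 0.
    rewrite /mixed_cols mul_mx_row.
    have -> : nu *m (X *m (Sel k.+1 (n - k.+1))^T) = 0.
      apply/matrixP => x y; rewrite !ord1 mulmxA [RHS]mxE; have ly := ltn_ord y.
      have lt : (n - k.+1 + y < n)%N by rewrite /r in kr; lia.
      rewrite (@mul_SelT _ _ _ _ _ _ _ _ (Ordinal lt)) //.
      case: (posnP y) => y0.
        by have -> : Ordinal lt = q by [apply: val_inj; rewrite /= y0 addn0 hq].
      have := eq0_entry 0 (Ordinal lt) (nuX _ _ TX).
      rewrite mulmxA mul_Pi ifT //=; lia.
    have -> : nu *m (Y *m (Sel (r - k) (n - (r - k)))^T) = 0; last by rewrite row_mx0.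
    have le : (n - (r - k) + (r - k) <= n)%N by lia.
    by rewrite -(@mul_Pi_SelT K n _ _ le) !mulmxA -(mulmxA nu) (nuX _ _ TY) mul0mx.
  have : nu = 0.
    rewrite -Sfull -[X in X *m Sel _ _]mulmx1 -AB e1 !mulmxA Sfull.
    by rewrite nuF !mul0mx.
  move/matrixP/(_ 0 j); rewrite nuc mxE T_out ?jb // eqxx sub0r => /eqP.
  by rewrite oppr_eq0 oner_eq0.
have [M M1 M2] := minor_inv (nzX _ rn); rewrite er in M1 M2.
set S := Sel r.+1 b in M1 M2.
(* [X *m w] has the same entries as column [b] of [E] from row [b] on. *)
pose w := S^T *m (M *m (S *m (E *m ei b))).
have SX : S *m (X *m w) = S *m (E *m ei b).
  by rewrite /w !mulmxA M1 mul1mx.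
have w_out (a : 'I_n) : (a < b)%N -> w a 0 = 0 by move=> ab; rewrite /w SelT_out //; lia.
have nuw k : (k <= r)%N -> forall nu : 'rV[K]_n, (forall c : 'I_n, (c < b)%N -> nu 0 c = 0) ->
    nu *m E *m ei b = 0 -> nu *m X *m w = 0.
  move=> kr nu supp nE.
  have Sfull : nu *m S^T *m S = nu.
    apply: mul_Sel_full => x c hc; rewrite ord1 supp //.
    by have := ltn_ord c; move: hc; rewrite /r; lia.
  by rewrite -Sfull -!mulmxA SX !mulmxA Sfull -(mulmxA nu) mulmxA.
have w0 : w = 0.
  suff wm m (a : 'I_n) : (a < m)%N -> w a 0 = 0.
    by apply/colP => a; rewrite [RHS]mxE (wm a.+1).
  elim: m a => // m IHm a am.
  have [ab|ba] := ltnP a b; first exact: w_out.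
  have kr : (n - a.+1 <= r)%N by rewrite /r; lia.
  have [nu [supp nE nq nz]] := nuE _ kr.
  have := eq0_entry 0 0 (nuw _ kr nu supp nE); rewrite mxE (bigD1 a) //= big1 ?addr0.
    move=> /eqP; rewrite mulf_eq0 (negPf (nz a _)) ?orFb => [/eqP //|].
    by have := ltn_ord a; lia.
  move=> c ca; have [cm|mc] := ltnP c m; first by rewrite IHm ?mulr0.
  rewrite nq ?mul0r //; move: ca; rewrite -val_eqE /= => ca.
  by have := ltn_ord a; lia.
have /matrixP H := SX; rewrite w0 mulmx0 mulmx0 in SX.
have lt : (i - b < r.+1)%N by have := ltn_ord i; rewrite /r; lia.
have := congr1 (fun A : 'cV[K]_r.+1 => A (Ordinal lt) 0) SX.
rewrite mxE (@Sel_mul _ _ _ _ _ _ _ i) /=; last by lia.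
by rewrite -jb mul_ei.
Qed.

Variable d : K -> K.
Hypothesis dP : derivation d.

(** These minors are invariant under left multiplication by unipotent upper triangular
   matrices, and the claim is that they separate the orbits infinitesimally. The rows
   of [A] are treated from the bottom. For row [i], each killed minor with top row
   [i] gives a vector [be] orthogonal to [row i A *m X]; by [sliding] this row vector
   is a combination of the rows of [X] below row [i]. *)
Lemma minors_killed_rows X :
  (forall r t, (t + r <= n)%N -> minor r (n - r) t X != 0) ->
  (forall r t, (0 < r)%N -> (t + r <= n)%N -> d (minor r (n - r) t X) = 0) ->
  exists2 A, strict_upper A & map_mx d X = A *m X.
Proof.
move=> nz kill.
have uX : X \in unitmx.
  by have := nz n 0%N (leqnn _); rewrite subnn minor_full unitmxE unitfE.
pose A := map_mx d X *m invmx X.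
have dX : map_mx d X = A *m X by rewrite mulmxKV.
exists A => //.
suff main r (i j : 'I_n) : (n - r <= i)%N -> (j <= i)%N -> A i j = 0.
  by move=> i j; apply: (main n); rewrite subnn.
elim: r i j => [|r IH] i j ri ji; first by have := ltn_ord i; lia.
have [lt|le] := ltnP (n - r.+1) i; first by apply: IH => //; lia.
have [rn|nr] := ltnP r n; last by apply: IH => //; lia.
have is_ : i = (n - r.+1)%N :> nat by lia.
have {}IH (a b : 'I_n) : (i < a)%N -> (b <= a)%N -> A a b = 0 by move=> ia ba; apply: IH => //; lia.
(* The column [be t] is supported on the interval starting at [t] and pairs to 1
   with row [i] of [X], and to 0 with the rows below. *)
have beE t : (t + r < n)%N -> exists be : 'cV[K]_n,
   [/\ forall a : 'I_n, ~~ (t <= a < t + r.+1)%N -> be a 0 = 0,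
       forall a : 'I_n, (i <= a)%N -> (X *m be) a 0 = (a == i)%:R &
       row i A *m X *m be = 0].
  move=> tr; have t1 : (t + r.+1 <= n)%N by lia.
  have s1 : (n - r.+1 + r.+1 <= n)%N by lia.
  have [G [hG hr _ _ hP]] := minor_grad s1 t1 (nz r.+1 t t1).
  have := hG d dP; rewrite kill // => /esym/eqP.
  rewrite mulf_eq0 (negPf (nz _ _ t1)) orbF dX mxtrace_mulC => /eqP tr0.
  have {}hr := (rowproj_tr _ _ _).1 hr.
  have T_in (a b : 'I_n) : (i <= a)%N -> (X *m G) a b = (a == b)%:R.
    move=> ia; have -> : (X *m G) a b = (X *m G)^T b a by rewrite [RHS]mxE.
    by rewrite (colproj_in _ hr) 1?eq_sym //; have := ltn_ord a; lia.
  have T_out (a b : 'I_n) : (b < i)%N -> (X *m G) a b = 0.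
    move=> ia; have -> : (X *m G) a b = (X *m G)^T b a by rewrite [RHS]mxE.
    by rewrite (colproj_out _ hr) //; lia.
  exists (G *m ei i); split.
  - by move=> a ha; rewrite -hP -mulmxA Pi_mul (negPf ha).
  - by move=> a ia; rewrite mulmxA mul_ei T_in.
  apply/matrixP => x y; rewrite !ord1 mulmxA mul_ei -mulmxA mxE [RHS]mxE.
  rewrite -[RHS]tr0 -[\tr _]/(\tr _) -mulmxA mxtraceM [RHS](bigD1 i) //= [X in _ =
    _ + X]big1 ?addr0.
    by apply: eq_bigr => b _; rewrite mxE.
  move=> a ai; apply: big1 => b _.
  have [lt|ge] := ltnP a i; first by rewrite T_out ?mulr0.
  have ia : (i < a)%N by move: ai; rewrite -val_eqE /=; lia.
  have [ba|ab] := leqP b a; first by rewrite IH ?mul0r.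
  by rewrite T_in ?mulr0; [rewrite -val_eqE gtn_eqF ?mulr0|lia].
have r1 : (0 + r <= n)%N by lia.
have [M MM MM'] := minor_inv (nz r 0%N r1).
pose c := row i A *m X *m (Sel r 0)^T *m M.
(* [c] is chosen so that the first [r] entries of [al] vanish. *)
pose al := row i A *m X - c *m Sel r (n - r) *m X.
have al0 : al = 0.
  apply: (@sliding r al) => [b br|t tr].
    have -> : al 0 b = (al *m (Sel r 0)^T) 0 (Ordinal br).
      by rewrite (@mul_SelT _ _ _ r 0 _ 0 (Ordinal br) b).
    have -> : al *m (Sel r 0)^T = 0; last by rewrite mxE.
    by rewrite /al /c mulmxBl -!mulmxA (mulmxA (Sel r (n - r))) MM' mulmx1 subrr.
  have [be [b_out b_in b_or]] := beE t tr; exists be; split=> //.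
    rewrite /al mulmxBl b_or sub0r -!mulmxA.
    have -> : Sel r (n - r) *m (X *m be) = 0; last by rewrite !mulmx0 oppr0.
    apply/matrixP => x y; have lx := ltn_ord x.
    have lt : (n - r + x < n)%N by lia.
    rewrite (@Sel_mul _ _ _ _ _ _ _ (Ordinal lt)) // [RHS]mxE ord1 b_in /=; last by lia.
    by rewrite -val_eqE /= (_ : (_ == _) = false) //; lia.
  move=> a ea; apply/eqP => ba.
  have t1 : (t + r <= n)%N by lia.
  have [M' M1 M2] := minor_inv (nz r t t1).
  have full : (Sel r t)^T *m (Sel r t *m be) = be.
    apply: Sel_full => b z; rewrite ord1 => hb.
    have [->//|ne] := eqVneq b a; apply: b_out.
    by move: ne; rewrite -val_eqE /=; lia.
  have be0 : be = 0.
    rewrite -full -[Sel r t *m be]mul1mx -M2 -!mulmxA full.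
    have -> : Sel r (n - r) *m (X *m be) = 0; last by rewrite !mulmx0.
    apply/matrixP => x y; have lx := ltn_ord x.
    have lt : (n - r + x < n)%N by lia.
    rewrite (@Sel_mul _ _ _ _ _ _ _ (Ordinal lt)) // [RHS]mxE ord1 b_in /=; last by lia.
    by rewrite -val_eqE /= (_ : (_ == _) = false) //; lia.
  have := b_in i (leqnn _); rewrite be0 mulmx0 mxE eqxx.
  by move/esym/eqP; rewrite oner_eq0.
have rowA : row i A = c *m Sel r (n - r).
  have : row i A *m X = c *m Sel r (n - r) *m X by apply/eqP; rewrite -subr_eq0 -/al al0.
  by move/(congr1 (mulmx^~ (invmx X))); rewrite /= !mulmxK.
have -> : A i j = row i A 0 j by rewrite [RHS]mxE.
rewrite rowA mxE big1 // => k _; rewrite [Sel _ _ _ _]mxE (_ : (_ == _) = false) ?mulr0 //.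
by lia.
Qed.

Lemma minors_killed_cols Y :
  (forall r s, (s + r <= n)%N -> minor r s (n - r) Y != 0) ->
  (forall r s, (0 < r)%N -> (s + r <= n)%N -> d (minor r s (n - r) Y) = 0) ->
  exists2 B, strict_lower B & map_mx d Y = Y *m B.
Proof.
move=> nz kill; have [r t tr|r t r0 tr|A sA dY] := @minors_killed_rows Y^T.
- by rewrite minor_tr nz.
- by rewrite minor_tr kill.
exists A^T; first by move=> i j ij; rewrite mxE sA.
by rewrite -[LHS]trmxK map_trmx dY trmx_mul trmxK.
Qed.

End Strict.

(** * The functions [psi] in Hessenberg form *)

Section DetSplit.
Variable K : fieldType.

Lemma det_lower_split n p q (W : 'M[K]_n) (A : 'M[K]_p) (D : 'M[K]_q) :
  n = (p + q)%N ->
  (forall (i j : 'I_p) (i' j' : 'I_n), i' = i :> nat -> j' = j :> nat -> W i' j' = A i j) ->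
  (forall (i j : 'I_q) (i' j' : 'I_n), i' = (p + i)%N :> nat -> j' = (p + j)%N :> nat ->
     W i' j' = D i j) ->
  (forall i j : 'I_n, (i < p)%N -> (p <= j)%N -> W i j = 0) ->
  \det W = \det A * \det D.
Proof.
move=> e; subst n => WA WD W0.
rewrite -[W]submxK -(_ : A = ulsubmx W) -1?(_ : D = drsubmx W).
- rewrite (_ : ursubmx W = 0) ?det_lblock //.
  by apply/matrixP => i j; rewrite !mxE W0 //= leq_addr.
- by apply/matrixP => i j; rewrite !mxE (WD i j).
- by apply/matrixP => i j; rewrite !mxE (WA i j).
Qed.

Lemma det_upper_split n p q (W : 'M[K]_n) (A : 'M[K]_p) (D : 'M[K]_q) :
  n = (p + q)%N ->
  (forall (i j : 'I_p) (i' j' : 'I_n), i' = i :> nat -> j' = j :> nat -> W i' j' = A i j) ->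
  (forall (i j : 'I_q) (i' j' : 'I_n), i' = (p + i)%N :> nat -> j' = (p + j)%N :> nat ->
     W i' j' = D i j) ->
  (forall i j : 'I_n, (p <= i)%N -> (j < p)%N -> W i j = 0) ->
  \det W = \det A * \det D.
Proof.
move=> e WA WD W0; rewrite -det_tr -(det_tr A) -(det_tr D).
apply: det_lower_split => // [i j i' j' ei ej|i j i' j' ei ej|i j ip pj].
- by rewrite !mxE (WA j i).
- by rewrite !mxE (WD j i).
- by rewrite mxE W0.
Qed.

Lemma det_upper n (A : 'M[K]_n) : upper A -> \det A = \prod_i A i i.
Proof.
move=> uA; rewrite -det_tr det_trig; first by apply: eq_bigr => i _; rewrite mxE.
by apply/is_trig_mxP => i j ij; rewrite mxE uA.
Qed.

Lemma det_col_reindex n (A B : 'M[K]_n) (f : 'I_n -> 'I_n) : injective f ->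
  (forall i j, B i j = A i (f j)) -> exists b : bool, \det A = (-1) ^+ b * \det B.
Proof.
move=> fi BA; exists (odd_perm (perm fi)).
have -> : B = col_perm (perm fi) A by apply/matrixP => i j; rewrite mxE permE BA.
by rewrite col_permE det_mulmx det_perm odd_permV mulrCA -signr_addb addbb mulr1.
Qed.
End DetSplit.

(** The columns of [psi_mx], over any commutative ring so that they can be evaluated
   at a point. *)
Definition psicol (R : comNzRingType) n (U : 'M[R]_n) k l j : 'cV[R]_n :=
  if (j < k)%N then ei (n - k + j) else
  if (j < k + l)%N then U *m ei (n - l + (j - k)) else U ^+ (j - (k + l)).+2 *m ei n.-1.

Section PsiTop.
Variables (K : fieldType) (n : nat).
Implicit Types (U H N : 'M[K]_n).
Local Notation Sel := (@Sel K n).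
Local Notation ei := (@ei K n).

Lemma psi_cols U k l : (k + l <= n)%N ->
  psi U k l = \det (\matrix_(a < n, j < n) psicol U k l j a 0).
Proof.
move=> kl; apply: rdet_entry; rewrite //; first by lia.
move=> i j i' j' /val_inj <- ej; have lj := ltn_ord j.
rewrite !mxE /psicol; case: splitP => c ec; have lc := ltn_ord c.
  rewrite mxE; case: splitP => e ee; have le := ltn_ord e.
    by rewrite ifT; [rewrite !mxE; congr (_ == _)%:R; lia|lia].
  rewrite ifF; last by lia.
  rewrite ifT; last by lia.
  have lt : (n - l + (j - k) < n)%N by lia.
  rewrite (@mul_SelT _ _ _ _ _ _ _ _ (Ordinal lt)) /=; last by lia.
  by rewrite -[(n - l + _)%N]/(nat_of_ord (Ordinal lt)) mul_ei.
rewrite ifF; last by lia.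
rewrite ifF; last by lia.
have -> : (j - (k + l) = c)%N by lia.
by rewrite mxE.
Qed.

Definition psi_top_mx U k l p : 'M[K]_(n, p) :=
  \matrix_(a, j) if (j < (n - k - l).+1)%N then (U ^+ j.+1 *m ei n.-1) a 0
                 else (U *m ei (n - l + (j - (n - k - l).+1))) a 0.

(** The first [k] columns in [psi U k l] are the last basis vectors, so it is a minor
   of the other columns up to sign. The last column [U e] of the block of [U], with
   [e] the last basis vector, is moved in front of [U ^ 2 e], [U ^ 3 e] and so on, so
   that the columns form the beginning of a Krylov sequence followed by columns of
   [U]. *)
Lemma psi_top U k l : (0 < l)%N -> (k + l <= n)%N ->
  exists b : bool, psi U k l = (-1) ^+ b * \det (Sel (n - k) 0 *m psi_top_mx U k l (n - k)).
Proof.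
move=> l0 kl; rewrite psi_cols //.
(* The reordering of columns: the Krylov columns, the rest of the block of [U], then
   the basis vectors. *)
pose s p := if (p < (n - k - l).+1)%N then (k + l.-1 + p)%N else
  if (p < n - k)%N then (k + (p - (n - k - l).+1))%N else (p - (n - k))%N.
have sn (p : 'I_n) : (s p < n)%N by rewrite /s; have := ltn_ord p; do 2?case: ifP; lia.
pose f p := Ordinal (sn p).
have fi : injective f.
  move=> p q /(congr1 val) /= e; apply: ord_inj; move: e; rewrite /s.
  by have := ltn_ord p; have := ltn_ord q; do 4?case: ifP; lia.
pose B : 'M[K]_n := \matrix_(a, p) if (p < n - k)%N then psi_top_mx U k l n a p
                                   else (a == p :> nat)%:R.
have [|b ->] := det_col_reindex (A := \matrix_(a, j) psicol U k l j a 0) (B := B) fi.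
  move=> a p; rewrite [LHS]mxE [RHS]mxE -[nat_of_ord (f p)]/(s p); have lp := ltn_ord p.
  have [h1|h1] := ltnP p (n - k); last first.
    have -> : s p = (p - (n - k))%N by rewrite /s; do 2?case: ifP; lia.
    rewrite /psicol ifT; last by lia.
    by rewrite mxE; congr (_ == _)%:R; lia.
  rewrite [LHS]mxE; have [h2|h2] := ltnP p (n - k - l).+1.
    have -> : s p = (k + l.-1 + p)%N by rewrite /s; do 2?case: ifP; lia.
    rewrite /psicol ifF; last by lia.
    case: ifP => h3.
      have -> : nat_of_ord p = 0%N by lia.
      have -> : (n - l + (k + l.-1 + 0 - k) = n.-1)%N by lia.
      by rewrite expr1.
    by have -> : ((k + l.-1 + p - (k + l)).+2 = p.+1)%N by lia.
  have -> : s p = (k + (p - (n - k - l).+1))%N by rewrite /s; do 2?case: ifP; lia.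
  rewrite /psicol ifF; last by lia.
  rewrite ifT; last by lia.
  by rewrite addKn.
exists b; congr (_ * _).
rewrite (@det_lower_split _ n (n - k) k B (Sel (n - k) 0 *m psi_top_mx U k l (n - k)) 1%:M).
- by rewrite det1 mulr1.
- by lia.
- move=> i j i' j' hi hj; have := ltn_ord j; move=> lj.
  rewrite (@Sel_mul _ _ _ _ _ _ _ i') ?add0n // /B mxE hj lj.
  by rewrite [LHS]mxE [RHS]mxE hj.
- move=> i j i' j' hi hj; rewrite /B mxE ifF; last by lia.
  by rewrite mxE hi hj eqn_add2l.
- move=> i j hi hj; rewrite /B mxE ifF; last by lia.
  by rewrite (_ : (_ == _) = false) //; lia.
Qed.

(** For [k = 0] every column of the matrix carries a factor [U], and without it the
   columns are those for [(l, 1)]. *)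
Lemma psi0 U l : (0 < l < n)%N -> psi U 0 l = \det U * psi U l 1.
Proof.
move=> ll; rewrite !psi_cols; try lia.
rewrite -det_mulmx; congr (\det _).
apply/matrixP => a j; have lj := ltn_ord j.
have -> : (U *m \matrix_(a0, j0) psicol U l 1 j0 a0 0) a j =
          (U *m psicol U l 1 j) a 0.
  by rewrite !mxE; apply: eq_bigr => c _; rewrite mxE.
rewrite mxE /psicol ltn0 add0n subn0.
case: ifP => h1 //; case: ifP => h2.
  have -> : nat_of_ord j = l by lia.
  have -> : (n - 1 + (l - l) = n.-1)%N by lia.
  by rewrite subnn !expmxS expr0 mulmx1 mulmxA.
rewrite mulmxA -(expmxS U); congr ((U ^+ _ *m _) _ _); lia.
Qed.

Lemma psi0n U : (0 < n)%N -> psi U 0 n = \det U.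
Proof.
move=> n0; rewrite psi_cols //; congr (\det _).
apply/matrixP => a j; rewrite mxE /psicol ltn0 add0n subnn subn0 add0n ltn_ord.
by rewrite mul_ei.
Qed.

Lemma rdet_mulr m p (A : 'M[K]_(m, p)) (B : 'M[K]_p) : m = p ->
  rdet (A *m B) = rdet A * \det B.
Proof. by move=> e; subst m; rewrite !rdet_sq det_mulmx. Qed.

Lemma rdet_mull m p (A : 'M[K]_(m, p)) (B : 'M[K]_m) : m = p ->
  rdet (B *m A) = \det B * rdet A.
Proof. by move=> e; subst m; rewrite !rdet_sq det_mulmx. Qed.

Definition unilower N := lower N /\ forall i, N i i = 1.

Lemma det_unilower N : unilower N -> \det N = 1.
Proof.
move=> [l u]; rewrite det_trig; last exact/is_trig_mxP.
by rewrite big1.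
Qed.

(** A unipotent lower triangular [N] preserves the span of the last basis vectors and
   fixes the last one, so it acts on the columns of [psi_mx] through a block diagonal
   matrix [La] of determinant 1. *)
Lemma psi_conj U H N k l : (0 < l)%N -> (k + l <= n)%N -> unilower N -> U *m N = N *m H ->
  psi U k l = psi H k l.
Proof.
move=> l0 kl uN UN; have [lN dN] := uN.
have en : n = (k + l + (n - k - l))%N by lia.
have NS r : (r <= n)%N ->
    (Sel r (n - r))^T *m (Sel r (n - r) *m N *m (Sel r (n - r))^T) = N *m (Sel r (n - r))^T.
  move=> rn; rewrite -mulmxA; apply: Sel_full => a j ha; have lj := ltn_ord j.
  have lt : (n - r + j < n)%N by lia.
  by rewrite (@mul_SelT _ _ _ _ _ _ _ _ (Ordinal lt)) // lN //=; have := ltn_ord a; lia.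
have dS r : (r <= n)%N -> \det (Sel r (n - r) *m N *m (Sel r (n - r))^T) = 1.
  move=> rn; have ent (i j : 'I_r) (i' j' : 'I_n) : i' = (n - r + i)%N :> nat ->
      j' = (n - r + j)%N :> nat -> (Sel r (n - r) *m N *m (Sel r (n - r))^T) i j = N i' j'.
    by move=> ei ej; rewrite (mul_SelT _ _ ej) (Sel_mul _ _ ei).
  have lt (i : 'I_r) : (n - r + i < n)%N by have := ltn_ord i; lia.
  rewrite det_trig; last first.
    apply/is_trig_mxP => i j ij.
    by rewrite (ent i j (Ordinal (lt i)) (Ordinal (lt j))) // lN //= ltn_add2l.
  by rewrite big1 // => i _; rewrite (ent i i (Ordinal (lt i)) (Ordinal (lt i))).
have Ne : N *m ei n.-1 = ei n.-1.
  have lt : (n.-1 < n)%N by lia.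
  apply/colP => a; rewrite -[n.-1]/(nat_of_ord (Ordinal lt)) mul_ei mxE.
  have [->|ne] := eqVneq a (Ordinal lt); first by rewrite dN eqxx.
  move: ne; rewrite -val_eqE /= => ne; rewrite (negPf ne) lN //=; have := ltn_ord a; lia.
have UsN s : U ^+ s *m N = N *m H ^+ s.
  elim: s => [|s IH]; first by rewrite !expr0 mulmx1 mul1mx.
  by rewrite expmxSr -mulmxA UN mulmxA IH -mulmxA -expmxSr.
pose La := block_mx (block_mx (Sel k (n - k) *m N *m (Sel k (n - k))^T) 0 0
   (Sel l (n - l) *m N *m (Sel l (n - l))^T)) 0 0 (1%:M : 'M[K]_(n - k - l)).
have eq : psi_mx U k l *m La = N *m psi_mx H k l.
  rewrite /psi_mx /La !mul_row_block !mulmx0 !addr0 !add0r mulmx1 !mul_mx_row.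
  congr (row_mx (row_mx _ _) _).
  - by rewrite NS //; lia.
  - by rewrite -mulmxA NS ?(mulmxA N) -?UN ?mulmxA //; lia.
  - apply/matrixP => a t; rewrite mxE -{1}Ne mulmxA UsN -mulmxA.
    by rewrite [LHS]mxE [RHS]mxE; apply: eq_bigr => c _; rewrite [in RHS]mxE.
have := congr1 (@rdet _ _ _) eq.
rewrite (rdet_mull _ N en) (det_unilower uN) mul1r => eqd.
rewrite /psi -eqd (rdet_mulr _ La en).
have kn : (k <= n)%N by lia.
have ln : (l <= n)%N by lia.
by rewrite /La det_ublock det_ublock (dS k kn) (dS l ln) det1 !mulr1.
Qed.
End PsiTop.

Section Hessenberg.
Variables (K : fieldType) (n : nat).
Implicit Types (U H N R S : 'M[K]_n).
Local Notation Sel := (@Sel K n).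
Local Notation ei := (@ei K n).

Definition krylov U : 'M[K]_n := \matrix_(a, j) (U ^+ j.+1 *m ei n.-1) a 0.

Lemma krylov_ei U (j : 'I_n) : krylov U *m ei j = U ^+ j.+1 *m ei n.-1.
Proof. by apply/colP => a; rewrite mul_ei mxE. Qed.

Lemma psi_krylov U t : (0 < t <= n)%N ->
  exists b : bool, psi U (n - t) 1 = (-1) ^+ b * minor t 0 0 (krylov U).
Proof.
move=> tn; have [||b ->] := @psi_top K n U (n - t) 1; try lia.
exists b; congr (_ * _).
have e : (n - (n - t) = t)%N by lia.
rewrite e /minor -mulmxA; congr (\det (_ *m _)).
apply/matrixP => a j; have lj := ltn_ord j.
have lt : (j < n)%N by lia.
rewrite (@mul_SelT _ _ _ _ _ _ _ _ (Ordinal lt)) // [LHS]mxE [RHS]mxE ifT //.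
by rewrite e; lia.
Qed.

(** The triangular factorisation [krylov U = N R], whose second factor is the Krylov
   matrix of [H = N^-1 U N]. Column [t] of [S = R^-1] is a column of the inverse of a
   leading submatrix of the Krylov matrix. *)
Lemma hessenberg_form U :
  (0 < n)%N -> (forall t, (0 < t <= n)%N -> minor t 0 0 (krylov U) != 0) ->
  exists N H, [/\ unilower N, U *m N = N *m H, upper (krylov H) &
                  forall i, krylov H i i != 0].
Proof.
move=> n0 nz; pose Q := krylov U.
have colE (t : 'I_n) : exists s : 'cV[K]_n,
    (forall a : 'I_n, (t < a)%N -> s a 0 = 0) /\
    (forall a : 'I_n, (a <= t)%N -> (Q *m s) a 0 = (a == t)%:R).
  have lt := ltn_ord t.
  have t1 : (0 + t.+1 <= n)%N by lia.
  have t2 : (0 < t.+1 <= n)%N by lia.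
  have [G [_ hr _ _ hP]] := minor_grad t1 t1 (nz _ t2).
  exists (G *m ei t); split=> a ha.
    by rewrite -hP -mulmxA Pi_mul ifF //; lia.
  rewrite mulmxA mul_ei; have {}hr := (rowproj_tr _ _ _).1 hr.
  have -> : (Q *m G) a t = (Q *m G)^T t a by rewrite [RHS]mxE.
  by rewrite (colproj_in _ hr) 1?eq_sym //; lia.
have [s sP] := fin_all_exists colE.
pose S : 'M[K]_n := \matrix_(a, t) s t a 0.
have Scol (t : 'I_n) : S *m ei t = s t by apply/colP => a; rewrite mul_ei mxE.
have uS : upper S by move=> a t ta; rewrite mxE (sP t).1.
pose N := Q *m S.
have NE (a t : 'I_n) : N a t = (Q *m s t) a 0 by rewrite -Scol mulmxA mul_ei.
have uN : unilower N.
  split=> [a t at_|a]; rewrite NE (sP _).2 ?eqxx //; last exact: ltnW.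
  by rewrite -val_eqE /= ltn_eqF.
have N_unit : N \in unitmx by rewrite unitmxE det_unilower // unitr1.
pose R := invmx N *m Q.
have RS : R *m S = 1%:M by rewrite -mulmxA mulVmx.
have [uR _] := upper_inv RS uS.
have [_ Rd] := upper_inv (mulmx1C RS) uR.
pose H := invmx N *m U *m N.
have UN : U *m N = N *m H by rewrite !mulmxA mulmxV // mul1mx.
(* [N] intertwines [H] and [U] and fixes the last basis vector. *)
have kR : krylov H = R.
  have HsN p : N *m H ^+ p = U ^+ p *m N.
    elim: p => [|p IH]; first by rewrite !expr0 mulmx1 mul1mx.
    by rewrite (expmxSr H) (mulmxA N) IH -(mulmxA _ N) -UN mulmxA -expmxSr.
  have Ne : N *m ei n.-1 = ei n.-1.
    have lt : (n.-1 < n)%N by lia.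
    apply/colP => a; rewrite -[n.-1]/(nat_of_ord (Ordinal lt)) mul_ei NE (sP _).2 ?mxE //=.
    by have := ltn_ord a; lia.
  rewrite -[krylov H](mulKmx N_unit); congr (_ *m _).
  apply/matrixP => a t; rewrite -[LHS](mul_ei _ _ 0) -mulmxA krylov_ei mulmxA HsN -mulmxA Ne.
  by rewrite /Q [RHS]mxE.
by exists N, H; split; rewrite ?kR.
Qed.

Lemma krylov_step H (t t' : 'I_n) : t' = t.+1 :> nat ->
  H *m (krylov H *m ei t) = krylov H *m ei t'.
Proof. by move=> e; rewrite !krylov_ei mulmxA -expmxS e. Qed.

(** [H] maps each column of its Krylov matrix to the next one, and the last basis
   vector to the first column. *)
Lemma hessenberg_shape H : upper (krylov H) -> (forall i, krylov H i i != 0) ->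
  (forall a t : 'I_n, (t.+1 < a)%N -> H a t = 0) /\
  (forall a t : 'I_n, t.+1 = n -> (0 < a)%N -> H a t = 0).
Proof.
move=> uR Rd; split=> [|a t tn a0]; last first.
  rewrite -(mul_ei _ _ 0) (_ : nat_of_ord t = n.-1); last by lia.
  have z : (0 < n)%N by lia.
  have := uR a (Ordinal z) a0; rewrite mxE /= expr1 //.
suff main m (a t : 'I_n) : (t < m)%N -> (t.+1 < a)%N -> H a t = 0.
  by move=> a t; apply: (main t.+1).
elim: m a t => // m IH a t tm ta.
have lt : (t.+1 < n)%N by have := ltn_ord a; lia.
have := @krylov_step H t (Ordinal lt) erefl.
move/(congr1 (fun A : 'cV[K]_n => A a 0)); rewrite mulmxA !mul_ei [RHS]uR //=.
rewrite mxE (bigD1 t) //= big1 ?addr0.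
  by move/eqP; rewrite mulf_eq0 (negPf (Rd t)) orbF => /eqP.
move=> c ct; have [cm|mc] := ltnP c t; first by rewrite IH ?mul0r //; lia.
by rewrite uR ?mulr0 //; move: ct; rewrite -val_eqE /=; lia.
Qed.

(** Over a triangular Krylov matrix, the minor in [psi_top] is block triangular. *)
Lemma hessenberg_psi H k l : upper (krylov H) -> (0 < l)%N -> (k + l <= n)%N ->
  exists b : bool, psi H k l = (-1) ^+ b *
    (minor (n - k - l).+1 0 0 (krylov H) * minor l.-1 (n - k - l).+1 (n - l) H).
Proof.
move=> uR l0 kl; have [b ->] := psi_top H l0 kl.
exists b; congr (_ * _); set m := (n - k - l)%N; rewrite /minor.
have ltl (i : 'I_m.+1) : (i < n)%N by have := ltn_ord i; rewrite /m; lia.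
apply: (@det_upper_split _ (n - k) m.+1 l.-1); first by rewrite /m; lia.
- move=> i j i' j' ei ej.
  have -> : (Sel m.+1 0 *m krylov H *m (Sel m.+1 0)^T) i j =
            krylov H (Ordinal (ltl i)) (Ordinal (ltl j)).
    by rewrite (@mul_SelT _ _ _ _ _ _ _ _ (Ordinal (ltl j))) //
      (@Sel_mul _ _ _ _ _ _ _ (Ordinal (ltl i))).
  rewrite (@Sel_mul _ _ _ _ _ _ _ (Ordinal (ltl i))) ?ei //.
  by rewrite [LHS]mxE [RHS]mxE ej ifT.
- move=> i j i' j' ei ej; have li := ltn_ord i; have lj := ltn_ord j.
  have h1 : (m.+1 + i < n)%N by rewrite /m; lia.
  have h2 : (n - l + j < n)%N by lia.
  rewrite (@mul_SelT _ _ _ _ _ _ _ _ (Ordinal h2)) // (@Sel_mul _ _ _ _ _ _ _ (Ordinal h1)) //.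
  rewrite (@Sel_mul _ _ _ _ _ _ _ (Ordinal h1)) ?ei //.
  rewrite mxE ifF; last by rewrite ej /m; lia.
  by rewrite ej -/m addKn -[(n - l + j)%N]/(nat_of_ord (Ordinal h2)) mul_ei.
- move=> i j hi hj; have li := ltn_ord i; have lj := ltn_ord j.
  have h1 : (i < n)%N by lia.
  have h2 : (j < n)%N by lia.
  rewrite (@Sel_mul _ _ _ _ _ _ _ (Ordinal h1)) // mxE ifT //.
  by have := uR (Ordinal h1) (Ordinal h2); rewrite mxE => -> //=; lia.
Qed.

(** ** The coefficients of the pencil *)

(** Jacobi's formula makes [eta] orthogonal to the vector of polynomials
   [\adj (pencil 1 H) * e], whose coefficients span the Krylov space of [e]. *)
Lemma der_pencil_row d H (eta : 'rV[K]_n) (e : 'cV[K]_n) : derivation d ->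
  map_mx d H = e *m eta -> (forall i, d (pencil_det 1%:M H)`_i = 0) ->
  forall j, eta *m (H ^+ j *m e) = 0.
Proof.
move=> dP dH kill.
pose P := pencil 1%:M H; pose w := \adj P *m map_mx polyC e.
pose wc i : 'cV[K]_n := map_mx (coefp i) w.
have ew : map_mx polyC eta *m w = 0.
  have : map_poly d (\det P) = 0 by apply/polyP => i; rewrite (coef_der dP) coef0 kill.
  rewrite (der_det (map_poly_derivation dP)) der_pencil // map_mx_der1 // dH.
  rewrite /pencil map_mx0 add0r -scalemxAr mxtraceZ map_mxM mulmxA mxtrace_mulC.
  move=> /eqP; rewrite mulf_eq0 polyX_eq0 /= /mxtrace big_ord1 => /eqP h.
  by apply/matrixP => x y; rewrite !ord1 h mxE.
have eta_w i : eta *m wc i = 0.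
  apply/matrixP => x y; have /matrixP/(_ x y)/(congr1 (coefp i)) := ew.
  rewrite !mxE /= coef0 coef_sum => h; rewrite -[RHS]h; apply: eq_bigr => c _.
  by rewrite !mxE /= coefCM.
have Pw : P *m w = \det P *: map_mx polyC e.
  by rewrite mulmxA mul_mx_adj mul_scalar_mx.
have Pw' : w + 'X *: (map_mx polyC H *m w) = \det P *: map_mx polyC e.
  by rewrite -Pw /P /pencil map_mx1 mulmxDl mul1mx scalemxAl.
have Hwc i : map_mx (coefp i) (map_mx polyC H *m w) = H *m wc i.
  apply/matrixP => x y; rewrite !mxE /= coef_sum; apply: eq_bigr => c _.
  by rewrite !mxE /= coefCM.
have wS i : H *m wc i = (\det P)`_i.+1 *: e - wc i.+1.
  apply/matrixP => x y; have /matrixP/(_ x y)/(congr1 (coefp i.+1)) := Pw'.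
  rewrite -Hwc !mxE /= coefD coefXM coefMC /= => <-.
  by rewrite addrC addKr.
have w0 : wc 0%N = (\det P)`_0 *: e.
  apply/matrixP => x y; have /matrixP/(_ x y)/(congr1 (coefp 0%N)) := Pw'.
  by rewrite !mxE /= coefD coefXM coefMC /= addr0.
have det0 : (\det P)`_0 = 1.
  rewrite -horner_coef0 -[RHS](det1 K n) -[LHS]/(horner_eval 0 (\det P)) -det_map_mx.
  congr (\det _); apply/matrixP => x y; rewrite !mxE /= /horner_eval.
  by rewrite hornerD hornerM hornerX mul0r addr0 hornerC.
have main j : forall i, eta *m (H ^+ j *m wc i) = 0.
  elim: j => [|j IH] i; first by rewrite expr0 mul1mx.
  rewrite expmxSr -mulmxA wS mulmxBr mulmxBr IH subr0 -!scalemxAr.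
  by have := IH 0%N; rewrite w0 det0 scale1r => ->; rewrite scaler0.
by move=> j; have := main j 0%N; rewrite w0 det0 scale1r.
Qed.

Lemma pencil_det_conj X U N H : N \in unitmx -> U *m N = N *m H ->
  forall Y, Y = X *m U -> pencil_det X Y = (\det X)%:P * pencil_det 1%:M H.
Proof.
move=> uN UN Y ->; rewrite /pencil_det -!/(pencil _ _).
have e : pencil X (X *m U) *m map_mx polyC N = map_mx polyC (X *m N) *m pencil 1%:M H.
  rewrite -pencil_mulr -pencil_mull; congr (pencil _ _); first by rewrite mulmx1.
  by rewrite -mulmxA UN mulmxA.
have := congr1 (@determinant _ _) e; rewrite !det_mulmx !det_map_mx (det_mulmx X) rmorphM /=.
move=> h; apply: (mulIf (x := (\det N)%:P)); last by rewrite h mulrAC.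
by rewrite polyC_eq0 -unitfE -unitmxE.
Qed.

Lemma der_factor (d : K -> K) x y : derivation d -> x != 0 -> d x = 0 -> d (x * y) = 0 ->
  d y = 0.
Proof.
move=> dP x0 dx; rewrite (derM dP) dx mul0r add0r => /eqP.
by rewrite mulf_eq0 (negPf x0) => /eqP.
Qed.

Lemma der_signM (d : K -> K) (b : bool) x : derivation d -> d ((-1) ^+ b * x) = (-1) ^+ b * d x.
Proof. by move=> dP; rewrite (derM dP) (der_sign dP) mul0r add0r. Qed.

(** By [hessenberg_psi] the functions [psi] are, up to sign, products of leading
   minors of the Krylov matrix and of solid minors on the last columns of [B], which
   is [H] without its first row and last column. Hence [d B = B Ga] with [Ga]
   strictly lower triangular, while [B] and [d B] are upper triangular: [B] is
   killed. The first row of [H] is killed by the characteristic polynomial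
   ([der_pencil_row]), as the first basis vector is cyclic. *)
Lemma hessenberg_killed d H : derivation d -> (1 < n)%N ->
  upper (krylov H) -> (forall i, krylov H i i != 0) ->
  (forall k l, (0 < l)%N -> (k + l <= n)%N -> psi H k l != 0) ->
  (forall k l, (0 < l)%N -> (k + l <= n)%N -> d (psi H k l) = 0) ->
  (forall i, d (pencil_det 1%:M H)`_i = 0) ->
  map_mx d H = 0.
Proof.
move=> dP n1 uR Rd nz kill killc.
have lead t : (0 < t <= n)%N -> minor t 0 0 (krylov H) != 0 /\ d (minor t 0 0 (krylov H)) = 0.
  move=> tn; have [b e] := psi_krylov H tn.
  have h1 : (0 < 1)%N by [].
  have h2 : (n - t + 1 <= n)%N by lia.
  have := nz _ _ h1 h2; have := kill _ _ h1 h2; rewrite e der_signM // => /eqP.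
  by rewrite !mulf_eq0 !signr_eq0 /= => /eqP -> ->.
pose B := Sel n.-1 1 *m H *m (Sel n.-1 0)^T.
have BE (i j : 'I_n.-1) (i' j' : 'I_n) : i' = i.+1 :> nat -> j' = j :> nat -> B i j = H i' j'.
  move=> ei ej; rewrite /B (@mul_SelT _ _ _ _ _ _ _ _ j') ?add0n //.
  by rewrite (@Sel_mul _ _ _ _ _ _ _ i') ?add1n.
have blk r s : (0 < r)%N -> (s + r <= n.-1)%N ->
    minor r s (n.-1 - r) B != 0 /\ d (minor r s (n.-1 - r) B) = 0.
  move=> r0 sr; have h2 : (n.-1 - r + r <= n.-1)%N by lia.
  rewrite /B minor_sub //.
  have h3 : (0 < r.+1)%N by [].
  have h4 : (n - r.+1 - s + r.+1 <= n)%N by lia.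
  have [b] := hessenberg_psi uR h3 h4.
  have -> : (n - (n - r.+1 - s) - r.+1 = s)%N by lia.
  have -> : (n - r.+1 = 0 + (n.-1 - r))%N by lia.
  rewrite [r.+1.-1]/= -[s.+1]add1n => e.
  have [l1 l2] : minor (1 + s) 0 0 (krylov H) != 0 /\ d (minor (1 + s) 0 0 (krylov H)) = 0.
    by apply: lead; lia.
  have k1 : (0 + (n.-1 - r) - s + r.+1 <= n)%N by lia.
  have := nz _ _ h3 k1; have := kill _ _ h3 k1; rewrite e der_signM // => /eqP.
  rewrite mulf_eq0 signr_eq0 /= => /eqP /(der_factor dP l1 l2) ->.
  by rewrite !mulf_eq0 !negb_or => /and3P [].
have nzB r s : (s + r <= n.-1)%N -> minor r s (n.-1 - r) B != 0.
  case: r => [|r] sr; last by apply: (blk _ _ _ _).1.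
  by rewrite /minor det_mx00 oner_neq0.
have [Ga sGa dB] := minors_killed_cols dP nzB (fun r s r0 sr => (blk r s r0 sr).2).
have [shape shape_last] := hessenberg_shape uR Rd.
have n'lt (i : 'I_n.-1) : (i.+1 < n)%N by have := ltn_ord i; lia.
have n'lt' (i : 'I_n.-1) : (i < n)%N by have := ltn_ord i; lia.
have uB : upper B.
  move=> i j ji; rewrite (BE _ _ (Ordinal (n'lt i)) (Ordinal (n'lt' j))) //.
  by apply: shape.
have unitB : B \in unitmx.
  by have := nzB n.-1 0%N (leqnn _); rewrite subnn minor_full unitmxE unitfE.
have [uBi _] := upper_inv (mulVmx unitB) uB.
have udB : upper (map_mx d B) by move=> i j ji; rewrite mxE uB // (der0 dP).
(* [Ga] is both strictly lower and upper triangular. *)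
have Ga0 : Ga = 0.
  have e : Ga = invmx B *m map_mx d B by rewrite dB mulKmx.
  apply/matrixP => i j; rewrite [RHS]mxE; have [ij|ji] := leqP i j; first exact: sGa.
  by rewrite e upperM.
have dH (i j : 'I_n) : (0 < i)%N -> d (H i j) = 0.
  move=> i0; have [jn|nj] := ltnP j.+1 n; last first.
    by rewrite shape_last ?(der0 dP) //; have := ltn_ord j; lia.
  have i1 : (i.-1 < n.-1)%N by have := ltn_ord i; lia.
  have j1 : (j < n.-1)%N by lia.
  have := BE (Ordinal i1) (Ordinal j1) i j; rewrite /= prednK // => <- //.
  by have := dB; rewrite Ga0 mulmx0 => /(eq0_entry (Ordinal i1) (Ordinal j1)); rewrite mxE.
have z : (0 < n)%N by lia.
pose z0 := Ordinal z.
pose eta := row z0 (map_mx d H).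
have dHe : map_mx d H = ei 0 *m eta.
  apply/matrixP => i j; rewrite [RHS]mxE big_ord1 !mxE.
  have [i0|i0] := posnP i; last by rewrite mul0r dH.
  by rewrite mul1r (_ : i = z0) //; apply: val_inj.
have cyc := der_pencil_row dP dHe killc.
(* The Krylov space of the last basis vector starts with a multiple of the first one. *)
have He : H *m ei n.-1 = krylov H z0 z0 *: ei 0.
  have kz a : krylov H a z0 = (H *m ei n.-1) a 0 by rewrite mxE /= expr1.
  apply/colP => a; rewrite -kz [RHS]mxE [ei 0 _ _]mxE.
  have [a0|a0] := posnP a; last by rewrite mulr0 uR.
  by rewrite mulr1 (_ : a = z0) //; apply: val_inj.
have etaR : eta *m krylov H = 0.
  apply/matrixP => x j; rewrite -(mul_ei _ _ 0) -mulmxA krylov_ei [RHS]mxE.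
  by rewrite expmxSr -mulmxA He -!scalemxAr cyc scaler0 mxE.
have eta0 : eta = 0.
  have uK : krylov H \in unitmx.
    by rewrite unitmxE det_upper // unitfE; apply/prodf_neq0 => i _.
  by rewrite -[eta](mulmxK uK) etaR mul0mx.
by rewrite dHe eta0 mulmx0.
Qed.

End Hessenberg.

Section LeadCoef.
Variable K : fieldType.

Lemma coef_prod_linear m (a b : 'I_m -> K) :
  let p := \prod_i ((a i)%:P + 'X * (b i)%:P) in
  (forall j, (m < j)%N -> p`_j = 0) /\ p`_m = \prod_i b i.
Proof.
elim: m a b => [|m IH] a b /=.
  rewrite !big_ord0; split=> [j j0|]; rewrite coef1 ?eqxx //.
  by rewrite gtn_eqF.
rewrite !big_ord_recr /=.
have [h1 h2] := IH (fun i => a (widen_ord (leqnSn m) i)) (fun i => b (widen_ord (leqnSn m) i)).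
set p := \prod_(i < m) _ in h1 h2 *.
have e j : (p * ((a ord_max)%:P + 'X * (b ord_max)%:P))`_j.+1 =
    p`_j.+1 * a ord_max + p`_j * b ord_max.
  by rewrite mulrDr coefD coefMC mulrA coefMC coefMX.
split=> [[|j] jm //|]; first by rewrite e !h1 ?mul0r ?addr0 //; lia.
by rewrite e h1 // mul0r add0r h2.
Qed.

Lemma coef_pencil_det n (X Y : 'M[K]_n) :
  [/\ (pencil_det X Y)`_0 = \det X, (pencil_det X Y)`_n = \det Y &
      forall j, (n < j)%N -> (pencil_det X Y)`_j = 0].
Proof.
have coefE j : (pencil_det X Y)`_j =
  \sum_(s : 'S_n) (-1) ^+ s * (\prod_i ((X i (s i))%:P + 'X * (Y i (s i))%:P))`_j.
  rewrite /pencil_det /determinant coef_sum; apply: eq_bigr => s _.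
  rewrite -(rmorph_sign (@polyC K)) coefCM; congr (_ * _`_j).
  by rewrite (eq_bigr (fun i => (X i (s i))%:P + 'X * (Y i (s i))%:P)) // => i _; rewrite !mxE.
split.
- rewrite coefE /determinant; apply: eq_bigr => s _; congr (_ * _).
  rewrite -horner_coef0 horner_prod; apply: eq_bigr => i _.
  by rewrite hornerD hornerC hornerM hornerX mul0r addr0.
- rewrite coefE /determinant; apply: eq_bigr => s _; congr (_ * _).
  exact: (coef_prod_linear _ _).2.
- by move=> j nj; rewrite coefE big1 // => s _; rewrite (coef_prod_linear _ _).1 ?mulr0.
Qed.
End LeadCoef.

Section Killed.
Variables (K : fieldType) (n : nat) (d : K -> K) (X Y : 'M[K]_n).
Local Notation ei := (@ei K n).
Hypothesis dP : derivation d.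
Hypothesis n2 : (1 < n)%N.
Let U := invmx X *m Y.

Hypothesis nzX : forall r t, (t + r <= n)%N -> minor r (n - r) t X != 0.
Hypothesis nzY : forall r s, (s + r <= n)%N -> minor r s (n - r) Y != 0.
Hypothesis nz_mixed : forall k l, (k + l <= n)%N -> mixed_minor X Y k l != 0.
Hypothesis nz_psi : forall k l, (0 < k)%N -> (0 < l)%N -> (k + l <= n)%N -> psi U k l != 0.
Hypothesis kill : forall x, x \in family_F X Y -> d x = 0.

Lemma killX r t : (0 < r)%N -> (t + r <= n)%N -> d (minor r (n - r) t X) = 0.
Proof.
move=> r0 tr; have := @fun_g_minor K n X (n - r).+1 t.+1.
have -> : (n.+1 - (n - r).+1 = r)%N by lia.
move=> /= <-; try lia; apply: kill; rewrite /family_F !mem_cat; apply/orP; left.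
by apply/allpairsPdep; exists (n - r).+1, t.+1; rewrite !mem_index_iota; split=> //; lia.
Qed.

Lemma killY r s : (0 < r)%N -> (s + r <= n)%N -> d (minor r s (n - r) Y) = 0.
Proof.
move=> r0 tr; have := @fun_h_minor K n Y s.+1 (n - r).+1.
have -> : (n.+1 - (n - r).+1 = r)%N by lia.
move=> /= <-; try lia; apply: kill; rewrite /family_F !mem_cat; apply/orP; right.
apply/orP; left.
by apply/allpairsPdep; exists s.+1, (n - r).+1; rewrite !mem_index_iota; split=> //; lia.
Qed.

Lemma detX_killed : \det X != 0 /\ d (\det X) = 0.
Proof.
have h : (0 + n <= n)%N by [].
have <- : minor n (n - n) 0 X = \det X by rewrite subnn minor_full.
by split; [exact: nzX|apply: killX => //; lia].
Qed.

Lemma detY_killed : \det Y != 0 /\ d (\det Y) = 0.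
Proof.
have h : (0 + n <= n)%N by [].
have <- : minor n 0 (n - n) Y = \det Y by rewrite subnn minor_full.
by split; [exact: nzY|apply: killY => //; lia].
Qed.

Let uX : X \in unitmx. Proof. by rewrite unitmxE unitfE; exact: detX_killed.1. Qed.

Let XU : X *m U = Y. Proof. exact: mulKVmx. Qed.

Lemma detU_killed : \det U != 0 /\ d (\det U) = 0.
Proof.
have e : \det X * \det U = \det Y by rewrite -det_mulmx XU.
have [x0 dx] := detX_killed; have [y0 dy] := detY_killed.
split; first by move: y0; rewrite -e mulf_eq0 negb_or => /andP [].
by apply: (der_factor dP x0 dx); rewrite e.
Qed.

Lemma kill_psi k l : (0 < k)%N -> (0 < l)%N -> (k + l <= n)%N -> d (psi U k l) = 0.
Proof.
move=> k0 l0 kl; have := fun_phiE X Y k0 l0 kl; rewrite -/U => e.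
have : d (fun_phi X Y k l) = 0.
  apply: kill; rewrite /family_F !mem_cat; do 3 (apply/orP; right); apply/orP; left.
  by apply/allpairsPdep; exists k, l; rewrite !mem_index_iota; split=> //; lia.
rewrite e -mulrA /sgn_phi; have [x0 dx] := detX_killed.
have ds m (z : K) : d ((-1) ^+ m * z) = (-1) ^+ m * d z.
  by rewrite (derM dP) (der_sign dP) mul0r add0r.
case: ifP => _; rewrite ds => /eqP; rewrite mulf_eq0 signr_eq0 => /eqP;
apply: der_factor => //; rewrite ?expf_neq0 //; exact: der_exp0.
Qed.

(** The case [k = 0] is reduced to [k > 0] by [psi0]. *)
Lemma psi_all k l : (0 < l)%N -> (k + l <= n)%N -> psi U k l != 0 /\ d (psi U k l) = 0.
Proof.
move=> l0 kl; have [k0|k0] := posnP k; last by split; [exact: nz_psi|exact: kill_psi].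
subst k; have [ln|nl] := ltnP l n; last first.
  have -> : l = n by lia.
  by rewrite psi0n; [exact: detU_killed|lia].
rewrite psi0 ?l0 //; have [u0 du] := detU_killed.
have l1 : (l + 1 <= n)%N by lia.
by rewrite mulf_neq0 ?nz_psi // (derM dP) du kill_psi // mul0r mulr0 addr0.
Qed.

Lemma kill_pencil i : d (pencil_det X Y)`_i = 0.
Proof.
have [c0 cn cj] := coef_pencil_det X Y.
have [->|i0] := eqVneq i 0%N; first by rewrite c0 detX_killed.2.
have [->|ne] := eqVneq i n; first by rewrite cn detY_killed.2.
have [lt|le] := ltnP n i; first by rewrite cj ?(der0 dP).
have : d (fun_c X Y i) = 0.
  apply: kill; rewrite /family_F !mem_cat; do 4 (apply/orP; right).
  by apply/mapP; exists i => //; rewrite mem_index_iota; lia.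
rewrite /fun_c (derM dP) (der_sign dP) mul0r add0r => /eqP.
by rewrite mulf_eq0 signr_eq0 => /eqP.
Qed.

(** In [U = N H N^-1] only [N] varies. *)
Lemma der_U : exists2 Om, strict_lower Om & map_mx d U = Om *m U - U *m Om.
Proof.
have [|t tn|N [H [uN UN uR Rd]]] := @hessenberg_form K n U; first by lia.
  have h2 : (n - t + 1 <= n)%N by lia.
  have := (psi_all (ltn0Sn 0) h2).1; have [b ->] := psi_krylov U tn.
  by rewrite mulf_eq0 negb_or => /andP [].
have N_unit : N \in unitmx by rewrite unitmxE det_unilower // unitr1.
have pc k l : (0 < l)%N -> (k + l <= n)%N -> psi H k l = psi U k l.
  by move=> l0 kl; rewrite (psi_conj l0 kl uN UN).
have dH : map_mx d H = 0.
  apply: hessenberg_killed => //.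
  - by move=> k l l0 kl; rewrite pc //; exact: (psi_all l0 kl).1.
  - by move=> k l l0 kl; rewrite pc //; exact: (psi_all l0 kl).2.
  move=> i; have := pencil_det_conj N_unit UN (esym XU) => e.
  have := kill_pencil i; rewrite e coefCM; exact: (der_factor dP detX_killed.1 detX_killed.2).
have [lN dN] := uN.
have lNi : lower (invmx N).
  have e : (invmx N)^T *m N^T = 1%:M by rewrite -trmx_mul mulmxV // trmx1.
  have uNT : upper N^T by move=> i j ji; rewrite mxE lN.
  by have [h _] := upper_inv e uNT => i j ij; have := h j i ij; rewrite mxE.
have sdN : strict_lower (map_mx d N).
  move=> i j; rewrite leq_eqVlt mxE => /orP [/eqP/val_inj ->|ij].
    by rewrite dN (der1 dP).
  by rewrite lN ?(der0 dP).
exists (map_mx d N *m invmx N); first exact: strict_lowerM.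
have e := congr1 (map_mx d) UN.
rewrite (map_mx_derM dP _ N) (map_mx_derM dP N) dH mulmx0 addr0 in e.
have -> : map_mx d U = (map_mx d N *m H - U *m map_mx d N) *m invmx N.
  by rewrite -e addrK mulmxK.
rewrite mulmxBl -[map_mx d N *m invmx N *m U]mulmxA.
have -> : invmx N *m U = H *m invmx N.
  by rewrite -[RHS](mulKmx N_unit) (mulmxA N) -UN mulmxK.
by rewrite !mulmxA.
Qed.

Lemma mixed_minor_k0 k : (k <= n)%N -> mixed_minor X Y k 0 = minor k (n - k) (n - k) X.
Proof.
move=> kn; rewrite /mixed_minor -rdet_sq; apply: rdet_entry; rewrite ?addn0 //.
move=> i j i' j' ei ej; have li := ltn_ord i; have lj := ltn_ord j.
have h1 : (n - k + i < n)%N by lia.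
have h2 : (n - k + j < n)%N by lia.
rewrite [RHS](@mul_SelT _ _ _ _ _ _ _ _ (Ordinal h2)) //
  [RHS](@Sel_mul _ _ _ _ _ _ _ (Ordinal h1)) //.
rewrite (@Sel_mul _ _ _ _ _ _ _ (Ordinal h1)) /=; last by lia.
rewrite [LHS]mxE.
case: splitP => c ec; last by case: c ec.
by rewrite (@mul_SelT _ _ _ _ _ _ _ _ (Ordinal h2)) //= -ec ej.
Qed.

Lemma mixed_minor_0l l : (l <= n)%N -> mixed_minor X Y 0 l = minor l (n - l) (n - l) Y.
Proof.
move=> kn; rewrite /mixed_minor -rdet_sq; apply: rdet_entry; rewrite ?add0n //.
move=> i j i' j' ei ej; have li := ltn_ord i; have lj := ltn_ord j.
have h1 : (n - l + i < n)%N by lia.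
have h2 : (n - l + j < n)%N by lia.
rewrite [RHS](@mul_SelT _ _ _ _ _ _ _ _ (Ordinal h2)) //
  [RHS](@Sel_mul _ _ _ _ _ _ _ (Ordinal h1)) //.
rewrite (@Sel_mul _ _ _ _ _ _ _ (Ordinal h1)) /=; last by lia.
rewrite [LHS]mxE.
case: splitP => c ec; first by case: c ec.
by rewrite (@mul_SelT _ _ _ _ _ _ _ _ (Ordinal h2)) //= ej ec add0n.
Qed.

Lemma kill_mixed_minor k l : (k + l <= n)%N -> (k + l < n)%N || (l == 0)%N ->
  d (mixed_minor X Y k l) = 0.
Proof.
move=> kl h; have [l0|l0] := posnP l.
  subst l; rewrite mixed_minor_k0; last by lia.
  have [->|k0] := posnP k; first by rewrite minor_empty (der1 dP).
  by apply: killX => //; lia.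
have [k0|k0] := posnP k.
  subst k; rewrite mixed_minor_0l; last by lia.
  by apply: killY => //; lia.
rewrite -fun_fE //; apply: kill; rewrite /family_F !mem_cat; do 2 (apply/orP; right).
apply/orP; left.
by apply/allpairsPdep; exists k, l; rewrite !mem_index_iota; split=> //; lia.
Qed.

Lemma tr_lower_strict_lower (A B : 'M[K]_n) : lower A -> strict_lower B -> \tr (A *m B) = 0.
Proof.
move=> lA sB; rewrite mxtraceM big1 // => i _; rewrite big1 // => j _.
have [ij|ji] := ltnP i j; first by rewrite lA ?mul0r.
by rewrite sB ?mulr0.
Qed.

(** The matrix [E] compares the three variations [A], [B], [Om] of [X], [Y], [U],
   which are tied together by [X U = Y]. *)
Lemma family_killed : map_mx d X = 0 /\ map_mx d Y = 0.
Proof.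
have [A sA dX] := minors_killed_rows dP nzX killX.
have [B sB dY] := minors_killed_cols dP nzY killY.
have [Om sOm dU] := der_U.
pose E := A + X *m Om *m invmx X.
have EX : E *m X = map_mx d X + X *m Om by rewrite mulmxDl -dX mulmxKV.
have EY : E *m Y = map_mx d Y + Y *m Om.
  have e := congr1 (map_mx d) XU; rewrite (map_mx_derM dP X) dU in e; rewrite -e.
  by rewrite -XU mulmxA EX mulmxDl mulmxBr !mulmxA -addrA subrK.
have trailX r : (r <= n)%N -> minor r (n - r) (n - r) X != 0 by move=> rn; apply: nzX; lia.
have trailY r : (r <= n)%N -> minor r (n - r) (n - r) Y != 0 by move=> rn; apply: nzY; lia.
have sE : strict_upper E.
  apply: (projections_separate nz_mixed trailX) => k l kl h.
  have [a [b [hd hr ha hb [c1 c2 c3 c4]]]] := mixed_minor_grad kl (nz_mixed kl).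
  have la : lower (a *m X) by apply: colproj_lower ha; lia.
  have lb : lower (b *m Y) by apply: colproj_lower hb; lia.
  exists (X *m a + Y *m b); split=> //.
  - rewrite mulmxDl -!mulmxA (mulmxA a) ha.1 (mulmxA b) c4.
    by rewrite mulmx0 addr0.
  - rewrite mulmxDl -!mulmxA (mulmxA a) c2 (mulmxA b) hb.1.
    by rewrite mulmx0 add0r.
  have := hd d dP; rewrite kill_mixed_minor // => /esym/eqP.
  rewrite mulf_eq0 (negPf (nz_mixed kl)) orbF => /eqP.
  have -> : map_mx d X = E *m X - X *m Om by rewrite EX addrK.
  have -> : map_mx d Y = E *m Y - Y *m Om by rewrite EY addrK.
  rewrite !mulmxBr !mxtraceD !raddfN /= !(mulmxA _ _ Om) (tr_lower_strict_lower la sOm)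
    (tr_lower_strict_lower lb sOm) !subr0 => e.
  by rewrite mulmxDl mxtraceD -!mulmxA ![\tr (_ *m (_ *m E))]mxtrace_mulC -!mulmxA.
have sG : strict_lower (B + Om) by move=> i j ij; rewrite mxE sB ?sOm ?addr0.
have E0 : E = 0.
  by apply: (big_cell_transversal sE sG _ trailY); rewrite EY dY mulmxDr.
have sO : strict_lower (- Om) by move=> i j ij; rewrite mxE sOm ?oppr0.
have dXO : map_mx d X = - (X *m Om).
  by apply/eqP; rewrite -addr_eq0 -EX E0 mul0mx.
have A0 : A = 0.
  by apply: (big_cell_transversal sA sO _ trailX); rewrite -dX dXO mulmxN.
have dX0 : map_mx d X = 0 by rewrite dX A0 mul0mx.
split=> //.
have Om0 : Om = 0.
  have : X *m Om = 0 by apply/eqP; rewrite -oppr_eq0 -dXO dX0.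
  by move/(congr1 (mulmx (invmx X))); rewrite mulKmx // mulmx0.
by move: EY; rewrite E0 mul0mx Om0 mulmx0 addr0.
Qed.
End Killed.

(** * Non-vanishing at the generic point *)

Lemma map_mx_exp (R S : comNzRingType) (f : {rmorphism R -> S}) n (U : 'M[R]_n) s :
  map_mx f (U ^+ s) = (map_mx f U) ^+ s.
Proof.
elim: s => [|s IH]; first by rewrite !expr0 [LHS]map_mx1.
by rewrite !exprS [LHS]map_mxM IH.
Qed.

Lemma map_psicol (R S : comNzRingType) (f : {rmorphism R -> S}) n (U : 'M[R]_n) k l j :
  map_mx f (psicol U k l j) = psicol (map_mx f U) k l j.
Proof.
have me b : map_mx f (ei b) = ei b :> 'cV_n.
  by apply/matrixP => a c; rewrite !mxE rmorph_nat.
rewrite /psicol; case: ifP => _; first exact: me.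
by case: ifP => _; rewrite map_mxM me // map_mx_exp.
Qed.

Lemma exprZmx (R : comNzRingType) n c (U : 'M[R]_n) s : (c *: U) ^+ s = c ^+ s *: U ^+ s.
Proof.
elim: s => [|s IH]; first by rewrite !expr0 scale1r.
by rewrite !exprS IH [LHS](_ : _ = (c *: U) *m (c ^+ s *: U ^+ s)) // -scalemxAl -scalemxAr scalerA.
Qed.

Lemma psicol_scale (R : comNzRingType) n (U : 'M[R]_n) c k l j : exists e,
  psicol (c *: U) k l j = c ^+ e *: psicol U k l j.
Proof.
rewrite /psicol; case: ifP => _; first by exists 0%N; rewrite expr0 scale1r.
case: ifP => _; first by exists 1%N; rewrite -scalemxAl expr1.
by exists (j - (k + l)).+2; rewrite exprZmx -scalemxAl.
Qed.

(** Each column of the matrix of [psi] is homogeneous in [U]. This allows replacing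
   [invmx X *m Y] by [\adj X *m Y], whose entries are polynomials. *)
Lemma psi_scale_neq0 (K : fieldType) n (U : 'M[K]_n) c k l : (k + l <= n)%N ->
  psi (c *: U) k l != 0 -> psi U k l != 0.
Proof.
move=> kl; apply: contraNneq; rewrite !psi_cols // => e0.
have [e eP] := fin_all_exists (fun j : 'I_n => psicol_scale U c k l j).
have -> : \matrix_(a, j) psicol (c *: U) k l j a 0 =
   (\matrix_(a, j) psicol U k l j a 0) *m diag_mx (\row_j (c ^+ e j)).
  by apply/matrixP => a j; rewrite mul_mx_diag !mxE eP mxE mulrC.
by rewrite det_mulmx e0 mul0r.
Qed.

Section Generic.
Variables (C : fieldType) (n : nat).
Local Notation K := (funfield C n).
Local Notation P := (coord_ring C n).
Local Notation X := (genX C n).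
Local Notation Y := (genY C n).
Local Notation N := (n * n + n * n)%N.

Definition polX : 'M[P]_n := \matrix_(i, j) 'X_(xidx i j).
Definition polY : 'M[P]_n := \matrix_(i, j) 'X_(yidx i j).

Lemma genXE : X = map_mx (@tofrac P) polX.
Proof. by apply/matrixP => i j; rewrite !mxE. Qed.
Lemma genYE : Y = map_mx (@tofrac P) polY.
Proof. by apply/matrixP => i j; rewrite !mxE. Qed.

Definition point (X0 Y0 : 'M[C]_n) (v : 'I_N) : C :=
  match split v with inl u => mxvec X0 0 u | inr u => mxvec Y0 0 u end.

Definition evalp (X0 Y0 : 'M[C]_n) : {rmorphism P -> C} := @meval N C (point X0 Y0).

Lemma evalp_X X0 Y0 : map_mx (evalp X0 Y0) polX = X0.
Proof.
apply/matrixP => i j; rewrite !mxE /evalp /= mevalXU /point /xidx.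
by rewrite (unsplitK (inl _)) mxvecE.
Qed.

Lemma evalp_Y X0 Y0 : map_mx (evalp X0 Y0) polY = Y0.
Proof.
apply/matrixP => i j; rewrite !mxE /evalp /= mevalXU /point /yidx.
by rewrite (unsplitK (inr _)) mxvecE.
Qed.

(** Evaluation at a point is a ring morphism on polynomials and commutes with
   determinants. *)
Lemma det_generic r (A : 'M[K]_r) (M : 'M[P]_r) X0 Y0 : A = map_mx (@tofrac P) M ->
  \det (map_mx (evalp X0 Y0) M) != 0 -> \det A != 0.
Proof.
move=> -> h; rewrite det_map_mx tofrac_eq0.
by apply: contraNneq h => e; rewrite det_map_mx e rmorph0.
Qed.

Lemma minor_generic r s t : (s + r <= n)%N -> (t + r <= n)%N ->
  minor r s t X != 0 /\ minor r s t Y != 0.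
Proof.
move=> sr tr.
have ls (i : 'I_r) : (s + i < n)%N by have := ltn_ord i; lia.
have lt (i : 'I_r) : (t + i < n)%N by have := ltn_ord i; lia.
pose f i := Ordinal (ls i); pose g i := Ordinal (lt i).
(* The shifted identity matrix for which the chosen submatrix is the identity. *)
pose Z : 'M[C]_n := \matrix_(a, b) (a + t == b + s)%N%:R.
have sub (A : 'M[K]_n) : Sel r s *m A *m (Sel r t)^T = mxsub f g A.
  apply/matrixP => i j; rewrite [RHS]mxE.
  by rewrite (@mul_SelT _ _ _ _ _ _ _ _ (g j)) // (@Sel_mul _ _ _ _ _ _ _ (f i)).
have Z1 : mxsub f g Z = 1%:M.
  by apply/matrixP => i j; rewrite !mxE /= -val_eqE /=; congr (_%:R); lia.
split; rewrite /minor sub.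
- apply: (@det_generic _ _ (mxsub f g polX) Z Z).
    by apply/matrixP => i j; rewrite !mxE.
  have -> : map_mx (evalp Z Z) (mxsub f g polX) = mxsub f g (map_mx (evalp Z Z) polX).
    by apply/matrixP => i j; rewrite !mxE.
  by rewrite evalp_X Z1 det1 oner_neq0.
- apply: (@det_generic _ _ (mxsub f g polY) Z Z).
    by apply/matrixP => i j; rewrite !mxE.
  have -> : map_mx (evalp Z Z) (mxsub f g polY) = mxsub f g (map_mx (evalp Z Z) polY).
    by apply/matrixP => i j; rewrite !mxE.
  by rewrite evalp_Y Z1 det1 oner_neq0.
Qed.

Lemma genX_unit : X \in unitmx.
Proof.
have [h _] := @minor_generic n 0 0 (leqnn _) (leqnn _).
by rewrite unitmxE unitfE -minor_full.
Qed.

Lemma mixed_minor_generic k l : (k + l <= n)%N -> mixed_minor X Y k l != 0.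
Proof.
move=> kl.
have lf (i : 'I_(k + l)) : (n - (k + l) + i < n)%N by have := ltn_ord i; lia.
have lg (i : 'I_k) : (n - k + i < n)%N by have := ltn_ord i; lia.
have lh (i : 'I_l) : (n - l + i < n)%N by have := ltn_ord i; lia.
pose f i := Ordinal (lf i); pose g i := Ordinal (lg i); pose h i := Ordinal (lh i).
(* Together with the last [l] columns of the identity, the last [k] columns of [Z] form
   the last [k + l] basis vectors. *)
pose Z : 'M[C]_n := \matrix_(a, b) (a + l == b)%N%:R.
pose M : 'M[P]_(k + l) := row_mx (mxsub f g polX) (mxsub f h polY).
rewrite /mixed_minor; apply: (@det_generic _ _ M Z 1%:M).
  apply/matrixP => i j; rewrite (@Sel_mul _ _ _ _ _ _ _ (f i)) // !mxE.
  case: splitP => c ec.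
    by rewrite (@mul_SelT _ _ _ _ _ _ _ _ (g c)) // !mxE.
  by rewrite (@mul_SelT _ _ _ _ _ _ _ _ (h c)) // !mxE.
have -> : map_mx (evalp Z 1%:M) M = row_mx (mxsub f g (map_mx (evalp Z 1%:M) polX))
    (mxsub f h (map_mx (evalp Z 1%:M) polY)).
  by rewrite map_row_mx; congr row_mx; apply/matrixP => i j; rewrite !mxE.
rewrite evalp_X evalp_Y (_ : row_mx _ _ = 1%:M) ?det1 ?oner_neq0 //.
apply/matrixP => i j; rewrite !mxE; have li := ltn_ord i; have lj := ltn_ord j.
by case: splitP => c ec; rewrite !mxE -!val_eqE /=; have lc := ltn_ord c; congr (_%:R); lia.
Qed.

Lemma psi_generic k l : (0 < k)%N -> (0 < l)%N -> (k + l <= n)%N ->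
  psi (invmx X *m Y) k l != 0.
Proof.
move=> k0 l0 kl; set U := invmx X *m Y.
pose V : 'M[K]_n := \adj X *m Y.
have VE : V = \det X *: U.
  rewrite /V /U /invmx genX_unit -scalemxAl scalerA mulfV ?scale1r //.
  by rewrite -unitfE -unitmxE genX_unit.
apply: (@psi_scale_neq0 _ _ _ (\det X)) => //; rewrite -VE psi_cols //.
(* [U0] maps basis vectors to basis vectors, in such a way that the columns of [psi_mx]
   are distinct basis vectors: the last one goes to the first one, whose iterates run
   through the initial vectors, and the [l - 1] ones before it fill the gap before the
   last [k]. *)
pose U0 : 'M[C]_n := \matrix_(a, b)
  (if b == n.-1 :> nat then a == 0%N :> nat
   else if (n - l <= b)%N then (a + k == b.+1)%N else (a == b.+1 :> nat))%:R.
pose M : 'M[P]_n := \matrix_(a, j) psicol (\adj polX *m polY) k l j a 0.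
apply: (@det_generic _ _ M 1%:M U0).
  have -> : V = map_mx (@tofrac P) (\adj polX *m polY).
    by rewrite map_mxM map_mx_adj -genXE -genYE.
  by apply/matrixP => a j; rewrite !mxE -map_psicol mxE.
have -> : map_mx (evalp 1%:M U0) M = \matrix_(a, j) psicol U0 k l j a 0.
  have e : map_mx (evalp 1%:M U0) (\adj polX *m polY) = U0.
    by rewrite map_mxM map_mx_adj evalp_X evalp_Y adj1 mul1mx.
  by apply/matrixP => a j; rewrite !mxE -[in RHS]e -map_psicol mxE.
have Ue (b : nat) (c : nat) : (b < n)%N ->
   (if b == n.-1 then c = 0%N else if (n - l <= b)%N then (c + k = b.+1)%N else c = b.+1) ->
   U0 *m ei b = ei c.
  move=> bn hc; apply/colP => a; rewrite -[b]/(nat_of_ord (Ordinal bn)).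
  rewrite (mul_ei U0 a 0 (Ordinal bn)) !mxE /=; congr (_%:R).
  by move: hc; case: ifP => _; [move=> ->|case: ifP => _; lia].
have pw s : (s <= n - k - l)%N -> U0 ^+ s.+1 *m ei n.-1 = ei s.
  elim: s => [|s IH] sm; first by rewrite expr1; apply: Ue; rewrite ?eqxx //; lia.
  rewrite exprS [U0 * _](_ : _ = U0 *m U0 ^+ s.+1) // -mulmxA IH; last by lia.
  by apply: Ue; [lia|rewrite ifF; [rewrite ifF; lia|lia]].
pose sg j := if (j < k)%N then (n - k + j)%N else
  if (j < (k + l).-1)%N then (n - l + (j - k) - k).+1 else (j - (k + l).-1)%N.
have colE (j : 'I_n) : psicol U0 k l j = ei (sg j).
  have lj := ltn_ord j; rewrite /psicol /sg; case: ifP => h1 //.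
  case: (ltnP j (k + l).-1) => h2.
    rewrite ifT; last by lia.
    by apply: Ue; [lia|rewrite ifF; [rewrite ifT; lia|lia]].
  case: ifP => h3.
    apply: Ue; first by lia.
    by rewrite ifT; lia.
  rewrite (_ : (j - (k + l).-1 = (j - (k + l)).+1)%N); last by lia.
  by apply: pw; lia.
set M0 := \matrix_(a, j) _.
have : M0^T *m M0 = 1%:M.
  apply/matrixP => i j; rewrite mxE.
  have li := ltn_ord i; have lj := ltn_ord j.
  have si : (sg i < n)%N by rewrite /sg; case: ifP => // h1; try lia; case: ifP => //; lia.
  rewrite (bigD1 (Ordinal si)) //= !mxE !colE !mxE /= eqxx mul1r big1 ?addr0.
    congr (_%:R); rewrite -val_eqE /= /sg.
    by do 4?case: ifP; lia.
  by move=> a ai; rewrite !mxE colE mxE (_ : (_ == _) = false) ?mul0r //; apply/negP => /eqP h;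
    case/negP: ai; apply/eqP/val_inj.
move/(congr1 (@determinant _ _)); rewrite det_mulmx det_tr det1 => h.
by apply/eqP => h0; move: h; rewrite h0 mulr0 => /eqP; rewrite eq_sym oner_eq0.
Qed.
End Generic.

(** * The Jacobian criterion *)

Section Jacobian.
Variables (k K : fieldType) (iota : {rmorphism k -> K}).
Hypothesis char0 : forall m, m.+1%:R != 0 :> k.

Lemma der_evalfam (d : K -> K) (s : seq K) (p : {mpoly k[size s]}) :
  derivation d -> (forall c, d (iota c) = 0) ->
  d (evalfam iota p) =
  \sum_i evalfam iota (mderiv i p) * d (tnth (in_tuple s) i).
Proof.
move=> dP dc; pose Q (q : {mpoly k[size s]}) := d (evalfam iota q) =
  \sum_i evalfam iota (mderiv i q) * d (tnth (in_tuple s) i).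
have QD p1 p2 : Q p1 -> Q p2 -> Q (p1 + p2).
  rewrite /Q /evalfam !mmapD (derD dP) => -> ->; rewrite -big_split /=.
  by apply: eq_bigr => i _; rewrite mderivD mmapD mulrDl.
have QM p1 p2 : Q p1 -> Q p2 -> Q (p1 * p2).
  rewrite /Q /evalfam !rmorphM (derM dP) => -> ->.
  rewrite mulr_suml mulr_sumr -big_split /=.
  by apply: eq_bigr => i _; rewrite mderivM mmapD !rmorphM mulrDl mulrAC mulrA.
have QC c : Q c%:MP.
  rewrite /Q /evalfam mmapC dc big1 // => i _.
  by rewrite mderivC mmap0 mul0r.
have QX i : Q 'X_i.
  rewrite /Q /evalfam mmapX mmap1U (bigD1 i) //= mderivX mnm1E eqxx scale1r.
  rewrite (_ : (U_(i) - U_(i))%MM = 0%MM); last by apply/mnmP => j; rewrite mnmBE mnm0E subnn.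
  rewrite mmapX mmap11 mul1r big1 ?addr0 // => j ji.
  by rewrite mderivX mnm1E eq_sym (negPf ji) scale0r mmap0 mul0r.
have Q1 : Q 1 by rewrite -mpolyC1.
have QXm m : Q 'X_[m].
  rewrite mpolyXE_id; apply: (big_ind Q) => // i _.
  elim: (m i) => [|e IH]; first by rewrite expr0.
  by rewrite exprS; apply: QM.
suff : Q p by [].
rewrite [p]mpolyE; apply: (big_ind Q) => //; first by rewrite -mpolyC0.
by move=> m _; rewrite -mul_mpolyC; apply: QM.
Qed.

(** Applying every [D v] to a relation [p] shows that the partial derivatives of [p],
   evaluated at the family, are in the kernel of the invertible Jacobian matrix,
   hence zero. So the partial derivatives are relations of smaller degree, which
   vanish identically by induction, and [p] is constant. *)
Lemma jacobian_independent (s : seq K) N (D : 'I_N -> K -> K) : size s = N ->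
  (forall v, derivation (D v)) -> (forall v c, D v (iota c) = 0) ->
  (forall c : 'cV[K]_N, (forall x, x \in s -> \sum_v D v x * c v 0 = 0) -> c = 0) ->
  alg_independent iota s.
Proof.
move=> sN DP Dc ker.
pose J : 'M[K]_(size s, N) := \matrix_(i, v) D v (tnth (in_tuple s) i).
have freeJ : row_free J.
  suff : row_free J^T by rewrite /row_free mxrank_tr => /eqP ->; rewrite sN.
  apply: inj_row_free => v vJ; apply: trmx_inj; rewrite trmx0; apply: ker => x.
  case/(nthP 0) => i si <-; pose i' := Ordinal si.
  have := congr1 (fun A : 'M_(_, _) => A 0 i') vJ; rewrite !mxE => h.
  rewrite -[RHS]h; apply: eq_bigr => w _; rewrite !mxE mulrC.
  by rewrite (tnth_nth 0).
move=> p; have [b hb] : exists b, forall m, p@_m != 0 -> (mdeg m < b)%N.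
  by exists (msize p) => m; rewrite -mcoeff_msupp; apply: msize_mdeg_lt.
elim: b p hb => [|b IH] p hb ep.
  by apply/mpolyP => m; rewrite mcoeff0; apply/eqP/negPn/negP => /hb.
pose r := \row_i evalfam iota (mderiv i p).
have rJ : r *m J = 0.
  apply/matrixP => x v; rewrite [RHS]mxE mxE.
  have := der_evalfam p (DP v) (Dc v); rewrite ep (der0 (DP v)) => h.
  by rewrite [RHS]h; apply: eq_bigr => i _; rewrite !mxE.
have r0 : r = 0 by apply: (row_free_inj freeJ); rewrite rJ mul0mx.
have dp0 i : mderiv i p = 0.
  apply: IH => [m|]; last by have := congr1 (fun A : 'rV_(_) => A 0 i) r0; rewrite !mxE.
  rewrite mcoeff_mderiv => h; have /hb : p@_(m + U_(i)) != 0.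
    by apply: contraNneq h => ->; rewrite mul0rn.
  by rewrite mdegD mdeg1 addn1 ltnS.
have pC : p = (p@_0)%:MP.
  apply/mpolyP => m; rewrite mcoeffC; have [->|m0] := eqVneq m 0%MM.
    by rewrite mulr1.
  rewrite mulr0; have [i mi] : exists i, m i != 0%N.
    apply/existsP; apply: contraNT m0; rewrite negb_exists => /forallP h.
    by apply/eqP/mnmP => i; rewrite mnm0E; apply/eqP; have := h i; rewrite negbK.
  have /mpolyP/(_ (m - U_(i))%MM) := dp0 i; rewrite mcoeff_mderiv mcoeff0.
  have -> : (m - U_(i) + U_(i))%MM = m.
    by apply/mnmP => j; rewrite mnmDE mnmBE mnm1E; case: eqP => [<-|_]; lia.
  move=> /eqP; rewrite -mulr_natr mulf_eq0 => /orP [/eqP //|].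
  by rewrite (negPf (char0 _)).
move: ep; rewrite pC /evalfam mmapC => /eqP; rewrite fmorph_eq0 => /eqP ->.
by rewrite mpolyC0.
Qed.
End Jacobian.

(** * Counting monomials: more rational functions than variables are dependent *)

Section Counting.
Variables (k : fieldType) (N : nat).
Local Notation P := {mpoly k[N]}.
Local Notation K := {fraction P}.

Lemma dependent_rows m p (A : 'M[k]_(m, p)) : (p < m)%N ->
  exists2 u : 'rV[k]_m, u *m A = 0 & u != 0.
Proof.
move=> pm; have : kermx A != 0.
  rewrite -mxrank_eq0 mxrank_ker subn_eq0 -ltnNge.
  exact: leq_ltn_trans (rank_leq_col _) pm.
by case/rowV0Pn => u /sub_kermxP uA u0; exists u.
Qed.

Definition degle e (p : P) := forall m, p@_m != 0 -> (mdeg m <= e)%N.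

Lemma degle_mul e f p q : degle e p -> degle f q -> degle (e + f) (p * q).
Proof.
move=> dp dq m; rewrite -mcoeff_msupp => /msuppM_le /allpairsP [[m1 m2] /= [h1 h2 ->]].
by rewrite mdegD leq_add ?dp ?dq // -mcoeff_msupp.
Qed.

Lemma degle_exp e p j : degle e p -> degle (j * e) (p ^+ j).
Proof.
move=> dp; elim: j => [|j IH]; last by rewrite exprS mulSn; apply: degle_mul.
move=> m; rewrite expr0 mcoeff1; case: (m =P 0%MM) => [->|]; first by rewrite mdeg0.
by rewrite eqxx.
Qed.

Lemma degle_prod (I : finType) (e : I -> nat) (F : I -> P) :
  (forall i, degle (e i) (F i)) -> degle (\sum_i e i) (\prod_i F i).
Proof.
move=> H; apply: (big_ind2 degle) => //; last by move=> *; apply: degle_mul.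
move=> m; rewrite mcoeff1; case: (m =P 0%MM) => [->|]; first by rewrite mdeg0.
by rewrite eqxx.
Qed.

Lemma degle_exists (I : finType) (F : I -> P) : exists e, forall i, degle e (F i).
Proof.
exists (\max_i msize (F i)) => i m hm; apply: ltnW; apply: leq_trans (leq_bigmax i).
by apply: msize_mdeg_lt; rewrite mcoeff_msupp.
Qed.

Lemma common_denominator (I : finType) (x : I -> K) :
  exists b a, b != 0 /\ forall i, x i = tofrac (a i) / tofrac b.
Proof.
pose den i : P := \d_(repr (x i)); pose num i : P := \n_(repr (x i)).
have d0 i : den i != 0 := denom_ratioP _.
exists (\prod_i den i), (fun i => num i * \prod_(j | j != i) den j).
split; first by apply/prodf_neq0 => i _.
move=> i; rewrite {1}(frac_reprE (x i)) [\prod_j den j](bigD1 i) //= !rmorphM /= invfM mulrACA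
  divff ?mulr1 //.
by rewrite tofrac_eq0; apply/prodf_neq0 => j _.
Qed.

(** The monomials of degree at most [q] in each of the [t > N] functions, multiplied
   by a common denominator, are polynomials of degrees linear in [q]; for large [q]
   they outnumber the monomials of these degrees in [N] variables. *)
Lemma monomials_dependent t (x : 'I_t -> K) : (N < t)%N ->
  exists q (u : {ffun 'I_t -> 'I_q.+1} -> k), (exists al, u al != 0) /\
    \sum_al tofrac ((u al)%:MP : P) * \prod_i x i ^+ al i = 0 :> K.
Proof.
move=> Nt; have [b [a [b0 xE]]] := common_denominator x.
have [e eP] := degle_exists (fun o : option 'I_t => if o is Some i then a i else b).
(* [e] bounds all degrees, so the polynomials have degree at most [e * t * q]; any
   [q] at least [(e * t + 1) ^ N] makes [(e * t * q + 1) ^ N < (q + 1) ^ t]. *)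
pose c := (e * t).+1.
pose q := (c ^ N)%N; pose D := (t * q)%N; pose Q := (e * D)%N.
have count : (Q.+1 ^ N < q.+1 ^ t)%N.
  have h1 : (Q.+1 <= c * q.+1)%N.
    rewrite /c mulSn /Q /D mulnA mulnSr; set z := (e * t * q)%N; lia.
  have h2 : (Q.+1 ^ N <= q * q.+1 ^ N)%N.
    rewrite /q -/q (_ : (c ^ N * q.+1 ^ N)%N = ((c * q.+1) ^ N)%N) ?expnMn //.
    by rewrite -expnMn; case: (N) => // N'; rewrite leq_exp2r.
  apply: (leq_ltn_trans h2); apply: (@leq_trans (q.+1 ^ N.+1)).
    by rewrite expnS ltn_pmul2r ?expn_gt0.
  by rewrite leq_pexp2l.
pose I := {ffun 'I_t -> 'I_q.+1}; pose Jt := {ffun 'I_N -> 'I_Q.+1}.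
pose f (al : I) : P := b ^+ (D - \sum_i al i) * \prod_i a i ^+ al i.
have sumD (al : I) : (\sum_i al i <= D)%N.
  rewrite /D -[t in (t * q)%N]card_ord -sum_nat_const leq_sum // => i _.
  by rewrite -ltnS.
have fdeg al : degle Q (f al).
  have db : degle e b := eP None.
  have da i : degle (al i * e) (a i ^+ al i) := degle_exp (eP (Some i)).
  have := degle_mul (degle_exp (j := D - \sum_i al i) db) (degle_prod da).
  by rewrite -big_distrl -mulnDl /= subnK // mulnC.
pose mon (mu : Jt) : 'X_{1..N} := [multinom (mu i : nat) | i < N].
pose A : 'M[k]_(#|I|, #|Jt|) := \matrix_(i, j) (f (enum_val i))@_(mon (enum_val j)).
have [|u uA u0] := dependent_rows A.
  by rewrite !card_ffun !card_ord.
exists q, (fun al => u 0 (enum_rank al)); split.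
  have [i ui] : exists i, u 0 i != 0.
    apply/existsP; apply: contraNT u0; rewrite negb_exists => /forallP h.
    by apply/eqP/rowP => i; rewrite mxE; apply/eqP; have := h i; rewrite negbK.
  by exists (enum_val i); rewrite enum_valK.
have rel : \sum_(al : I) (u 0 (enum_rank al)) *: f al = 0.
  apply/mpolyP => m; rewrite mcoeff0 raddf_sum /=.
  have [mQ|Qm] := leqP (mdeg m) Q; last first.
    rewrite big1 // => al _; rewrite mcoeffZ; have [->|h] := eqVneq (f al)@_m 0.
      by rewrite mulr0.
    by have := fdeg al m h; lia.
  have mi i : (m i < Q.+1)%N.
    by rewrite ltnS (leq_trans _ mQ) // mdegE (bigD1 i) //= leq_addr.
  pose mu : Jt := [ffun i => Ordinal (mi i)].
  have emu : mon mu = m by apply/mnmP => i; rewrite mnmE ffunE.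
  have := congr1 (fun M : 'M_(_, _) => M 0 (enum_rank mu)) uA; rewrite !mxE => h.
  rewrite -[RHS]h (reindex_onto (@enum_val _ _) (@enum_rank _)) /=; last first.
    by move=> al _; rewrite enum_rankK.
  apply: eq_big => [i|i _]; first by rewrite enum_valK eqxx.
  by rewrite mcoeffZ enum_valK mxE enum_rankK emu.
have tb0 : tofrac b != 0 :> K by rewrite tofrac_eq0.
have fE al : tofrac (f al) = tofrac b ^+ D * \prod_i x i ^+ al i.
  rewrite /f tofracM rmorphXn rmorph_prod /=.
  rewrite (eq_bigr (fun i => x i ^+ al i * tofrac b ^+ al i)); last first.
    by move=> i _; rewrite rmorphXn /= xE -exprMn divfK.
  by rewrite big_split /= -expr_sum mulrCA -exprD subnK // mulrC.
have := congr1 (@tofrac P) rel; rewrite rmorph_sum tofrac0 /= => h.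
apply: (mulfI (expf_neq0 D tb0)); rewrite mulr0 mulr_sumr -[RHS]h.
by apply: eq_bigr => al _; rewrite -mul_mpolyC tofracM fE mulrCA.
Qed.
End Counting.

Section Algebraic.
Variables (k : fieldType) (N : nat).
Local Notation P := {mpoly k[N]}.
Local Notation K := {fraction P}.
Variable iota : {rmorphism k -> K}.
Hypothesis iotaE : forall c, iota c = tofrac (c%:MP : P).

Lemma evalfam_monom (s : seq K) (c : k) (m : 'X_{1..size s}) :
  evalfam iota (c *: 'X_[m]) = iota c * \prod_i tnth (in_tuple s) i ^+ m i.
Proof. by rewrite /evalfam mmapZ mmapX. Qed.

(** A relation between monomials in [z] and the family is regrouped by powers of [z];
   by independence some coefficient is nonzero. *)
Lemma independent_algebraic (s : seq K) : (N <= size s)%N ->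
  alg_independent iota s -> forall z, algebraic_over_gen iota s z.
Proof.
move=> Ns indep z.
pose x (i : 'I_(size s).+1) :=
  if unlift ord0 i is Some j then tnth (in_tuple s) j else z.
have x0 : x ord0 = z by rewrite /x unlift_none.
have xl j : x (lift ord0 j) = tnth (in_tuple s) j by rewrite /x liftK.
have [q [u [[al0 ual0] rel]]] := @monomials_dependent k N _ x Ns.
pose mon (al : {ffun 'I_(size s).+1 -> 'I_q.+1}) : 'X_{1..size s} :=
  [multinom (al (lift ord0 j) : nat) | j < size s].
pose g (be : 'I_q.+1) : {mpoly k[size s]} := \sum_(al : {ffun 'I_(size s).+1 ->
  'I_q.+1} | al ord0 == be) u al *: 'X_[mon al].
have gE be : evalfam iota (g be) =
    \sum_(al : {ffun 'I_(size s).+1 -> 'I_q.+1} | al ord0 == be) iota (u al) * \prod_j tnth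
      (in_tuple s) j ^+ al (lift ord0 j).
  rewrite /evalfam /g rmorph_sum /=; apply: eq_bigr => al _.
  rewrite -/(evalfam iota _) evalfam_monom; congr (_ * _).
  by apply: eq_bigr => j _; rewrite mnmE.
pose p := \poly_(i < q.+1) evalfam iota (g (inord i)).
have coefE i : p`_i = if (i < q.+1)%N then evalfam iota (g (inord i)) else 0 by rewrite coef_poly.
exists p; split.
- apply/eqP => p0; have := coefE (al0 ord0); rewrite p0 coef0 ltn_ord inord_val => /esym /indep.
  move/mpolyP/(_ (mon al0)); rewrite mcoeff0 /g raddf_sum /= (bigD1 al0) //= mcoeffZ mcoeffX eqxx
    mulr1.
  rewrite big1 ?addr0 => [e|al /andP [/eqP a0 ne]]; first by rewrite e eqxx in ual0.
  rewrite mcoeffZ mcoeffX; case: eqP => [e|_]; last by rewrite mulr0.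
  case/eqP: ne; apply/ffunP => i; case: (unliftP ord0 i) => [j ->|-> //].
  by have /mnmP/(_ j) := e; rewrite !mnmE => /val_inj.
- move=> i; rewrite coefE; case: ifP => _; last first.
    exists 0, 1; rewrite /evalfam rmorph0 rmorph1 mul0r; split=> //; exact: oner_neq0.
  exists (g (inord i)), 1; rewrite /evalfam rmorph1 divr1; split=> //; exact: oner_neq0.
- rewrite /root horner_poly; apply/eqP.
  rewrite -[RHS]rel (partition_big (fun al : {ffun _ -> 'I_q.+1} => al ord0) xpredT) //=.
  apply: eq_bigr => be _; rewrite inord_val gE mulr_suml; apply: eq_bigr => al /eqP a0.
  rewrite iotaE -mulrA big_ord_recl x0 a0; congr (_ * _); rewrite mulrC; congr (_ * _).
  by apply: eq_bigr => j _; rewrite xl.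
Qed.
End Algebraic.

(** * Size of the family and algebraic independence *)

Lemma size_family (K : fieldType) n (X Y : 'M[K]_n) : (0 < n)%N ->
  size (family_F X Y) = (2 * n ^ 2)%N.
Proof.
move=> n0; rewrite /family_F !size_cat !size_allpairs_dep size_map !size_iota !sumnE !big_map.
have -> : (\sum_(j <- index_iota 1 n.+1) size (index_iota 1 j.+1) =
           \sum_(1 <= j < n.+1) j)%N.
  by apply: eq_bigr => j _; rewrite size_iota subn1.
have -> : (\sum_(j <- index_iota 1 n.+1) size (index_iota j n.+1) =
           \sum_(1 <= j < n.+1) (n.+1 - j))%N.
  by apply: eq_bigr => j _; rewrite size_iota.
have -> : (\sum_(j <- index_iota 1 n) size (index_iota 1 (n - j)) =
           \sum_(1 <= j < n) (n - j).-1)%N.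
  by apply: eq_bigr => j _; rewrite size_iota subn1.
have -> : (\sum_(j <- index_iota 1 n) size (index_iota 1 (n - j).+1) =
           \sum_(1 <= j < n) (n - j))%N.
  by apply: eq_bigr => j _; rewrite size_iota subn1.
rewrite addnA -big_split /= [X in (X + _)%N](_ : _ = n * n.+1)%N; last first.
  rewrite (eq_big_nat _ _ (F2 := fun=> n.+1)) => [|j hj]; last by rewrite subnKC //; lia.
  by rewrite sum_nat_const_nat subn1.
rewrite [X in (_ + X)%N]addnA -big_split /= big_nat_rev /=.
have -> : (\sum_(1 <= i < n) ((n - (1 + n - i.+1)).-1 + (n - (1 + n - i.+1))) = n.-1 ^ 2)%N.
  rewrite (eq_big_nat _ _ (F2 := fun i => (i.-1 + i)%N)) => [|j hj]; last by lia.
  case: (n) n0 => // m _; elim: m => [|m IH]; first by rewrite big_geq.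
  rewrite big_nat_recr //= IH; lia.
case: (n) n0 => // m _ /=; lia.
Qed.

Section Main.
Variables (C : fieldType) (n : nat).
Hypothesis char0 : forall m, m.+1%:R != 0 :> C.
Hypothesis n2 : (1 < n)%N.
Local Notation K := (funfield C n).
Local Notation X := (genX C n).
Local Notation Y := (genY C n).
Local Notation N := (n * n + n * n)%N.

Lemma funfield_char0 m : m.+1%:R != 0 :> K.
Proof. by rewrite -(rmorph_nat (funconst C n)) fmorph_eq0. Qed.

Lemma family_log_canonical : log_canonical_system (family_F X Y).
Proof.
have sz : size (family_F X Y) = N.
  by rewrite size_family; [rewrite mulSn mul1n -mulnn|lia].
have mX r s t : (s + r <= n)%N -> (t + r <= n)%N -> minor r s t X != 0.
  by move=> h1 h2; exact: (minor_generic C h1 h2).1.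
have mY r s t : (s + r <= n)%N -> (t + r <= n)%N -> minor r s t Y != 0.
  by move=> h1 h2; exact: (minor_generic C h1 h2).2.
split; last first.
  move=> x y hx hy.
  exact: (family_logcan funfield_char0 (genX_unit C n) mX mY (@mixed_minor_generic C n)
    (@psi_generic C n) hx hy).
have indep : alg_independent (funconst C n) (family_F X Y).
  apply: (@jacobian_independent _ _ _ char0 _ N (fun v => @fracderiv C n v) sz).
  - exact: fracderiv_derivation.
  - by move=> v c; apply: fracderiv_const.
  move=> c kill; pose d (x : K) := \sum_v fracderiv v x * c v 0.
  have dP : derivation d.
    split=> x y; rewrite /d.
      by rewrite -big_split /=; apply: eq_bigr => v _;
        rewrite (derD (@fracderiv_derivation C n v)) mulrDl.
    rewrite mulr_suml mulr_sumr -big_split /=; apply: eq_bigr => v _.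
    by rewrite (derM (@fracderiv_derivation C n v)) mulrDl -!mulrA (mulrC y).
  have dvar w : d (tofrac 'X_w) = c w 0.
    rewrite /d (bigD1 w) //= fracderiv_var eqxx mul1r big1 ?addr0 // => v vw.
    by rewrite fracderiv_var eq_sym (negPf vw) mul0r.
  have [dX dY] : map_mx d X = 0 /\ map_mx d Y = 0.
    apply: family_killed => //.
    - by move=> r t h; apply: mX => //; lia.
    - by move=> r t h; apply: mY => //; lia.
    - exact: mixed_minor_generic.
    - exact: psi_generic.
  apply/colP => w; rewrite [RHS]mxE -dvar.
  case: (split_ordP w) => u ->; case/mxvec_indexP: u => i j.
    by have /matrixP/(_ i j) := dX; rewrite !mxE.
  by have /matrixP/(_ i j) := dY; rewrite !mxE.
split=> // z; apply: independent_algebraic => //.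
by rewrite sz.
Qed.
End Main.

Theorem theorem3p2 (R : realType) (n : nat) (n_ge2 : (2 <= n)%N) :
  let F_n := family_F (genX (complex R) n) (genY (complex R) n) in
  size F_n = (2 * n ^ 2)%N /\ log_canonical_system F_n.
Proof.
split; first by apply: size_family; apply: leq_trans n_ge2.
by apply: family_log_canonical => // m; rewrite Num.Theory.pnatr_eq0.
Qed.
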